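(* Any solution of the first-order structure-preserving IVS scheme (Steps 1–3 of the context) satisfies the discrete mass conservation law $$(\phi^{n+1},1)=(\phi^n,1),\qquad \forall\,0\le n\le N_t-1.$$ Moreover, the discrete modified energy dissipation law holds: $$E^{n+1}(\phi,\bm u,R)-E^n(\phi,\bm u,R)\le -M\tau\|\nabla\mu^{n+1}\|^2-\frac{\nu\tau}{2}\big(\|\nabla\widehat{\bm u}^{n+1}\|^2+\|\nabla\bm u^{n+1}\|^2\big)$$ for $0\le n\le N_t-1$, where $$E^{n+1}(\phi,\bm u,R):=\frac12\|\bm u^{n+1}\|^2+\frac{\lambda}{2}\|\nabla\phi^{n+1}\|^2+\frac{\lambda\beta}{2}\|\phi^{n+1}\|^2+\lambda|R^{n+1}|^2 .$$
   Context: Let $\Omega\subset\mathbb R^d$, $d=2,3$, be an open bounded convex polygonal or polyhedral domain with unit outward normal $\bm n$; $(\cdot,\cdot)$ and $\|\cdot\|$ denote the (scalar or vector) $L^2(\Omega)$ inner product and norm. Let $M,\lambda,\nu,\epsilon,\beta,\theta>0$ be constants, $G(\phi)=\frac{1}{4\epsilon^2}(1-\phi^2)^2$, $F(\phi)=G(\phi)-\frac{\beta}{2}\phi^2$, $E_1(\phi)=\int_\Omega F(\phi)\,d\bm x$, and let $\delta_0>0$ be a constant such that $E_1(\phi)+\delta_0>0$ for all $\phi$. Put $\bm b(\bm u,\bm v,\bm w)=(\bm u\cdot\nabla\bm v,\bm w)$. Let $\tau=T/N_t$, and $\partial_\tau v^{n+1}=(v^{n+1}-v^n)/\tau$. First-order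 scheme for the Cahn–Hilliard–Navier–Stokes system: for $0\le n\le N_t-1$, given $(\phi^n,\mu^n,\bm u^n,p^n,R^n)$ (with $\nabla\cdot\bm u^n=0$ and $\bm u^n|_{\partial\Omega}=\bm 0$), put $\gamma^n=\frac{\theta}{\|\nabla p^n\|+1}$ and find $(\phi^{n+1},\mu^{n+1},\widehat{\bm u}^{n+1},R^{n+1},\bm u^{n+1},p^{n+1})$ such that, with $\xi^{n+1}=\frac{R^{n+1}}{\sqrt{E_1(\phi^n)+\delta_0}}$: Step 1: $\partial_\tau\phi^{n+1}+\xi^{n+1}\nabla\cdot(\bm u^n\phi^n)=M\Delta\mu^{n+1}$; $\ \mu^{n+1}=-\lambda\Delta\phi^{n+1}+\lambda\beta\phi^{n+1}+\lambda\xi^{n+1}F'(\phi^n)$; $\ \frac{\widehat{\bm u}^{n+1}-\bm u^n}{\tau}+\xi^{n+1}\bm u^n\cdot\nabla\bm u^n-\nu\Delta\widehat{\bm u}^{n+1}=-\xi^{n+1}(\phi^n\nabla\mu^n+\gamma^n\nabla p^n)$; with $\partial_{\bm n}\phi^{n+1}=\partial_{\bm n}\mu^{n+1}=0$ and $\widehat{\bm u}^{n+1}=\bm 0$ on $\partial\Omega$. Step 2: $\partial_\tau R^{n+1}=\frac{1}{2\lambda\sqrt{E_1(\phi^n)+\delta_0}}\big[\lambda(F'(\phi^n),\partial_\tau\phi^{n+1})+(\mu^{n+1},\nabla\cdot(\bm u^n\phi^n))+(\widehat{\bm u}^{n+1},\phi^n\nabla\mu^n)+\bm b(\bm u^n,\bm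 u^n,\widehat{\bm u}^{n+1})+\gamma^n(\nabla p^n,\widehat{\bm u}^{n+1})\big]$. Step 3: $\frac{\bm u^{n+1}-\widehat{\bm u}^{n+1}}{\tau}-\nu\Delta(\bm u^{n+1}-\widehat{\bm u}^{n+1})+\nabla p^{n+1}=\gamma^n\nabla p^n$, $\nabla\cdot\bm u^{n+1}=0$ in $\Omega$, $\bm u^{n+1}=\bm 0$ on $\partial\Omega$. All functions are in the class $\phi,\mu\in H^2(\Omega)$, $\bm u,\widehat{\bm u}\in (H^2(\Omega)\cap H^1_0(\Omega))^d$, $p\in H^1(\Omega)$, and $R\in\mathbb R$; also $\partial_{\bm n}\phi^0=\partial_{\bm n}\mu^0=0$ on $\partial\Omega$. *)

(* Defs.v *)
(* Points of R^d are row vectors 'rV[R]_d. *)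
From HB Require Import structures.
From mathcomp Require Import all_boot all_order all_algebra.
From mathcomp Require Import all_classical all_reals all_analysis.

Set Implicit Arguments.
Unset Strict Implicit.
Unset Printing Implicit Defensive.

Import Order.TTheory GRing.Theory Num.Theory.
Import numFieldNormedType.Exports.

Local Open Scope classical_set_scope.
Local Open Scope ring_scope.

Definition rV_display : measure_display.
Proof. exact: default_measure_display. Qed.

(* The sigma-algebra of 'rV[R]_n generated by the coordinates, i.e. the Borel
   sigma-algebra. *)
Section rV_measurable.
Context (R : realType) (n : nat).

Let coord (i : 'I_n) (x : 'rV[R]_n) : measurableTypeR R := x 0 i.

Let rV_set0 : g_sigma_preimage coord set0.
Proof. exact: sigma_algebra0. Qed.

Let rV_setC A : g_sigma_preimage coord A -> g_sigma_preimage coord (~` A).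
Proof. exact: sigma_algebraC. Qed.

Let rV_bigcup (F : (set 'rV[R]_n)^nat) :
  (forall i, g_sigma_preimage coord (F i)) ->
  g_sigma_preimage coord (\bigcup_i F i).
Proof. exact: sigma_algebra_bigcup. Qed.

HB.instance Definition _ := @isMeasurable.Build rV_display 'rV[R]_n
  (g_sigma_preimage coord) rV_set0 rV_setC rV_bigcup.

Lemma measurable_coord (i : 'I_n) :
  measurable_fun [set: 'rV[R]_n] (fun x => x 0 i : measurableTypeR R).
Proof.
move=> _ Y mY; rewrite setTI; apply: sub_sigma_algebra => /=.
rewrite -bigcup_seq/=; exists i => /=; first by rewrite mem_index_enum.
by exists Y => //; rewrite setTI.
Qed.

Lemma measurable_fun_rV d (T : measurableType d) (f : T -> 'rV[R]_n) :
  (forall i, measurable_fun setT (fun x => f x 0 i : measurableTypeR R)) ->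
  measurable_fun setT f.
Proof.
move=> mf.
apply: (@measurability _ _ _ _ setT f
  (\big[setU/set0]_(i < n) preimage_set_system setT (coord i) measurable)) => //.
move=> _ [B + <-]; rewrite -bigcup_seq/= => -[i _ [C mC <-]].
by rewrite !setTI; have := mf i measurableT C mC; rewrite setTI.
Qed.

End rV_measurable.

(* Lebesgue measure on 'rV[R]_n, by iterated products. *)
Section lebesgue_rV.
Context (R : realType).

Definition consv n (p : measurableTypeR R * 'rV[R]_n) : 'rV[R]_n.+1 :=
  row_mx (p.1%:M : 'rV[R]_1) p.2.

Definition unconsv n (x : 'rV[R]_n.+1) : measurableTypeR R * 'rV[R]_n :=
  (x 0 ord0, \row_i x 0 (lift ord0 i)).

Lemma consvK n : cancel (@consv n) (@unconsv n).
Proof.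
case=> a x; rewrite /unconsv /consv /=; congr pair.
  have -> : (ord0 : 'I_n.+1) = lshift n (ord0 : 'I_1) by exact/val_inj.
  by rewrite (@row_mxEl _ 1 1 n) mxE mulr1n.
apply/rowP => i; rewrite mxE.
have -> : lift ord0 i = rshift 1 i by exact/val_inj.
by rewrite (@row_mxEr _ 1 1 n).
Qed.

Lemma measurable_consv n : measurable_fun setT (@consv n).
Proof.
apply: measurable_fun_rV => i; rewrite /consv.
rewrite -[i](@splitK 1 n); case: (@fintype.split 1 n i) => j /=.
  under eq_fun do rewrite (@row_mxEl _ 1 1 n) mxE ord1 eqxx mulr1n.
  exact: measurable_fst.
under eq_fun do rewrite (@row_mxEr _ 1 1 n).
by apply: (measurableT_comp (@measurable_coord R n j)); exact: measurable_snd.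
Qed.

Lemma measurable_unconsv n : measurable_fun setT (@unconsv n).
Proof.
apply/measurable_fun_pairP; split; first exact: measurable_coord.
apply: measurable_fun_rV => i /=.
under eq_fun do rewrite mxE.
exact: measurable_coord.
Qed.

Definition leb_cons n
    (m1 : {sigma_finite_measure set (measurableTypeR R) -> \bar R})
    (m2 : {sigma_finite_measure set 'rV[R]_n -> \bar R}) :=
  pushforward (m1 \x m2)%E (@consv n).

Section leb_cons.
Context n (m1 : {sigma_finite_measure set (measurableTypeR R) -> \bar R})
  (m2 : {sigma_finite_measure set 'rV[R]_n -> \bar R}).

Let mu := measure_function_pushforward__canonical__measure_function_Measure
  (m1 \x m2)%E (@measurable_consv n).

Let leb_cons0 : leb_cons m1 m2 set0 = 0%E.
Proof. exact: (measure0 mu). Qed.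

Let leb_cons_ge0 A : (0 <= leb_cons m1 m2 A)%E.
Proof. exact: (measure_ge0 mu). Qed.

Let leb_cons_sigma_additive : semi_sigma_additive (leb_cons m1 m2).
Proof. exact: (@measure_semi_sigma_additive _ _ _ mu). Qed.

HB.instance Definition _ := isMeasure.Build _ _ _ (leb_cons m1 m2)
  leb_cons0 leb_cons_ge0 leb_cons_sigma_additive.

Let leb_cons_sigma_finite : sigma_finite setT (leb_cons m1 m2).
Proof.
have /sigma_finiteP[F [TF ndF Foo]] := sigma_finiteT m1.
have /sigma_finiteP[G [TG ndG Goo]] := sigma_finiteT m2.
exists (fun k => @unconsv n @^-1` (F k `*` G k)).
  rewrite -preimage_bigcup (_ : \bigcup_k (F k `*` G k) = setT).
    by rewrite preimage_setT.
  rewrite -setXTT TF TG predeqE => -[x y]; split.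
    by move=> [k _ [/= Fx Gy]]; split; exists k.
  move=> [/= [k _ Fkx] [l _ Gly]]; exists (maxn k l) => //; split.
  - by move: x Fkx; exact/subsetPset/ndF/leq_maxl.
  - by move: y Gly; exact/subsetPset/ndG/leq_maxr.
move=> k; have [mF Fk] := Foo k; have [mG Gk] := Goo k; split.
  rewrite -[X in measurable X]setTI; apply: measurable_unconsv => //.
  exact: measurableX.
rewrite /leb_cons /pushforward -comp_preimage (_ : _ \o _ = id); last first.
  by apply/funext => p /=; rewrite consvK.
by rewrite preimage_id product_measure1E// lte_mul_pinfty// ge0_fin_numE.
Qed.

HB.instance Definition _ := Measure_isSigmaFinite.Build _ _ _
  (leb_cons m1 m2) leb_cons_sigma_finite.

End leb_cons.

Fixpoint leb n : {sigma_finite_measure set 'rV[R]_n -> \bar R} :=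
  if n is n'.+1 then leb_cons (@lebesgue_measure R) (leb n')
  else \d_(0 : 'rV[R]_0).

End lebesgue_rV.
Arguments leb : clear implicits.

(* Euclidean inner product of vectors, Frobenius inner product of matrices. *)
Definition dotmx (R : realType) m n (A B : 'M[R]_(m, n)) : R :=
  \sum_i \sum_j A i j * B i j.

Section sobolev.
Context (R : realType) (d : nat).
Local Notation X := 'rV[R]_d.
Local Notation mu := (leb R d).
Implicit Types (Om K : set X) (f g v psi : X -> R) (i j : 'I_d).

Definition ip Om f g : R := \int[mu]_(x in Om) (f x * g x).
Definition L2norm Om f : R := Num.sqrt (ip Om f f).

Definition mxip m n Om (u v : X -> 'M[R]_(m, n)) : R :=
  \int[mu]_(x in Om) dotmx (u x) (v x).
Definition mxL2norm m n Om (u : X -> 'M[R]_(m, n)) : R :=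
  Num.sqrt (mxip Om u u).

Definition vcomp (u : X -> X) i : X -> R := fun x => u x 0 i.

Definition partial i f : X -> R := fun x => 'D_(delta_mx 0 i) f x.

Definition smooth f := forall s : seq 'I_d,
  let g := foldr partial f s in
  continuous g /\ forall i x, derivable g x (delta_mx 0 i).

Definition test_fun Om psi :=
  smooth psi /\ exists K, [/\ compact K, K `<=` Om &
    forall x, ~ K x -> psi x = 0].

Definition L2 Om f := measurable_fun Om f /\
  mu.-integrable Om (fun x => (f x ^+ 2)%:E).

Definition L1loc Om f := measurable_fun Om f /\
  forall K, compact K -> K `<=` Om -> mu.-integrable K (fun x => (f x)%:E).

Definition weak_partial Om i f g := [/\ L1loc Om f, L1loc Om g &
  forall psi, test_fun Om psi ->
    \int[mu]_(x in Om) (f x * partial i psi x) =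
    - \int[mu]_(x in Om) (g x * psi x)].

(* The weak derivative, determined up to a.e. equality on Om; the default
   value is only used when f has no weak derivative. *)
Definition wD Om i f : X -> R := xget (cst 0) [set g | weak_partial Om i f g].

Definition H1 Om f := L2 Om f /\
  forall i, (exists g, weak_partial Om i f g) /\ L2 Om (wD Om i f).

Definition H2 Om f := H1 Om f /\ forall i, H1 Om (wD Om i f).

Definition grad Om f : X -> X := fun x => \row_i wD Om i f x.

Definition H1norm Om f : R :=
  Num.sqrt (L2norm Om f ^+ 2 + mxL2norm Om (grad Om f) ^+ 2).

Definition H10 Om f := H1 Om f /\
  exists psi : nat -> X -> R, (forall k, test_fun Om (psi k)) /\
    (fun k => H1norm Om (fun x => psi k x - f x)) @ \oo --> (0 : R).

Definition H2_H10 Om (u : X -> X) :=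
  forall i, H2 Om (vcomp u i) /\ H10 Om (vcomp u i).

Definition lap Om f : X -> R := fun x => \sum_i wD Om i (wD Om i f) x.

Definition diverg Om (u : X -> X) : X -> R :=
  fun x => \sum_i wD Om i (vcomp u i) x.

(* Entry (i, j) is the j-th derivative of the i-th component. *)
Definition vgrad Om (u : X -> X) : X -> 'M[R]_d :=
  fun x => \matrix_(i, j) wD Om j (vcomp u i) x.

Definition vlap Om (u : X -> X) : X -> X :=
  fun x => \row_i lap Om (vcomp u i) x.

Definition advect Om (u v : X -> X) : X -> X :=
  fun x => \row_i \sum_j u x 0 j * wD Om j (vcomp v i) x.

Definition ae_eq_in Om T (f g : X -> T) :=
  {ae mu, forall x, Om x -> f x = g x}.

(* Open bounded convex polygon/polyhedron: a bounded nonempty intersection of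
   open half-spaces.  The boundary is covered by the faces
   [closure Om `&` {dotmx (nrm l) x = off l}], on which nrm l is the unit
   outward normal (redundant half-spaces give faces of zero surface measure). *)
Definition convex_polytope Om (m : nat) (nrm : 'I_m -> X) (off : 'I_m -> R) :=
  [/\ Om = [set x | forall l, dotmx (nrm l) x < off l],
      forall l, dotmx (nrm l) (nrm l) = 1, bounded_set Om & Om !=set0].

(* Surface integration on the face of Om in the hyperplane dotmx n x = b
   (n a unit vector): the surface measure of a subset of the hyperplane is the
   Lebesgue measure of the right prism of height 1 erected on it, so that
   g is integrated over the face by integrating its pull-back
   [g \o hproj n b] over [prism Om n b]. *)
Definition hproj (n : X) (b : R) (x : X) : X := x - (dotmx n x - b) *: n.

Definition prism Om (n : X) (b : R) : set X :=
  [set x | 0 < dotmx n x - b < 1 /\ closure Om (hproj n b x)].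

(* g is the trace of v on that face: the L2 limit on the face of smooth
   functions converging to v in H1. *)
Definition trace_on Om (n : X) (b : R) v g :=
  L2 (prism Om n b) (g \o hproj n b) /\
  exists psi : nat -> X -> R, [/\ forall k, smooth (psi k),
    (fun k => H1norm Om (fun x => psi k x - v x)) @ \oo --> (0 : R) &
    (fun k => L2norm (prism Om n b)
       ((fun x => psi k x - g x) \o hproj n b)) @ \oo --> (0 : R)].

(* Vanishing normal derivative on the whole boundary, face by face: g is the
   trace of the gradient. *)
Definition neumann0 Om (m : nat) (nrm : 'I_m -> X) (off : 'I_m -> R) f :=
  forall l, exists g : X -> X,
    (forall i, trace_on Om (nrm l) (off l) (wD Om i f) (vcomp g i)) /\
    {ae mu, forall x, prism Om (nrm l) (off l) x ->
       dotmx (nrm l) (g (hproj (nrm l) (off l) x)) = 0}.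

End sobolev.

Section scheme.
Context (R : realType) (d : nat).
Local Notation X := 'rV[R]_d.
Local Notation mu := (leb R d).
Context (Om : set X) (m : nat) (nrm : 'I_m -> X) (off : 'I_m -> R).
Context (M lam nu eps beta theta delta0 tau : R).

Definition Gpot (s : R) : R := (4 * eps ^+ 2)^-1 * (1 - s ^+ 2) ^+ 2.
Definition Fpot (s : R) : R := Gpot s - beta / 2 * s ^+ 2.
Definition E1 (f : X -> R) : R := \int[mu]_(x in Om) Fpot (f x).
Definition dF (f : X -> R) : X -> R := fun x => derive1 Fpot (f x).

Context (phi muc p : nat -> X -> R) (u uh : nat -> X -> X) (r : nat -> R).

Definition gam n : R := theta / (mxL2norm Om (grad Om (p n)) + 1).

(* xi n is the scalar with time index n + 1. *)
Definition xi n : R := r n.+1 / Num.sqrt (E1 (phi n) + delta0).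

Definition dtau (f : nat -> X -> R) n : X -> R :=
  fun x => (f n.+1 x - f n x) / tau.

Definition divuphi n : X -> R := diverg Om (fun x => phi n x *: u n x).

Definition phigradmu n : X -> X := fun x => phi n x *: grad Om (muc n) x.

Definition step1 n := [/\
  ae_eq_in Om (fun x => dtau phi n x + xi n * divuphi n x)
              (fun x => M * lap Om (muc n.+1) x),
  ae_eq_in Om (muc n.+1)
    (fun x => - lam * lap Om (phi n.+1) x + lam * beta * phi n.+1 x
              + lam * xi n * dF (phi n) x) &
  ae_eq_in Om
    (fun x => tau^-1 *: (uh n.+1 x - u n x) + xi n *: advect Om (u n) (u n) x
              - nu *: vlap Om (uh n.+1) x)
    (fun x => - (xi n *: (phigradmu n x + gam n *: grad Om (p n) x)))].

Definition step2 n :=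
  (r n.+1 - r n) / tau =
  (2 * lam * Num.sqrt (E1 (phi n) + delta0))^-1 *
  (lam * ip Om (dF (phi n)) (dtau phi n)
   + ip Om (muc n.+1) (divuphi n)
   + mxip Om (uh n.+1) (phigradmu n)
   + mxip Om (advect Om (u n) (u n)) (uh n.+1)
   + gam n * mxip Om (grad Om (p n)) (uh n.+1)).

Definition step3 n :=
  ae_eq_in Om
    (fun x => tau^-1 *: (u n.+1 x - uh n.+1 x)
              - nu *: vlap Om (fun y => u n.+1 y - uh n.+1 y) x
              + grad Om (p n.+1) x)
    (fun x => gam n *: grad Om (p n) x).

(* Homogeneous Dirichlet conditions are part of [H2_H10]. *)
Definition admissible n := [/\
  H2 Om (phi n) /\ neumann0 Om nrm off (phi n),
  H2 Om (muc n) /\ neumann0 Om nrm off (muc n),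
  H2_H10 Om (u n), ae_eq_in Om (diverg Om (u n)) (cst 0) & H1 Om (p n)].

Definition ivs_solution (Nt : nat) :=
  (forall n, (n <= Nt)%N -> admissible n) /\
  (forall n, (n < Nt)%N ->
     [/\ H2_H10 Om (uh n.+1), step1 n, step2 n & step3 n]).

Definition energy n : R :=
  2^-1 * mxL2norm Om (u n) ^+ 2
  + lam / 2 * mxL2norm Om (grad Om (phi n)) ^+ 2
  + lam * beta / 2 * L2norm Om (phi n) ^+ 2
  + lam * `|r n| ^+ 2.

End scheme.

(* Main.v *)
(** Test the phase equation with mu^{n+1}, the equation of mu^{n+1} with the
    increment of phi, the equation of the predicted velocity with that velocity
    and the equation of R with 2 lambda R^{n+1}: all terms carrying xi^{n+1}
    cancel.  Step 3 tested with u^{n+1} loses both pressure terms, as u^{n+1} is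
    divergence free and vanishes on the boundary.  Completing squares gives the
    energy law; mass conservation is the phase equation integrated over Omega.

    Two points need analysis.

    (a) Green's formula under the Neumann condition, which is stated face by face
    through L^2 traces.  Multiply the field by a cut-off built on the softmin
    (log-sum-exp) of the distances to the faces.  Its gradient is a convex
    combination of the normals times a factor of order 1/t, supported at distance
    O(t) from the boundary.  A field with vanishing normal trace on a face has
    normal component O(t) in the L^2 norm of the strip of width t along that face
    (Hardy), so the boundary contribution tends to 0 by Cauchy-Schwarz.

    (b) The trilinear terms must be integrable to be separated.  When xi^{n+1} is
    nonzero the equation of mu^{n+1} puts F'(phi^n), hence (phi^n)^3, in L^2, so
    that phi^n is in L^4; the predicted velocity is in L^4 by Ladyzhenskaya's
    inequality. *)

Require Import Defs.
From HB Require Import structures.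
From mathcomp Require Import all_boot all_order all_algebra.
From mathcomp Require Import all_classical all_reals all_analysis.
From mathcomp Require Import measurable_realfun ring lra.

Set Implicit Arguments.
Unset Strict Implicit.
Unset Printing Implicit Defensive.

Import Order.TTheory GRing.Theory Num.Theory.
Import numFieldNormedType.Exports.
Import Defs.

Local Open Scope classical_set_scope.
Local Open Scope ring_scope.

(** * Square integrable functions *)

(** Regularity is the obstacle. Terms such as the divergence of [phi u] or the convective term are
    only known to be in L^1, and [Rintegral] gives a default value on non-integrable functions, so a
    bracket may be split only after each summand is known to be integrable. The remedy is to read
    the equations backwards: such a term times [xi] equals almost everywhere a combination of L^2
    functions, hence is itself in L^2 and may be tested. Where [xi] is 0 the term drops out
    altogether.

    Green's formula involves two scales, the width [1/k] of the boundary layer and the sharpness [p]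
    of the softmin. Faces that are not nearest to a point enter with an exponentially small weight;
    [p] is chosen after [k], large enough to beat the factor [k] of the gradient. A nearest face is
    harmless because the foot of the perpendicular on it stays in the closed polytope, so that the
    segment towards it can be integrated along. Softmin is used instead of the minimum because test
    functions must be smooth. *)

Section real_integral.
Context {dsp : measure_display} {T : measurableType dsp} {R : realType}.
Variables (mu : {measure set T -> \bar R}) (D : set T).
Hypothesis mD : measurable D.
Implicit Types f g h : T -> R.

Definition intg f := mu.-integrable D (EFin \o f).

Definition sqi f := measurable_fun D f /\ mu.-integrable D (fun x => (f x ^+ 2)%:E).

Lemma intg_meas f : intg f -> measurable_fun D f.
Proof. by move=> /measurable_int/measurable_EFinP. Qed.

Lemma eq_intg f g : {in D, f =1 g} -> intg f -> intg g.
Proof. by move=> fg; apply: eq_integrable => // x xD; rewrite /= fg. Qed.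

Lemma intgD f g : intg f -> intg g -> intg (fun x => f x + g x).
Proof. by move=> fi gi; rewrite /intg; exact: (integrableD mD fi gi). Qed.

Lemma intgB f g : intg f -> intg g -> intg (fun x => f x - g x).
Proof. by move=> fi gi; rewrite /intg; exact: (integrableB mD fi gi). Qed.

Lemma intgZ (c : R) f : intg f -> intg (fun x => c * f x).
Proof. by move=> fi; exact: (integrableZl mD c fi). Qed.

Lemma intg_norm f : intg f -> intg (fun x => `|f x|).
Proof. by move=> fi; exact: integrable_norm. Qed.

Lemma intg0 : intg (fun=> 0).
Proof. exact: integrable0. Qed.

Lemma intg_sum (I : Type) (s : seq I) (h : I -> T -> R) :
  (forall i, intg (h i)) -> intg (fun x => \sum_(i <- s) h i x).
Proof.
move=> hi; elim: s => [|a s IH].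
  by apply: eq_intg intg0 => x _ /=; rewrite big_nil.
by apply: eq_intg (intgD (hi a) IH) => x _ /=; rewrite big_cons.
Qed.

Lemma le_intg f g : measurable_fun D f -> (forall x, D x -> `|f x| <= g x) ->
  intg g -> intg f.
Proof.
move=> mf fg; apply: le_integrable => //; first exact/measurable_EFinP.
by move=> x Dx /=; rewrite lee_fin (le_trans (fg _ Dx))// ler_norm.
Qed.

Lemma intg_indic (Q : set T) : measurable Q -> (mu Q < +oo)%E -> intg \1_Q.
Proof.
move=> mQ Qfin; apply/integrableP; split.
  by apply/measurable_EFinP; exact: measurable_indic.
under eq_integral do rewrite /= ger0_norm//.
rewrite integral_indic//; apply: le_lt_trans Qfin.
by apply: le_measure; rewrite ?inE//; exact: measurableI.
Qed.

Lemma Rintegral_sum (I : Type) (s : seq I) (h : I -> T -> R) :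
  (forall i, intg (h i)) ->
  \int[mu]_(x in D) (\sum_(i <- s) h i x) = \sum_(i <- s) \int[mu]_(x in D) h i x.
Proof.
move=> hi; elim: s => [|a s IH].
  rewrite big_nil; under eq_Rintegral do rewrite big_nil.
  by rewrite Rintegral_cst// mul0r.
rewrite big_cons -IH -RintegralD//; [|exact: hi|exact: intg_sum].
by apply: eq_Rintegral => x _; rewrite big_cons.
Qed.

Lemma ae_eq_Rintegral f g : measurable_fun D f -> measurable_fun D g ->
  ae_eq mu D f g -> \int[mu]_(x in D) f x = \int[mu]_(x in D) g x.
Proof.
move=> mf mg fg; congr fine; apply: ae_eq_integral => //;
  [exact/measurable_EFinP|exact/measurable_EFinP|].
exact: (ae_eq_comp EFin fg).
Qed.

Lemma ae_eq_intg f g : measurable_fun D g -> ae_eq mu D f g -> intg f -> intg g.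
Proof.
move=> mg fg fi; have mf := intg_meas fi; move: fi => /integrableP[_ fi].
apply/integrableP; split; first exact/measurable_EFinP.
rewrite (ae_eq_integral (abse \o (EFin \o f))) => //.
- by apply: measurableT_comp => //; exact/measurable_EFinP.
- by apply: measurableT_comp => //; exact/measurable_EFinP.
- exact: (ae_eq_comp (abse \o EFin) (ae_eq_sym fg)).
Qed.

Lemma sqi_meas f : sqi f -> measurable_fun D f.
Proof. by case. Qed.

Lemma sqi_sq f : sqi f -> intg (fun x => f x ^+ 2).
Proof. by case. Qed.

Lemma sqi_mul f g : sqi f -> sqi g -> intg (fun x => f x * g x).
Proof.
move=> [mf fi] [mg gi].
apply: (@le_intg _ (fun x => f x ^+ 2 + g x ^+ 2)).
- exact: measurable_funM.
- move=> x _; rewrite normrM -(real_normK (num_real (f x))) -(real_normK (num_real (g x))).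
  by have := sqr_ge0 (`|f x| - `|g x|); have := sqr_ge0 (`|f x| + `|g x|); nra.
- exact: intgD.
Qed.

Lemma sqiD f g : sqi f -> sqi g -> sqi (fun x => f x + g x).
Proof.
move=> sf sg; split; first by apply: measurable_funD; [case: sf|case: sg].
apply: (@eq_intg (fun x => f x ^+ 2 + 2 * (f x * g x) + g x ^+ 2)).
  by move=> x _; ring.
apply: intgD; last exact: sqi_sq.
by apply: intgD; [exact: sqi_sq|apply: intgZ; exact: sqi_mul].
Qed.

Lemma sqiM f (c : T -> R) (K : R) : measurable_fun D c ->
  (forall x, D x -> `|c x| <= K) -> sqi f -> sqi (fun x => c x * f x).
Proof.
move=> mc cK [mf fi]; split; first exact: measurable_funM.
apply: (@le_intg _ (fun x => K ^+ 2 * f x ^+ 2)); last exact: intgZ.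
  by apply: measurable_funX; exact: measurable_funM.
move=> x Dx; rewrite exprMn normrM !normrX.
rewrite -(real_normK (num_real (f x))) ler_wpM2r ?sqr_ge0//.
by rewrite lerXn2r// ?nnegrE//; [exact: le_trans (cK x Dx)|exact: cK].
Qed.

Lemma sqiZ (k : R) f : sqi f -> sqi (fun x => k * f x).
Proof. by apply: (@sqiM _ (cst k) `|k|). Qed.

Lemma sqiN f : sqi f -> sqi (fun x => - f x).
Proof. by move=> /(sqiZ (-1)); rewrite (_ : (fun x => -1 * f x) = (fun x => - f x))//; apply/funext => x; rewrite mulN1r. Qed.

Lemma sqiB f g : sqi f -> sqi g -> sqi (fun x => f x - g x).
Proof. by move=> sf /sqiN; exact: sqiD. Qed.

Lemma sqi0 : sqi (fun=> 0).
Proof.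
split => //; apply: (@eq_intg (fun=> 0)); last exact: intg0.
by move=> x _; rewrite expr0n.
Qed.

Lemma sqi_sum (I : Type) (s : seq I) (h : I -> T -> R) :
  (forall i, sqi (h i)) -> sqi (fun x => \sum_(i <- s) h i x).
Proof.
move=> hi; elim: s => [|a s IH].
  by under eq_fun do rewrite big_nil; exact: sqi0.
by under eq_fun do rewrite big_cons; apply: sqiD.
Qed.

Lemma ae_eq_sqi f g : measurable_fun D g -> ae_eq mu D f g -> sqi f -> sqi g.
Proof.
move=> mg fg [mf fi]; split => //.
apply: (@ae_eq_intg (fun x => f x ^+ 2)) fi; first exact: measurable_funX.
exact: (ae_eq_comp (fun y => y ^+ 2) fg).
Qed.

Lemma sqi_bounded f (K : R) : (mu D < +oo)%E -> measurable_fun D f ->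
  (forall x, D x -> `|f x| <= K) -> sqi f.
Proof.
move=> Dfin mf fK; split => //; apply: measurable_bounded_integrable => //.
  exact: measurable_funX.
exists (K ^+ 2); split; first exact: num_real.
move=> y Ky x Dx /=; apply: le_trans (ltW Ky); rewrite normrX.
by rewrite lerXn2r ?nnegrE// ?fK// (le_trans _ (fK x Dx)).
Qed.

Lemma sqi_int_ge0 f : 0 <= \int[mu]_(x in D) (f x * f x).
Proof. by apply: Rintegral_ge0 => x _; rewrite -expr2 sqr_ge0. Qed.

(** The integral of [(f + t g)^2] is a nonnegative polynomial in [t] of degree at most 2; its value
    at the minimiser gives the inequality. *)
Lemma cauchy_schwarz f g : sqi f -> sqi g ->
  (\int[mu]_(x in D) (f x * g x)) ^+ 2 <=
  (\int[mu]_(x in D) (f x * f x)) * (\int[mu]_(x in D) (g x * g x)).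
Proof.
move=> sf sg; set a := \int[mu]_(x in D) (f x * f x).
set b := \int[mu]_(x in D) _; set c := \int[mu]_(x in D) (g x * g x).
have H (t : R) : 0 <= a + 2 * t * b + t ^+ 2 * c.
  have -> : a + 2 * t * b + t ^+ 2 * c =
    \int[mu]_(x in D) ((f x + t * g x) * (f x + t * g x)).
    rewrite /a /b /c -!RintegralZl//; [|exact: sqi_mul|exact: sqi_mul].
    rewrite -!RintegralD//.
    - by apply: eq_Rintegral => x _; ring.
    - by apply: intgD; [exact: sqi_mul|apply: intgZ; exact: sqi_mul].
    - by apply: intgZ; exact: sqi_mul.
    - exact: sqi_mul.
    - by apply: intgZ; exact: sqi_mul.
  exact: sqi_int_ge0.
have c0 : 0 <= c by exact: sqi_int_ge0.
have a0 : 0 <= a by exact: sqi_int_ge0.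
(* If [c] is 0 the polynomial is affine in [t]; were its slope nonzero, the chosen [t] would give it
   the value -1. *)
have [c00|cn0] := eqVneq c 0.
  have [->|bn0] := eqVneq b 0; first by rewrite expr0n mulr_ge0.
  have := H (- (a + 1) / (2 * b)); rewrite c00 mulr0 addr0.
  have -> : a + 2 * (- (a + 1) / (2 * b)) * b = -1 by field.
  by rewrite lerNr oppr0 ler10.
have cp : 0 < c by rewrite lt_neqAle eq_sym cn0.
have := H (- b / c).
have -> : a + 2 * (- b / c) * b + (- b / c) ^+ 2 * c = (a * c - b ^+ 2) / c by field.
by rewrite pmulr_lge0 ?invr_gt0// subr_ge0.
Qed.

Definition L2n f := Num.sqrt (\int[mu]_(x in D) (f x * f x)).

Lemma L2n_ge0 f : 0 <= L2n f. Proof. exact: sqrtr_ge0. Qed.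

Lemma L2n_sq f : L2n f ^+ 2 = \int[mu]_(x in D) (f x * f x).
Proof. by rewrite sqr_sqrtr// sqi_int_ge0. Qed.

Lemma cauchy_schwarz_norm f g : sqi f -> sqi g ->
  `|\int[mu]_(x in D) (f x * g x)| <= L2n f * L2n g.
Proof.
move=> sf sg; rewrite -ler_sqr ?nnegrE ?mulr_ge0 ?L2n_ge0//.
by rewrite real_normK ?num_real// exprMn !L2n_sq; exact: cauchy_schwarz.
Qed.

(** By Cauchy-Schwarz the error is at most [L2n f] times an L^2 distance that tends to 0. Identities
    known for smooth approximants, as in [H10_ibp] and [H1_mul_wp], reach the limit this way. *)
Lemma L2n_cvg_int (f g : T -> R) (g_ : nat -> T -> R) : sqi f -> sqi g ->
  (forall k, sqi (g_ k)) ->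
  (fun k => L2n (fun x => g_ k x - g x)) @ \oo --> (0 : R) ->
  (fun k => \int[mu]_(x in D) (f x * g_ k x)) @ \oo -->
    \int[mu]_(x in D) (f x * g x).
Proof.
move=> sf sg sg_ h.
have -> : (fun k => \int[mu]_(x in D) (f x * g_ k x)) =
    (fun k => \int[mu]_(x in D) (f x * g x) +
              \int[mu]_(x in D) (f x * (g_ k x - g x))).
  apply/funext => k; rewrite -RintegralD//.
  - by apply: eq_Rintegral => x _; ring.
  - exact: sqi_mul.
  - by apply: sqi_mul => //; exact: sqiB.
rewrite -[X in _ --> X]addr0; apply: cvgD; first exact: cvg_cst.
apply: norm_cvg0; apply: (@squeeze_cvgr _ _ _ _ (fun=> 0)
  (fun k => L2n f * L2n (fun x => g_ k x - g x))).
- near=> k; rewrite normr_ge0/=; apply: cauchy_schwarz_norm => //; exact: sqiB.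
- exact: cvg_cst.
- by rewrite -(mulr0 (L2n f)); apply: cvgM => //; exact: cvg_cst.
Unshelve. all: by end_near. Qed.

Lemma L2nD f g : sqi f -> sqi g -> L2n (fun x => f x + g x) <= L2n f + L2n g.
Proof.
move=> sf sg; rewrite -ler_sqr ?nnegrE ?addr_ge0 ?L2n_ge0// L2n_sq.
have E : \int[mu]_(x in D) ((f x + g x) * (f x + g x)) =
  L2n f ^+ 2 + 2 * \int[mu]_(x in D) (f x * g x) + L2n g ^+ 2.
  rewrite !L2n_sq -RintegralZl//; last exact: sqi_mul.
  have i1 := sqi_mul sf sf; have i2 := sqi_mul sg sg.
  have i3 := intgZ 2 (sqi_mul sf sg).
  rewrite -RintegralD// -RintegralD//; last exact: intgD.
  by apply: eq_Rintegral => x _; ring.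
rewrite E sqrrD; have := le_trans (ler_norm _) (cauchy_schwarz_norm sf sg).
by move: (L2n f * L2n g) (\int[mu]_(x in D) _) => a b; lra.
Qed.

Lemma L2nZ (c : R) f : sqi f -> L2n (fun x => c * f x) = `|c| * L2n f.
Proof.
move=> sf; rewrite /L2n -sqrtr_sqr -sqrtrM ?sqr_ge0// -RintegralZl//; last exact: sqi_mul.
by congr Num.sqrt; apply: eq_Rintegral => x _; ring.
Qed.

Lemma L2n_sum (I : Type) (s : seq I) (h : I -> T -> R) : (forall i, sqi (h i)) ->
  L2n (fun x => \sum_(i <- s) h i x) <= \sum_(i <- s) L2n (h i).
Proof.
move=> hs; elim: s => [|a s IH].
  rewrite big_nil /L2n (_ : \int[mu]_(x in D) _ = 0) ?sqrtr0//.
  under eq_Rintegral do rewrite big_nil mul0r.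
  by rewrite Rintegral_cst// mul0r.
rewrite big_cons; have -> : L2n (fun x => \sum_(i <- a :: s) h i x) =
    L2n (fun x => h a x + \sum_(i <- s) h i x).
  by congr Num.sqrt; apply: eq_Rintegral => x _; rewrite big_cons.
apply: le_trans (L2nD (hs a) (sqi_sum s hs)) _; exact: lerD.
Qed.

Lemma dominated_cvg_Rintegral (f_ : nat -> T -> R) f g :
  (forall k, measurable_fun D (f_ k)) -> measurable_fun D f ->
  (forall x, D x -> f_ ^~ x @ \oo --> f x) ->
  intg g -> (forall k x, D x -> `|f_ k x| <= g x) ->
  (fun k => \int[mu]_(x in D) f_ k x) @ \oo --> \int[mu]_(x in D) f x.
Proof.
move=> mf_ mf f_f ig f_g.
have [] := @dominated_convergence _ _ _ mu D mD (fun k => EFin \o f_ k)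
  (EFin \o f) (EFin \o g).
- by move=> k; exact/measurable_EFinP.
- exact/measurable_EFinP.
- by apply: aeW => x Dx; apply: cvg_EFin; [exact: nearW|exact: f_f].
- by [].
- by apply: aeW => x k Dx /=; rewrite lee_fin f_g.
move=> fi _ h.
have fin : (\int[mu]_(x in D) (EFin \o f) x)%E \is a fin_num.
  exact: integrable_fin_num.
by have := fine_cvg; apply => //; rewrite fineK.
Qed.

End real_integral.

Lemma sqi_subset {dsp : measure_display} {T : measurableType dsp} {R : realType}
    (mu : {measure set T -> \bar R}) (E D : set T) (f : T -> R) :
  measurable E -> measurable D -> E `<=` D -> sqi mu D f -> sqi mu E f.
Proof.
move=> mE mD ED [mf fi]; split; first exact: measurable_funS mf.
exact: integrableS fi.
Qed.

Lemma L2n_subset {dsp : measure_display} {T : measurableType dsp} {R : realType}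
    (mu : {measure set T -> \bar R}) (E D : set T) (f : T -> R) :
  measurable E -> measurable D -> E `<=` D -> sqi mu D f -> L2n mu E f <= L2n mu D f.
Proof.
move=> mE mD ED sf; rewrite ler_wsqrtr// -(setIidr ED) Rintegral_mkcondr.
have i1 := sqi_mul mD sf sf.
apply: le_Rintegral => //.
  apply: (@integrableS _ _ _ mu setT) => //.
  have iE : mu.-integrable E (EFin \o (fun x => f x * f x)) by exact: integrableS i1.
  have := (integrable_mkcond _ mE).1 iE; apply: eq_integrable => // x _.
  by rewrite /patch/=; case: ifP.
by move=> x Dx; rewrite /patch; case: ifP => // _; rewrite -expr2 sqr_ge0.
Qed.

(** * Lebesgue measure on row vectors *)

Section rV_topology.
Context {R : realType} {n : nat}.
Implicit Types (x a : 'rV[R]_n).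

Lemma cvg_rV (T : Type) (F : set_system T) {FF : Filter F} (f : T -> 'rV[R]_n) (l : 'rV[R]_n) :
  (forall i, f t 0 i @[t --> F] --> l 0 i) -> f t @[t --> F] --> l.
Proof.
move=> cf A [P hP sA].
have : \forall t \near F, forall i : 'I_n, P 0 i (f t 0 i).
  by apply: filter_forall => i; apply: cf; exact: hP.
by apply: filterS => t Pt; apply: sA => i j; rewrite ord1.
Qed.

Lemma continuous_rV (T : topologicalType) (f : T -> 'rV[R]_n) :
  (forall i, continuous (fun t => f t 0 i)) -> continuous f.
Proof. by move=> cf t; apply: cvg_rV => i; exact: cf. Qed.

Lemma open_rV_ball (U : set 'rV[R]_n) x : open U -> U x ->
  exists2 e : R, 0 < e & forall y : 'rV[R]_n, (forall i, `|x 0 i - y 0 i| < e) -> U y.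
Proof.
move=> oU Ux; have /nbhs_ballP[e /= e0 eU] := open_nbhs_nbhs (conj oU Ux).
by exists e => // y xy; apply: eU; split => // i j; rewrite ord1; exact: xy.
Qed.

Lemma bounded_setP (A : set 'rV[R]_n) : bounded_set A ->
  exists2 K : R, 0 < K & forall x, A x -> forall i, `|x 0 i| <= K.
Proof.
move=> [M [_ HM]]; exists (`|M| + 1); first by rewrite ltr_pwDr.
move=> x Ax i; apply: le_trans (HM (`|M| + 1) _ _ Ax); last first.
  by rewrite (le_lt_trans (ler_norm _))// ltrDl.
by rewrite /Num.Def.normr/= mx_normrE (le_bigmax _ (fun ij => `|x ij.1 ij.2|) (0, i)).
Qed.

Lemma bounded_set_coord (A : set 'rV[R]_n) (K : R) :
  (forall x, A x -> forall i, `|x 0 i| <= K) -> bounded_set A.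
Proof.
move=> AK; exists `|K|; split; first exact: num_real.
move=> M KM x Ax; rewrite /Num.Def.normr/= mx_normrE; apply: bigmax_le.
  exact: le_trans (ltW KM).
by move=> [j i] _ /=; rewrite ord1 (le_trans (AK _ Ax i))// (le_trans (ler_norm _))// ltW.
Qed.

End rV_topology.

Section rV_borel.
Context {R : realType} {n : nat}.

Let box (q : 'rV[rat]_n) (k : nat) : set 'rV[R]_n :=
  \bigcap_(i in [set: 'I_n]) [set x | `|x 0 i - ratr (q 0 i)| < k.+1%:R^-1].

Let measurable_box q k : measurable (box q k).
Proof.
apply: fin_bigcap_measurable => // i _.
rewrite [X in measurable X](_ : _ =
  (fun x : 'rV[R]_n => x 0 i : measurableTypeR R) @^-1`
    `](ratr (q 0 i) - k.+1%:R^-1), (ratr (q 0 i) + k.+1%:R^-1)[%classic); last first.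
  by apply/seteqP; split => x /=; rewrite in_itv/= ltr_distl.
by rewrite -[X in measurable X]setTI; apply: measurable_coord.
Qed.

(** The sigma-algebra is generated by the coordinates, so an open set must be built by countable
    operations: it is the union of the cubes with rational centre and radius [1 / k.+1] that it
    contains. *)
Lemma open_measurable_rV (U : set 'rV[R]_n) : open U -> measurable U.
Proof.
move=> oU.
have -> : U = \bigcup_(p in [set: 'rV[rat]_n * nat])
    (if `[< box p.1 p.2 `<=` U >] then box p.1 p.2 else set0).
  apply/seteqP; split => [x Ux|x [p _]]; last by case: asboolP => // + bx; exact.
  have [e e0 eU] := open_rV_ball oU Ux.
  (* The coordinates of two points of a box differ by less than [2 / k.+1], hence the half. *)
  have [k ke] : exists k : nat, k.+1%:R^-1 < e / 2.
    near \oo => k; exists k; near: k.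
    exact: (near_infty_natSinv_lt (PosNum (divr_gt0 e0 (ltr0n _ 2)))).
  have k0 : (0 : R) < k.+1%:R^-1 by rewrite invr_gt0 ltr0n.
  have hq i : exists q : rat, `|x 0 i - ratr q| < k.+1%:R^-1.
    move: k0; set c : R := k.+1%:R^-1 => k0.
    have /rat_in_itvoo[q] : x 0 i - c < x 0 i + c by lra.
    rewrite in_itv/= => /andP[q1 q2]; exists q.
    by rewrite ltr_distl; apply/andP; split; lra.
  have [q qP] := choice hq.
  exists (\row_i q i, k) => //=.
  have bx : box (\row_i q i) k x by move=> i _ /=; rewrite mxE.
  case: asboolP => // -[] y yb; apply: eU => i.
  have := bx i Logic.I; have := yb i Logic.I; rewrite /= mxE => h1 h2.
  move: k0 ke h1 h2; set c : R := k.+1%:R^-1 => k0 ke h1 h2.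
  rewrite (_ : x 0 i - y 0 i = (x 0 i - ratr (q i)) - (y 0 i - ratr (q i))); last by ring.
  by rewrite (le_lt_trans (ler_normB _ _))//; lra.
apply: countable_bigcupT_measurable; first exact: countableP.
by move=> p; case: ifP => _; [exact: measurable_box|exact: measurable0].
Unshelve. all: by end_near. Qed.

Lemma closed_measurable_rV (A : set 'rV[R]_n) : closed A -> measurable A.
Proof.
by move=> cA; rewrite -[A]setCK; apply: measurableC; apply: open_measurable_rV; exact: closed_openC.
Qed.

Lemma continuous_measurable_rV (f : 'rV[R]_n -> R) : continuous f ->
  measurable_fun setT f.
Proof.
move=> /continuousP cf; apply: (measurability _ (RGenOpens.measurableE R)).
move=> _ [_ [a [b ->] <-]]; rewrite setTI; apply: open_measurable_rV.
exact/cf/interval_open.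
Qed.

Lemma measurable_coordP d (T : measurableType d) (f : T -> 'rV[R]_n) :
  measurable_fun setT f <-> forall i, measurable_fun setT (fun x => f x 0 i : R).
Proof.
split=> [mf i|]; last exact: measurable_fun_rV.
exact: (measurableT_comp (@measurable_coord R n i) mf).
Qed.

Lemma measurable_shift (a : 'rV[R]_n) : measurable_fun setT (fun x : 'rV[R]_n => x + a).
Proof.
apply/measurable_coordP => i; under eq_fun do rewrite mxE.
by apply: measurable_funD; [exact: measurable_coord|exact: measurable_cst].
Qed.

End rV_borel.

(** Lebesgue measure is determined by its values on half-open intervals, and a shift does not change
    their length. *)
Lemma lebesgue_measure_shift {R : realType} (a : R) (A : set (measurableTypeR R)) :
  measurable A ->
  pushforward (@lebesgue_measure R) ((fun x => x + a) : _ -> measurableTypeR R) A =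
  lebesgue_measure A.
Proof.
have ms : measurable_fun setT ((fun x => x + a) : measurableTypeR R -> measurableTypeR R).
  by apply: measurable_funD; [exact: measurable_id|exact: measurable_cst].
pose m := measure_function_pushforward__canonical__measure_function_Measure
  (@lebesgue_measure R) ms.
move=> mA; apply/esym; apply: (@lebesgue_measure_unique R m) => // _ [[b c]] _ <-.
rewrite /= /pushforward.
have -> : (fun x => x + a) @^-1` `]b, c]%classic = `](b - a), (c - a)]%classic.
  by apply/seteqP; split => x /=; rewrite !in_itv/= => /andP[? ?]; apply/andP; split; lra.
rewrite !lebesgue_measure_itv/= !lte_fin ltrD2r.
by case: ifP => // _; rewrite -!EFinB; congr (_%:E); ring.
Qed.

Lemma ge0_integral_shift1 {R : realType} (a : R) (f : measurableTypeR R -> \bar R) :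
  measurable_fun setT f -> (forall x, 0 <= f x)%E ->
  (\int[@lebesgue_measure R]_x f (x + a)%R = \int[@lebesgue_measure R]_x f x)%E.
Proof.
move=> mf f0.
have ms : measurable_fun setT ((fun x => x + a) : measurableTypeR R -> measurableTypeR R).
  by apply: measurable_funD; [exact: measurable_id|exact: measurable_cst].
have := @ge0_integral_pushforward _ _ _ _ R _ ms lebesgue_measure setT f measurableT mf.
rewrite preimage_setT => /(_ (fun x _ => f0 x)) <-.
by apply: eq_measure_integral => A mA _; exact: lebesgue_measure_shift.
Qed.

Lemma consvD {R : realType} n (t : R) (y : 'rV[R]_n) (a : 'rV[R]_n.+1) :
  consv (t, y) + a = consv (t + (unconsv a).1, y + (unconsv a).2).
Proof.
apply/rowP => i; rewrite mxE /consv.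
rewrite -[i](@splitK 1 n); case: (@fintype.split 1 n i) => j /=.
  rewrite !(@row_mxEl _ 1 1 n) !mxE ord1 !mulr1n /=; congr (_ + a _ _).
  exact/val_inj.
rewrite !(@row_mxEr _ 1 1 n) !mxE; congr (_ + a _ _); exact/val_inj.
Qed.

Section leb_theory.
Context {R : realType}.

(** Induction on the dimension: the measure is the integral over the first coordinate of the
    measures of the sections. The shift inside a section is absorbed by the induction hypothesis,
    that of the first coordinate by the one-dimensional case. *)
Lemma leb_shift n (a : 'rV[R]_n) (A : set 'rV[R]_n) : measurable A ->
  leb R n ((fun x => x + a) @^-1` A) = leb R n A.
Proof.
elim: n a A => [|n IH] a A mA.
  congr (_ _); apply/seteqP; split => x /=;
    by rewrite (_ : x + a = x)//; apply/rowP => -[].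
have mA' : measurable (@consv R n @^-1` A).
  by rewrite -[X in measurable X]setTI; exact: measurable_consv.
rewrite /= /leb_cons /pushforward /product_measure1 /=.
transitivity (\int[@lebesgue_measure R]_t
  (fun t => leb R n (xsection (@consv R n @^-1` A) t)) (t + (unconsv a).1)%R)%E.
  apply: eq_integral => t _ /=.
  rewrite -[RHS](IH (unconsv a).2); last exact: (measurable_xsection _ mA').
  congr (_ _); apply/seteqP; split => y; rewrite /xsection/= !inE/=.
    by rewrite consvD.
  by rewrite consvD.
apply: ge0_integral_shift1 => //.
exact: (measurable_fun_xsection (leb R n) mA').
Qed.

Lemma ge0_integral_shift n (a : 'rV[R]_n) (f : 'rV[R]_n -> \bar R) :
  measurable_fun setT f -> (forall x, 0 <= f x)%E ->
  (\int[leb R n]_x f (x + a)%R = \int[leb R n]_x f x)%E.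
Proof.
move=> mf f0.
have ms := @measurable_shift R n a.
have := @ge0_integral_pushforward _ _ _ _ R _ ms (leb R n) setT f measurableT mf.
rewrite preimage_setT => /(_ (fun x _ => f0 x)) <-.
by apply: eq_measure_integral => A mA _; exact: leb_shift.
Qed.

Lemma measurable_cube n (K : R) : measurable [set x : 'rV[R]_n | forall i, `|x 0 i| <= K].
Proof.
rewrite (_ : [set _ | _] = \bigcap_(i in [set: 'I_n])
     ((fun x : 'rV[R]_n => x 0 i : measurableTypeR R) @^-1` `[(- K), K]%classic)).
  apply: fin_bigcap_measurable => // i _.
  by rewrite -[X in measurable X]setTI; apply: measurable_coord.
by apply/seteqP; split => x /= h i; [move=> _|]; have := h i;
  rewrite /= in_itv/= -ler_norml//; exact.
Qed.

Lemma leb_box n (K : R) : 0 < K ->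
  (leb R n [set x : 'rV[R]_n | forall i, `|x 0 i| <= K]%R < +oo)%E.
Proof.
move=> K0; elim: n => [|n IH].
  by rewrite /= diracE; case: (_ \in _); rewrite ltry.
rewrite /= /leb_cons /pushforward.
have -> : consv (R := R) (n := n) @^-1` [set x : 'rV[R]_n.+1 | forall i, `|x 0 i| <= K] =
   `[(- K), K]%classic `*` [set x : 'rV[R]_n | forall i, `|x 0 i| <= K].
  apply/seteqP; split => -[t y] /=.
    move=> H; split.
      have := H (lshift n (ord0 : 'I_1)).
      by rewrite /consv (@row_mxEl _ 1 1 n) mxE mulr1n in_itv/= -ler_norml.
    by move=> i; have := H (rshift 1 i); rewrite /consv (@row_mxEr _ 1 1 n).
  rewrite in_itv/= -ler_norml => -[h1 h2] i.
  rewrite /consv -[i](@splitK 1 n); case: (@fintype.split 1 n i) => j /=.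
    by rewrite (@row_mxEl _ 1 1 n) mxE ord1 mulr1n.
  by rewrite (@row_mxEr _ 1 1 n).
rewrite product_measure1E//; last exact: measurable_cube.
apply: lte_mul_pinfty => //.
  by rewrite ge0_fin_numE// [ltLHS](@lebesgue_measure_itv R `[(- K), K])/=; case: ifP; rewrite -?EFinD ltry.
Qed.

Lemma leb_bounded n (A : set 'rV[R]_n) : measurable A -> bounded_set A ->
  (leb R n A < +oo)%E.
Proof.
move=> mA /bounded_setP[K K0 AK]; apply: le_lt_trans (leb_box n K0).
have mB := @measurable_cube n K.
apply: le_measure; rewrite ?inE//.
Qed.

Lemma ge0_integral_consv n (f : 'rV[R]_n.+1 -> \bar R) :
  measurable_fun setT f -> (forall x, 0 <= f x)%E ->
  (\int[leb R n.+1]_x f x =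
   \int[@lebesgue_measure R]_t \int[leb R n]_y f (consv (t, y)))%E.
Proof.
move=> mf f0.
have h := @ge0_integral_pushforward _ _ _ _ R _ (@measurable_consv R n)
  (lebesgue_measure \x leb R n)%E setT f measurableT mf (fun x _ => f0 x).
rewrite /= [LHS]h preimage_setT.
apply: (@fubini_tonelli1 _ _ _ _ R lebesgue_measure (leb R n)) => //=.
by apply: measurableT_comp mf _; exact: measurable_consv.
Qed.

End leb_theory.

(** * Smooth functions *)

Section one_dim_smooth.
Context {R : realType}.
Implicit Types (f g phi : R -> R) (p q : {poly R}).

Definition smooth1 f := forall n x, derivable (derive1n n f) x 1.

Lemma smooth1_derive1 f : smooth1 f -> smooth1 (derive1 f).
Proof. by move=> sf n x; rewrite -derive1Sn; exact: sf. Qed.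

Lemma smooth1_is_derive f : smooth1 f -> forall x : R, is_derive x 1 f (derive1 f x).
Proof. by move=> sf x; rewrite derive1E; apply: derivableP; exact: (sf 0%N). Qed.

Lemma is_derive_continuous f df : (forall x : R, is_derive x 1 f (df x)) -> continuous f.
Proof.
move=> h x; apply: differentiable_continuous; apply/derivable1_diffP.
exact: (@ex_derive _ _ _ _ _ _ _ (h x)).
Qed.

(** A class in which every member has a derivative in the class consists of smooth functions; no
    formula for iterated derivatives is needed. *)
Lemma smooth1_coind (P : (R -> R) -> Prop) :
  (forall f, P f -> exists2 g, P g & forall x : R, is_derive x 1 f (g x)) ->
  forall f, P f -> smooth1 f.
Proof.
move=> hP f Pf n x; suff /hP[k _ dk] : P (derive1n n f).
  exact: (@ex_derive _ _ _ _ _ _ _ (dk x)).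
elim: n f Pf => [//|n IH] f Pf; have [g Pg dg] := hP f Pf.
rewrite derive1Sn (_ : derive1 f = g); first exact: IH.
by apply/funext => y; rewrite derive1E; exact: derive_val.
Qed.

Lemma smooth1_expR (c : R) : smooth1 (fun x => expR (c * x)).
Proof.
apply: (@smooth1_coind (fun f => exists k : R, f = fun x => k * expR (c * x))).
  move=> _ [k ->]; exists (fun x => (k * c) * expR (c * x)); first by exists (k * c).
  move=> x; have h1 : is_derive (c * x) 1 expR (expR (c * x)) by exact: is_derive_expR.
  have h2 : is_derive x 1 (fun x : R => c * x) c.
    by apply: is_derive_eq (is_deriveZ c (is_derive_id x 1)) _; rewrite scaler1.
  have h := is_deriveZ k (is_derive1_comp h1 h2).
  by apply: is_derive_eq h _; rewrite /GRing.scale/=; ring.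
by exists 1; apply/funext => x; rewrite mul1r.
Qed.

(** The classical [exp (-1/x)] with a polynomial factor in [1/x], which makes the family stable
    under differentiation: [p] becomes [X^2 (p - p')]. *)
Definition flat p (x : R) := if 0 < x then p.[x^-1] * expR (- x^-1) else 0.

Lemma flat_bound p : exists C : R, forall x : R, `|x| <= 1 -> `|flat p x| <= C * `|x|.
Proof.
pose n := size p; pose C : R := \sum_(i < n) `|p`_i|.
(* For [y = 1/x >= 1] and [n = size p], [|p(y)| <= C y^n], and the exponential series gives
   [exp (-y) <= (n+1)! / y^(n+1)]; the product keeps one factor [1/y = |x|]. *)
exists (C * (n.+1)`!%:R) => x x1; rewrite /flat; case: ifPn => [x0|_]; last first.
  by rewrite normr0 mulr_ge0// mulr_ge0// sumr_ge0.
have y1 : 1 <= x^-1 by rewrite invf_ge1// -(gtr0_norm x0).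
have y0 : 0 < x^-1 by rewrite invr_gt0.
set y := x^-1 in y1 y0 *.
have H1 : `|p.[y]| <= C * y ^+ n.
  rewrite horner_coef (le_trans (ler_norm_sum _ _ _))// mulr_suml; apply: ler_sum => i _.
  rewrite normrM normrX (gtr0_norm y0) ler_wpM2l// ler_weXn2l//.
  exact: ltnW.
have H2 : expR (- y) <= (n.+1)`!%:R / y ^+ n.+1.
  rewrite expRN -lef_pV2 ?posrE ?invr_gt0 ?expR_gt0 ?divr_gt0 ?exprn_gt0 ?ltr0n ?fact_gt0//.
  rewrite invrK invf_div; apply: le_trans (expR_ge1Dxn n (ltW y0)).
  by rewrite lerDr.
rewrite normrM (gtr0_norm (expR_gt0 _)) (gtr0_norm x0).
apply: le_trans (ler_pM (normr_ge0 _) (ltW (expR_gt0 _)) H1 H2) _.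
set F : R := (n.+1)`!%:R.
suff -> : C * y ^+ n * (F / y ^+ n.+1) = C * F * y^-1 by rewrite invrK.
have yn0 : y ^+ n != 0 by rewrite expf_neq0 ?gt_eqF.
have yn1 : y != 0 by rewrite gt_eqF.
rewrite exprS; move: yn0 yn1; move: (y ^+ n) (y) => a b an0 bn0; field.
by rewrite an0 bn0.
Qed.

Lemma flat_cvg0 p : flat p x @[x --> 0] --> (0 : R).
Proof.
have [C hC] := flat_bound p.
apply: norm_cvg0; apply: (@squeeze_cvgr _ _ _ _ (fun=> 0) (fun x => C * `|x|)).
- near=> x; rewrite normr_ge0/=; apply: hC; near: x.
  apply/nbhs_ballP; exists 1 => //= x; rewrite /ball/= sub0r normrN.
  exact: ltW.
- exact: cvg_cst.
- rewrite -[X in _ --> X](mulr0 C); apply: cvgM; first exact: cvg_cst.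
  by rewrite -[X in _ --> X](@normr0 R R); apply: cvg_norm; exact: cvg_id.
Unshelve. all: by end_near. Qed.

Lemma is_derive_flat p (x : R) :
  is_derive x 1 (flat p) (flat ('X^2 * (p - p^`())) x).
Proof.
have [x0|x0|->] := ltgtP x 0.
- have -> : flat ('X^2 * (p - p^`())) x = 0 by rewrite /flat ltNge ltW.
  apply: (@near_eq_is_derive _ _ _ (cst 0)); rewrite ?oner_eq0//.
  near=> y; rewrite /flat; case: ifPn => // y0; exfalso.
  suff : y < 0 by rewrite ltNge ltW.
  by near: y; exact: lt_nbhsl.
- apply: (@near_eq_is_derive _ _ _ (fun y : R => p.[y^-1] * expR (- y^-1))); rewrite ?oner_eq0//.
    by near=> y; rewrite /flat ifT//; near: y; exact: lt_nbhsr.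
  have xn0 : x != 0 by rewrite gt_eqF.
  have dV : is_derive x 1 (fun y : R => y^-1) (- x ^- 2).
    by apply: is_derive_eq (is_deriveV xn0 (is_derive_id x 1)) _; rewrite scaler1.
  have dp : is_derive x 1 (fun y : R => p.[y^-1]) (p^`().[x^-1] * - x ^- 2).
    by apply: (@is_derive1_comp _ (horner p)); exact: is_derive_poly.
  have de : is_derive x 1 (fun y : R => expR (- y^-1)) (expR (- x^-1) * x ^- 2).
    have h := @is_derive1_comp R expR (fun y => - y^-1) x _ _ (is_derive_expR _) (is_deriveN dV).
    by apply: is_derive_eq h _; rewrite opprK.
  apply: is_derive_eq (is_deriveM dp de) _.
  rewrite /flat x0 !hornerE /GRing.scale/= ; set a := p.[_]; set b := p^`().[_].
  by set e := expR _; rewrite exprVn; ring.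
(* At 0 the difference quotient of [flat p] is [flat ('X * p)], which tends to 0 by the same
   bound. *)
- apply/is_derive1_caratheodory; exists (flat ('X * p)); split.
  + move=> z; rewrite [flat p 0]/flat ltxx !subr0 /flat; case: ifPn => [z0|]; last by rewrite mul0r.
    by rewrite !hornerE; field; rewrite gt_eqF.
  + have h0 : flat ('X * p) 0 = 0 by rewrite /flat ltxx.
    suff : flat ('X * p) x @[x --> 0] --> flat ('X * p) 0 by [].
    by rewrite h0; exact: flat_cvg0.
  + by rewrite /flat !ltxx.
Unshelve. all: by end_near. Qed.

Lemma smooth1_flat p : smooth1 (flat p).
Proof.
apply: (@smooth1_coind (fun f => exists q, f = flat q)); last by exists p.
move=> _ [q ->]; exists (flat ('X^2 * (q - q^`()))); first by eexists.
exact: is_derive_flat.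
Qed.

Lemma flat1_gt0 x : 0 < x -> 0 < flat 1 x.
Proof. by move=> x0; rewrite /flat x0 hornerE mul1r expR_gt0. Qed.

Lemma flat_le0 p x : x <= 0 -> flat p x = 0.
Proof. by move=> x0; rewrite /flat ltNge x0. Qed.

Lemma flat1_ge0 x : 0 <= flat 1 x.
Proof. by have [/flat1_gt0/ltW//|/flat_le0->] := ltP 0 x. Qed.

Let den (x : R) := flat 1 x + flat 1 (1 - x).

Lemma flat1_den_gt0 x : 0 < flat 1 x + flat 1 (1 - x).
Proof.
have [x0|x0] := ltP 0 x; first by rewrite ltr_wpDr ?flat1_ge0 ?flat1_gt0.
by rewrite ltr_wpDl ?flat1_ge0 ?flat1_gt0// subr_gt0 (le_lt_trans x0).
Qed.

(** The usual smooth transition from 0, reached on the left of 0, to 1, reached on the right of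
    1. *)
Definition step (x : R) := flat 1 x / (flat 1 x + flat 1 (1 - x)).

Definition dstep (x : R) :=
  (flat ('X^2) x * flat 1 (1 - x) + flat 1 x * flat ('X^2) (1 - x)) / (den x) ^+ 2.

Lemma is_derive_step (x : R) : is_derive x 1 step (dstep x).
Proof.
have d1 (y : R) : is_derive y 1 (flat 1) (flat ('X^2) y).
  by apply: is_derive_eq (is_derive_flat 1 y) _; rewrite derivC subr0 mulr1.
have d2 : is_derive x 1 (fun y : R => flat 1 (1 - y)) (- flat ('X^2) (1 - x)).
  have h : is_derive x 1 (fun y : R => 1 - y) (-1).
    by apply: is_derive_eq (is_deriveB (is_derive_cst (1 : R) x (1 : R)) (is_derive_id x (1 : R))) _; rewrite sub0r.
  by apply: is_derive_eq (@is_derive1_comp R (flat 1) (fun y => 1 - y) x _ _ (d1 _) h) _; rewrite mulrN1.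
have dn0 : den x != 0 by rewrite gt_eqF// flat1_den_gt0.
have dV := is_deriveV dn0 (is_deriveD (d1 x) d2).
apply: is_derive_eq (is_deriveM (d1 x) dV) _.
rewrite /dstep /GRing.scale/=; move: dn0; rewrite /den.
set a := flat 1 x; set b := flat 1 (1 - x); set c := flat _ x; set d := flat _ (1 - x).
by move=> dn0; field.
Qed.

Lemma step_le0 x : x <= 0 -> step x = 0.
Proof. by move=> x0; rewrite /step flat_le0// mul0r. Qed.

Lemma step_ge1 x : 1 <= x -> step x = 1.
Proof.
move=> x1; rewrite /step (@flat_le0 _ (1 - x)) ?subr_le0// addr0 divff//.
by rewrite gt_eqF// flat1_gt0// (lt_le_trans _ x1).
Qed.

Lemma step_ge0 x : 0 <= step x.
Proof. by rewrite /step divr_ge0 ?flat1_ge0 ?ltW ?flat1_den_gt0. Qed.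

Lemma step_le1 x : step x <= 1.
Proof. by rewrite /step ler_pdivrMr ?flat1_den_gt0// mul1r lerDl flat1_ge0. Qed.

Lemma dstep_le0 x : x <= 0 -> dstep x = 0.
Proof. by move=> x0; rewrite /dstep !(@flat_le0 _ x)// !mul0r addr0 mul0r. Qed.

Lemma dstep_ge1 x : 1 <= x -> dstep x = 0.
Proof.
by move=> x1; rewrite /dstep !(@flat_le0 _ (1 - x)) ?subr_le0// !mulr0 addr0 mul0r.
Qed.

Lemma continuous_dstep : continuous dstep.
Proof.
have cf p : continuous (flat p) by apply: is_derive_continuous => y; exact: is_derive_flat.
have cf1 p : continuous (fun x : R => flat p (1 - x)).
  move=> x; apply: (@continuous_comp _ _ _ (fun x : R => 1 - x) (flat p)); last exact: cf.
  by apply: cvgB; [exact: cvg_cst|exact: cvg_id].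
move=> x; apply: cvgM.
  by apply: cvgD; apply: cvgM; [exact: cf|exact: cf1|exact: cf|exact: cf1].
apply: cvgV; first by rewrite expf_neq0// gt_eqF// flat1_den_gt0.
rewrite expr2; under eq_fun do rewrite expr2.
by apply: cvgM; apply: cvgD; [exact: cf|exact: cf1|exact: cf|exact: cf1].
Qed.

(** [dstep] is continuous and vanishes outside [[0, 1]], so its supremum is attained there. The
    constant enters the estimate of the boundary layer. *)
Lemma dstep_bound : exists2 C : R, 0 <= C & forall x, `|dstep x| <= C.
Proof.
have [c _ hc] : exists2 c : R, c \in `[0, 1] & forall t : R, t \in `[0, 1] -> `|dstep t| <= `|dstep c|.
  apply: EVT_max => //; apply: continuous_subspaceT => x.
  by apply: cvg_norm; exact: continuous_dstep.
exists `|dstep c| => // x.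
have [x0|x0] := leP x 0; first by rewrite dstep_le0 ?normr0.
have [x1|x1] := leP 1 x; first by rewrite dstep_ge1 ?normr0.
by apply: hc; rewrite in_itv/= !ltW.
Qed.

End one_dim_smooth.

Section line_derivative.
Context {R : realType} {V : normedModType R}.
Implicit Types (f : V -> R) (x v : V).

Lemma is_derive_line f x v (t df : R) : is_derive (x + t *: v) v f df ->
  is_derive t 1 (fun s : R => f (x + s *: v)) df.
Proof.
have E : (fun h : R => h^-1 *: (((fun s : R => f (x + s *: v)) \o shift t) (h *: 1) - f (x + t *: v))) =
         (fun h : R => h^-1 *: ((f \o shift (x + t *: v)) (h *: v) - f (x + t *: v))).
  apply/funext => h /=; congr (_ *: (f _ - _)).
  by rewrite [h *: 1]mulr1 scalerDl addrCA.
by case=> d1 d2; split; [rewrite /derivable E|rewrite /derive E].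
Qed.

(** Restriction to a line turns a directional derivative into an ordinary one, to which the
    one-variable chain rule applies; this lemma brings the result back. *)
Lemma line_is_derive f x v (df : R) :
  is_derive (0 : R) 1 (fun s : R => f (x + s *: v)) df -> is_derive x v f df.
Proof.
have E : (fun h : R => h^-1 *: (((fun s : R => f (x + s *: v)) \o shift 0) (h *: 1) - f (x + (0 : R) *: v))) =
         (fun h : R => h^-1 *: ((f \o shift x) (h *: v) - f x)).
  apply/funext => h /=; congr (_ *: (f _ - f _)); rewrite ?scale0r ?addr0//.
  by rewrite [h *: 1]mulr1 addrC.
by case=> d1 d2; split; [rewrite /derivable -E|rewrite /derive -E].
Qed.

Lemma is_derive_comp1 (phi : R -> R) f x v (a b : R) :
  is_derive (f x) 1 phi a -> is_derive x v f b -> is_derive x v (phi \o f) (a * b).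
Proof.
move=> da db; apply: line_is_derive.
apply: (@is_derive1_comp _ phi (fun s : R => f (x + s *: v))).
  by rewrite scale0r addr0.
by apply: is_derive_line; rewrite scale0r addr0.
Qed.

End line_derivative.

Section smooth_rV.
Context {R : realType} {n : nat}.
Local Notation X := 'rV[R]_n.
Implicit Types (f g : X -> R) (x v : X) (i : 'I_n).

Lemma smooth_partial f i : smooth f -> smooth (partial i f).
Proof. by move=> sf s; have := sf (rcons s i); rewrite foldr_rcons. Qed.

Lemma smooth_continuous f : smooth f -> continuous f.
Proof. by move=> sf; have [] := sf [::]. Qed.

Lemma smooth_is_derive f i x : smooth f -> is_derive x (delta_mx 0 i) f (partial i f x).
Proof. by move=> sf; apply: derivableP; have [_] := sf [::]; exact. Qed.

Lemma is_derive_partial f i (df : X -> R) :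
  (forall x, is_derive x (delta_mx 0 i) f (df x)) -> partial i f = df.
Proof. by move=> h; apply/funext => x; exact: (@derive_val _ _ _ _ _ _ _ (h x)). Qed.

Lemma smooth_coind (P : (X -> R) -> Prop) :
  (forall f, P f -> continuous f /\
    forall i, exists2 g, P g & forall x, is_derive x (delta_mx 0 i) f (g x)) ->
  forall f, P f -> smooth f.
Proof.
move=> hP f Pf s; suff /hP[cf df] : P (foldr (@partial R n) f s).
  by split => // i x; have [g _ /(_ x) h] := df i; exact: (@ex_derive _ _ _ _ _ _ _ h).
elim: s => [//|i s /hP[_ /(_ i)[g Pg dg]]] /=.
by rewrite (is_derive_partial dg).
Qed.

Lemma smooth_cst (c : R) : smooth (fun _ : X => c).
Proof.
apply: (@smooth_coind (fun f => exists c, f = fun=> c)); last by exists c.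
move=> _ [k ->]; split; first exact: cst_continuous.
by move=> j; exists (cst 0); [exists 0|move=> x; exact: is_derive_cst].
Qed.

(** The operations have to be closed simultaneously: differentiating a product gives sums of
    products, [ln f] brings in an inverse, a composition brings in a product with
    [derive1 phi \o f]. The generated class is stable under [partial], as [smooth_coind] requires,
    which replaces Leibniz formulas. *)
Inductive gen_smooth : (X -> R) -> Prop :=
| GenSmooth f : smooth f -> gen_smooth f
| GenAdd f g : gen_smooth f -> gen_smooth g -> gen_smooth (f + g)
| GenMul f g : gen_smooth f -> gen_smooth g -> gen_smooth (f * g)
| GenComp (phi : R -> R) f : smooth1 phi -> gen_smooth f -> gen_smooth (phi \o f)
| GenLn f : (forall x, 0 < f x) -> gen_smooth f -> gen_smooth (@ln R \o f)
| GenInv f : (forall x, 0 < f x) -> gen_smooth f -> gen_smooth (fun x => (f x)^-1).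

Lemma gen_smoothP f : gen_smooth f -> smooth f.
Proof.
move: f; apply: smooth_coind => f; elim => {f}.
- move=> f sf; split; first exact: smooth_continuous.
  by move=> i; exists (partial i f); [apply: GenSmooth; exact: smooth_partial|move=> x; exact: smooth_is_derive].
- move=> f g gf [cf df] gg [cg dg]; split; first by move=> x; exact: (cvgD (cf x) (cg x)).
  move=> i; have [f' gf' hf'] := df i; have [g' gg' hg'] := dg i.
  by exists (f' + g'); [exact: GenAdd|move=> x; exact: is_deriveD].
- move=> f g gf [cf df] gg [cg dg]; split; first by move=> x; exact: (cvgM (cf x) (cg x)).
  move=> i; have [f' gf' hf'] := df i; have [g' gg' hg'] := dg i.
  exists (f * g' + g * f'); first by apply: GenAdd; exact: GenMul.
  by move=> x; exact: (is_deriveM (hf' x) (hg' x)).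
- move=> phi f sphi gf [cf df]; split.
    move=> x; apply: continuous_comp; first exact: cf.
    exact: (is_derive_continuous (smooth1_is_derive sphi)).
  move=> i; have [f' gf' hf'] := df i.
  exists ((derive1 phi \o f) * f').
    by apply: GenMul => //; apply: GenComp => //; exact: smooth1_derive1.
  by move=> x; exact: (is_derive_comp1 (smooth1_is_derive sphi (f x)) (hf' x)).
- move=> f f0 gf [cf df]; split.
    by move=> x; apply: continuous_comp; [exact: cf|exact: continuous_ln].
  move=> i; have [f' gf' hf'] := df i.
  exists ((fun x => (f x)^-1) * f'); first by apply: GenMul => //; exact: GenInv.
  by move=> x; exact: (is_derive_comp1 (is_derive1_ln (f0 x)) (hf' x)).
- move=> f f0 gf [cf df]; split.
    by move=> x; apply: (@continuous_comp _ _ _ f (fun y : R => y^-1)); [exact: cf|apply: inv_continuous; rewrite gt_eqF].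
  move=> i; have [f' gf' hf'] := df i.
  exists (((fun=> -1) * ((fun x => (f x)^-1) * (fun x => (f x)^-1))) * f').
    apply: GenMul => //; apply: GenMul; last by apply: GenMul; exact: GenInv.
    by apply: GenSmooth; exact: (smooth_cst (-1)).
  move=> x; have fn0 : f x != 0 by rewrite gt_eqF.
  have dV : is_derive (f x) 1 (fun y : R => y^-1) (- (f x) ^- 2).
    by apply: is_derive_eq (is_deriveV fn0 (is_derive_id (f x) (1:R))) _; rewrite scaler1.
  apply: is_derive_eq (is_derive_comp1 dV (hf' x)) _.
  by rewrite /= /GRing.mul/= mulN1r -invfM -expr2.
Qed.

Lemma smoothD f g : smooth f -> smooth g -> smooth (fun x => f x + g x).
Proof. by move=> sf sg; apply: gen_smoothP; apply: GenAdd; exact: GenSmooth. Qed.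

Lemma smoothM f g : smooth f -> smooth g -> smooth (fun x => f x * g x).
Proof. by move=> sf sg; apply: gen_smoothP; apply: GenMul; exact: GenSmooth. Qed.

Lemma smooth_comp (phi : R -> R) f : smooth1 phi -> smooth f -> smooth (phi \o f).
Proof. by move=> sp sf; apply: gen_smoothP; apply: GenComp => //; exact: GenSmooth. Qed.

Lemma smooth_ln f : (forall x, 0 < f x) -> smooth f -> smooth (fun x => ln (f x)).
Proof. by move=> sp sf; apply: gen_smoothP; apply: GenLn => //; exact: GenSmooth. Qed.

Lemma smooth_inv f : (forall x, 0 < f x) -> smooth f -> smooth (fun x => (f x)^-1).
Proof. by move=> sp sf; apply: gen_smoothP; apply: GenInv => //; exact: GenSmooth. Qed.

Lemma is_derive_coord i x v : is_derive x v (fun y : X => y 0 i) (v 0 i).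
Proof.
apply: line_is_derive.
have -> : (fun s : R => (x + s *: v) 0 i) = (fun s : R => x 0 i + s * v 0 i).
  by apply/funext => s; rewrite !mxE.
have h := is_deriveD (is_derive_cst (x 0 i) (0:R) (1:R))
  (is_deriveM (is_derive_id (0:R) (1:R)) (is_derive_cst (v 0 i) (0:R) (1:R))).
by apply: is_derive_eq h _; rewrite add0r /GRing.scale/= mulr0 add0r mulr1.
Qed.

Lemma smooth_coord i : smooth (fun x : X => x 0 i).
Proof.
move=> s; have /= : (exists c, foldr (@partial R n) (fun x : X => x 0 i) s = fun=> c) \/
    foldr (@partial R n) (fun x : X => x 0 i) s = fun x => x 0 i.
  elim: s => [|j s]; first by right.
  case=> [[c /= ->]|/= ->].
    by left; exists 0; rewrite (@is_derive_partial _ j (fun=> 0)).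
  left; exists ((delta_mx 0 j : X) 0 i).
  by apply: is_derive_partial => x; exact: is_derive_coord.
case=> [[c ->]|->]; split.
- exact: cst_continuous.
- by move=> j x; exact: derivable_cst.
- exact: coord_continuous.
- by move=> j x; exact: (@ex_derive _ _ _ _ _ _ _ (is_derive_coord i x (delta_mx 0 j))).
Qed.

Lemma smoothZ (c : R) f : smooth f -> smooth (fun x => c * f x).
Proof. by move=> sf; exact: (smoothM (smooth_cst c) sf). Qed.

Lemma smooth_sum (I : Type) (s : seq I) (h : I -> X -> R) :
  (forall k, smooth (h k)) -> smooth (fun x => \sum_(k <- s) h k x).
Proof.
move=> hs; elim: s => [|a s IH].
  rewrite (_ : (fun x => _) = fun=> 0); first exact: smooth_cst.
  by apply/funext => x; rewrite big_nil.
rewrite (_ : (fun x => _) = fun x => h a x + \sum_(k <- s) h k x).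
  exact: (smoothD (hs a) IH).
by apply/funext => x; rewrite big_cons.
Qed.

Lemma smooth_prod (I : Type) (s : seq I) (h : I -> X -> R) :
  (forall k, smooth (h k)) -> smooth (fun x => \prod_(k <- s) h k x).
Proof.
move=> hs; elim: s => [|a s IH].
  rewrite (_ : (fun x => _) = fun=> 1); first exact: smooth_cst.
  by apply/funext => x; rewrite big_nil.
rewrite (_ : (fun x => _) = fun x => h a x * \prod_(k <- s) h k x).
  exact: (smoothM (hs a) IH).
by apply/funext => x; rewrite big_cons.
Qed.

Lemma smooth_dotmx (a : X) : smooth (fun x => dotmx a x).
Proof.
apply: smooth_sum => i; apply: smooth_sum => j.
by apply: smoothZ; rewrite ord1; exact: smooth_coord.
Qed.

Lemma partialD f g i : smooth f -> smooth g ->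
  partial i (fun x => f x + g x) = (fun x => partial i f x + partial i g x).
Proof.
by move=> sf sg; apply: is_derive_partial => x; apply: is_deriveD; exact: smooth_is_derive.
Qed.

Lemma partialM f g i : smooth f -> smooth g ->
  partial i (fun x => f x * g x) = (fun x => f x * partial i g x + g x * partial i f x).
Proof.
move=> sf sg; apply: is_derive_partial => x.
by apply: (is_deriveM (smooth_is_derive i x sf) (smooth_is_derive i x sg)).
Qed.

Lemma partialZ (c : R) f i : smooth f ->
  partial i (fun x => c * f x) = (fun x => c * partial i f x).
Proof.
move=> sf; apply: is_derive_partial => x.
exact: (is_deriveZ c (smooth_is_derive i x sf)).
Qed.

Lemma partial_sum (I : Type) (s : seq I) (h : I -> X -> R) i :
  (forall k, smooth (h k)) ->
  partial i (fun x => \sum_(k <- s) h k x) = (fun x => \sum_(k <- s) partial i (h k) x).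
Proof.
move=> hs; elim: s => [|a s IH].
  rewrite (_ : (fun x => _) = fun=> 0); last by apply/funext => x; rewrite big_nil.
  rewrite (_ : (fun x => \sum_(k <- [::]) _) = fun=> 0); last first.
    by apply/funext => x; rewrite big_nil.
  by rewrite (@is_derive_partial _ i (fun=> 0)).
rewrite (_ : (fun x => _) = fun x => h a x + \sum_(k <- s) h k x); last first.
  by apply/funext => x; rewrite big_cons.
rewrite partialD//; last exact: smooth_sum.
by rewrite IH; apply/funext => x; rewrite big_cons.
Qed.

Lemma partial_dotmx (a : X) i : partial i (fun x => dotmx a x) = fun=> a 0 i.
Proof.
rewrite /dotmx; apply: is_derive_partial => x; apply: line_is_derive.
have E (s : R) : \sum_i0 \sum_j a i0 j * (x + s *: delta_mx 0 i) i0 j =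
    \sum_i0 \sum_j a i0 j * x i0 j + s * a 0 i.
  rewrite !big_ord1; under eq_bigr do rewrite !mxE mulrDr.
  rewrite big_split/=; congr (_ + _); rewrite (bigD1 i)//= !eqxx/= big1 ?addr0.
    by rewrite mulr1 mulrC.
  by move=> j ji; rewrite (negbTE ji)/= mulr0 mulr0.
under [fun s : R => _]eq_fun do rewrite E.
have h := is_deriveD (is_derive_cst (\sum_i0 \sum_j a i0 j * x i0 j) (0:R) (1:R))
  (is_deriveM (is_derive_id (0:R) (1:R)) (is_derive_cst (a 0 i) (0:R) (1:R))).
by apply: is_derive_eq h _; rewrite add0r /GRing.scale/= mulr0 add0r mulr1.
Qed.

End smooth_rV.

(** * Derivatives of smooth functions in arbitrary directions *)

Section directional_derivative.
Context {R : realType} {n : nat}.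
Local Notation X := 'rV[R]_n.
Implicit Types (f g : X -> R) (x v : X) (i : 'I_n).

Lemma MVT_line (V : normedModType R) (f df : V -> R) (y v : V) (a : R) :
  (forall x : V, is_derive x v f (df x)) ->
  exists2 c : R, `|c| <= `|a| & f (y + a *: v) - f y = a * df (y + c *: v).
Proof.
move=> fd.
have gd (t : R) : is_derive t 1 (fun s : R => f (y + s *: v)) (df (y + t *: v)).
  exact: is_derive_line.
have gc (i : interval R) : {within [set` i], continuous (fun s : R => f (y + s *: v))}.
  by apply: continuous_subspaceT; exact: (is_derive_continuous gd).
have [a0|a0] := leP 0 a.
  have [c ca h] := MVT_segment a0 (fun t _ => gd t) (gc _).
  exists c; last by move: h; rewrite scale0r addr0 subr0 mulrC.
  by move: ca; rewrite in_itv/= => /andP[c0 ca]; rewrite !ger0_norm.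
have [c ca h] := MVT_segment (ltW a0) (fun t _ => gd t) (gc _).
exists c; last by apply: oppr_inj; rewrite opprB; move: h; rewrite scale0r addr0 sub0r mulrN mulrC.
move: ca; rewrite in_itv/= => /andP[c0 ca]; rewrite (ltr0_norm a0) ler0_norm//.
by rewrite lerN2.
Qed.

(** Strict differentiability: the base point [y] varies near [x] as well. This uniformity makes the
    notion additive in [v], since the second increment starts from [y + h *: v]. It bridges the gap
    between [smooth], which speaks of coordinate directions, and the arbitrary normals of the
    faces. *)
Definition strict_derive f x v (d : R) := forall e : R, 0 < e ->
  exists2 r : R, 0 < r & forall (y : X) (h : R), (forall i, `|y 0 i - x 0 i| < r) ->
    `|h| < r -> `|f (y + h *: v) - f y - h * d| <= e * `|h|.

Lemma strict_derive_basis f i x (c : R) : smooth f ->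
  strict_derive f x (c *: delta_mx 0 i) (c * partial i f x).
Proof.
move=> sf e e0; pose C := `|c| + 1.
have C0 : 0 < C by rewrite ltr_pwDr.
have cdf : continuous (partial i f) by apply: smooth_continuous; exact: smooth_partial.
have /nbhs_ballP[r r0 hr] : nbhs x [set z | `|partial i f x - partial i f z| < e / C].
  by have /cvgrPdist_lt/(_ (e / C)) := cdf x; apply; rewrite divr_gt0.
have C1 : 0 < 1 + C by rewrite ltr_pwDl// ltW.
(* The base point contributes less than [r / (1 + C)] and the displacement along the axis at most
   [C] times as much; together they stay within [r]. *)
exists (r / (1 + C)); first by rewrite divr_gt0.
move=> y h yx hr'.
have [t th E] := @MVT_line X f (partial i f) y (delta_mx 0 i) (h * c) (fun z => smooth_is_derive i z sf).
rewrite scalerA E mulrA -mulrBr normrM.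
suff H : `|partial i f (y + t *: delta_mx 0 i) - partial i f x| <= e / C.
  apply: le_trans (ler_wpM2l (normr_ge0 _) H) _.
  rewrite normrM -mulrA [leRHS]mulrC; apply: ler_wpM2l => //.
  by rewrite mulrCA ler_piMr// ?(ltW e0)// ler_pdivrMr// mul1r /C lerDl.
rewrite distrC; apply/ltW/hr; split => // j k; rewrite ord1 !mxE eqxx/=.
have := yx k; set P := y 0 k => yk.
have tk : `|t * (k == i)%:R| <= `|h| * C.
  rewrite normrM; case: (k == i); rewrite ?normr1 ?normr0 ?mulr1 ?mulr0.
    by apply: le_trans th _; rewrite normrM ler_wpM2l// /C; lra.
  by rewrite mulr_ge0// ltW.
have hC : `|h| * C < r / (1 + C) * C by rewrite ltr_pM2r.
have sE : r = r / (1 + C) + r / (1 + C) * C by field; rewrite gt_eqF.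
rewrite /ball/= distrC {}[X in _ < X]sE addrAC (le_lt_trans (ler_normD _ _))//.
by rewrite ltrD// (le_lt_trans tk).
Qed.

Lemma strict_deriveD f x v w (c d : R) :
  strict_derive f x v c -> strict_derive f x w d ->
  strict_derive f x (v + w) (c + d).
Proof.
move=> hv hw e e0; have e20 : 0 < e / 2 by rewrite divr_gt0.
have [r r0 Hr] := hv _ e20; have [s s0 Hs] := hw _ e20.
pose B : R := 1 + \sum_i `|v 0 i|.
have vB i : `|v 0 i| <= B.
  by rewrite /B (bigD1 i)//= addrCA lerDl addr_ge0// sumr_ge0.
have B0 : 0 < B by rewrite ltr_pwDl// sumr_ge0.
exists (Num.min r (s / (1 + B))).
  by rewrite lt_min r0/= divr_gt0// addr_gt0.
move=> y h yx; rewrite lt_min => /andP[hr hs].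
have H1 : `|f (y + h *: v) - f y - h * c| <= e / 2 * `|h|.
  by apply: Hr => // i; have := yx i; rewrite lt_min => /andP[].
have sE : s = s / (1 + B) + s / (1 + B) * B by field; rewrite gt_eqF// addr_gt0.
have H2 : `|f (y + h *: v + h *: w) - f (y + h *: v) - h * d| <= e / 2 * `|h|.
  apply: Hs; last first.
    apply: lt_le_trans hs _; rewrite {2}sE lerDl mulr_ge0 ?ltW// divr_gt0// addr_gt0//.
  move=> i; have := yx i; rewrite lt_min => /andP[_ yi]; rewrite !mxE sE addrAC.
  rewrite (le_lt_trans (ler_normD _ _))// ltr_leD// normrM.
  by apply: ler_pM => //; exact: ltW.
rewrite scalerDr addrA.
have -> : f (y + h *: v + h *: w) - f y - h * (c + d) =
  (f (y + h *: v + h *: w) - f (y + h *: v) - h * d) + (f (y + h *: v) - f y - h * c).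
  by ring.
apply: le_trans (ler_normD _ _) _; have : e * `|h| = e / 2 * `|h| + e / 2 * `|h| by field.
by move=> ->; exact: lerD.
Qed.

Lemma is_derive_smooth f x v : smooth f ->
  is_derive x v f (\sum_i v 0 i * partial i f x).
Proof.
move=> sf.
have : strict_derive f x v (\sum_i v 0 i * partial i f x).
  rewrite {1}[v]row_sum_delta; apply: (big_ind2 (fun v d => strict_derive f x v d)).
  - move=> e e0; exists 1 => // y h _ _.
    by rewrite scaler0 addr0 subrr mulr0 subr0 normr0 mulr_ge0// ltW.
  - by move=> v1 d1 v2 d2; exact: strict_deriveD.
  - by move=> i _; exact: strict_derive_basis.
move=> sd; set d := \sum_i _ in sd *.
suff H : (fun h : R => h^-1 *: ((f \o shift x) (h *: v) - f x)) @ 0^' --> d.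
  by split; [apply/cvg_ex; exists d|apply/cvg_lim].
apply/cvgrPdist_le => e e0; have [r r0 hr] := sd _ e0.
near=> h.
have hn0 : h != 0 by near: h; exact: nbhs_dnbhs_neq.
have hlt : `|h| < r.
  near: h; apply: nbhs_dnbhs; apply/nbhs_ballP; exists r => //= z.
  by rewrite /ball/= sub0r normrN.
have := hr x h _ hlt; rewrite /= (addrC (h *: v)).
have xx i : `|x 0 i - x 0 i| < r by rewrite subrr normr0.
move=> /(_ xx) H.
have hp : 0 < `|h| by rewrite normr_gt0.
rewrite -(ler_pM2r hp) distrC -normrM; apply: le_trans H.
rewrite le_eqVlt; apply/orP; left; apply/eqP; congr `|_|.
by rewrite /GRing.scale/=; field.
Unshelve. all: by end_near. Qed.

End directional_derivative.

(** * Integrals of derivatives of compactly supported functions *)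

Section integration_by_parts.
Context {R : realType} {n : nat}.
Local Notation X := 'rV[R]_n.
Local Notation mu := (leb R n).
Implicit Types (f g : X -> R) (x v : X) (i : 'I_n) (K : set X).

Lemma compact_closed_rV K : compact K -> closed K.
Proof. by apply: compact_closed; exact: norm_hausdorff. Qed.

Lemma compact_measurable_rV K : compact K -> measurable K.
Proof. by move=> cK; apply: closed_measurable_rV; exact: compact_closed_rV. Qed.

Lemma leb_compact K : compact K -> (mu K < +oo)%E.
Proof.
move=> cK; apply: leb_bounded; first exact: compact_measurable_rV.
exact: compact_bounded.
Qed.

Lemma continuous_bounded_compact f K : continuous f -> compact K ->
  exists2 C : R, 0 <= C & forall x, K x -> `|f x| <= C.
Proof.
move=> cf cK; have : compact (f @` K).
  by apply: continuous_compact => //; exact: continuous_subspaceT.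
move=> /compact_bounded[M [_ hM]]; exists (`|M| + 1); first by rewrite addr_ge0.
move=> x Kx; apply: hM; last by exists x.
by rewrite (le_lt_trans (ler_norm _))// ltrDl.
Qed.

Lemma continuous_intg_compact f K : continuous f -> compact K ->
  intg mu K f.
Proof.
move=> cf cK; have [C C0 hC] := continuous_bounded_compact cf cK.
apply: measurable_bounded_integrable.
- exact: compact_measurable_rV.
- exact: leb_compact.
- by apply: measurable_funTS; exact: continuous_measurable_rV.
- exists C; split; first exact: num_real.
  by move=> y Cy x Kx; apply: le_trans (hC _ Kx) (ltW Cy).
Qed.

Lemma partial_eq0_open f i (U : set X) : open U -> (forall x, U x -> f x = 0) ->
  forall x, U x -> partial i f x = 0.
Proof.
move=> oU f0 x Ux; rewrite /partial.
rewrite (@near_eq_derive _ _ _ f (cst 0)) ?derive_cst//.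
by near=> y; apply: f0; near: y; exact: open_nbhs_nbhs.
Unshelve. all: by end_near. Qed.

Lemma partial_eq0_compact f i K : compact K -> (forall x, ~ K x -> f x = 0) ->
  forall x, ~ K x -> partial i f x = 0.
Proof.
move=> cK f0; apply: (@partial_eq0_open f i (~` K)) => //.
by apply: closed_openC; exact: compact_closed_rV.
Qed.

Lemma supp_intg f K (D : set X) : measurable D -> continuous f -> compact K ->
  (forall x, ~ K x -> f x = 0) -> intg mu D f.
Proof.
move=> mD cf cK f0; apply: (@integrableS _ _ _ mu setT) => //.
have := continuous_intg_compact cf cK.
move=> /(integrable_mkcond _ (compact_measurable_rV cK)).1.
apply: eq_integrable => // x _; rewrite /restrict /patch/=.
by case: ifPn => //; rewrite notin_setE => /f0 ->.
Qed.

Lemma Rintegral_shift (a : X) f : intg mu setT f ->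
  \int[mu]_x f (x + a) = \int[mu]_x f x.
Proof.
move=> /measurable_int mf; congr fine; rewrite integralE [RHS]integralE.
congr (_ - _)%E.
  rewrite -[RHS](@ge0_integral_shift _ _ a (EFin \o f)^\+%E)//; last exact: measurable_funepos.
  by apply: eq_integral => x _; rewrite !funeposE.
rewrite -[RHS](@ge0_integral_shift _ _ a (EFin \o f)^\-%E)//; last exact: measurable_funeneg.
by apply: eq_integral => x _; rewrite !funenegE.
Qed.

Lemma intg_shift (a : X) f : intg mu setT f -> intg mu setT (fun x => f (x + a)).
Proof.
move=> /integrableP[mf fi]; apply/integrableP; split.
  by apply: measurableT_comp mf _; exact: measurable_shift.
rewrite (@ge0_integral_shift _ _ a (fun x => `|(f x)%:E|)%E)//.
exact: measurableT_comp.
Qed.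

(** The difference quotients have integral 0 by translation invariance, the mean value theorem
    bounds them by the supremum of the derivative, and dominated convergence passes to the limit. No
    iterated integration is involved. *)
Lemma Rintegral_partial0 f i K : smooth f -> compact K ->
  (forall x, ~ K x -> f x = 0) -> \int[mu]_x partial i f x = 0.
Proof.
move=> sf cK f0; pose e : X := delta_mx 0 i.
have cf := smooth_continuous sf.
have cdf := smooth_continuous (smooth_partial i sf).
have [C C0 hC] := continuous_bounded_compact cdf cK.
have hC' x : `|partial i f x| <= C.
  have [Kx|nKx] := pselect (K x); first exact: hC.
  by rewrite (partial_eq0_compact i cK f0 nKx) normr0.
have [B B0 hB] := bounded_setP (compact_bounded cK).
(* The increments [t k] are at most 1, so all translated supports stay in the cube enlarged by 1. *)
pose Q := [set x : X | forall j, `|x 0 j| <= B + 1].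
have mQ : measurable Q by exact: measurable_cube.
have Qfin : (mu Q < +oo)%E by apply: leb_box; rewrite addr_gt0.
pose t (k : nat) : R := k.+1%:R^-1.
have t0 k : 0 < t k by rewrite invr_gt0.
have t1 k : t k <= 1 by rewrite invf_le1// ler1n.
pose q k x := (t k)^-1 * (f (x + t k *: e) - f x).
have fi : intg mu setT f by exact: (supp_intg _ cf cK f0).
have q0 k : \int[mu]_x q k x = 0.
  rewrite RintegralZl//; last by apply: intgB => //; exact: intg_shift.
  rewrite RintegralB//; last exact: intg_shift.
  by rewrite Rintegral_shift// subrr mulr0.
have qE k x : exists2 c : R, `|c| <= `|t k| & q k x = partial i f (x + c *: e).
  have [c ck E] := @MVT_line R X f (partial i f) x e (t k) (fun z => smooth_is_derive i z sf).
  by exists c => //; rewrite /q E mulKf// gt_eqF.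
have q00 k x : ~ Q x -> q k x = 0.
  move=> nQ; rewrite /q !f0 ?subrr ?mulr0//.
    by move=> Kx; apply: nQ => j; rewrite (le_trans (hB _ Kx j))// lerDl.
  move=> Kx; apply: nQ => j.
  have -> : x 0 j = (x + t k *: e) 0 j - (t k *: e) 0 j by rewrite !mxE addrK.
  rewrite (le_trans (ler_normB _ _))// lerD//; first exact: hB.
  rewrite !mxE eqxx/= normrM (gtr0_norm (t0 k)).
  by case: (_ == _); rewrite ?normr1 ?normr0 ?mulr1 ?mulr0.
have qc : (fun k => \int[mu]_x q k x) @ \oo --> \int[mu]_x partial i f x.
  apply: (@dominated_cvg_Rintegral _ _ _ mu setT _ q (partial i f) (fun x => C * \1_Q x)) => //.
  - move=> k; apply: measurable_funM => //; apply: measurable_funB.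
      by apply: measurableT_comp (continuous_measurable_rV cf) _; exact: measurable_shift.
    exact: continuous_measurable_rV.
  - exact: continuous_measurable_rV.
  - move=> x _; apply/cvgrPdist_le => eps eps0.
    have /nbhs_ballP[r r0 hr] : nbhs x [set z | `|partial i f x - partial i f z| < eps].
      by have /cvgrPdist_lt/(_ eps eps0) := cdf x.
    near=> k; have [c ck ->] := qE k x; apply/ltW/hr; split => // a b.
    have tr : t k < r by near: k; exact: (near_infty_natSinv_lt (PosNum r0)).
    rewrite ord1 !mxE eqxx/= /ball/= opprD addrA subrr sub0r normrN normrM.
    case: (_ == _); rewrite ?normr1 ?normr0 ?mulr1 ?mulr0//.
    by rewrite (le_lt_trans ck)// ger0_norm// ltW.
  - by apply: intgZ => //; exact: intg_indic.
  - move=> k x _; rewrite indicE; have [Qx|nQx] := pselect (Q x).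
      by rewrite mem_set// mulr1; have [c _ ->] := qE k x; exact: hC'.
    by rewrite memNset// mulr0 q00// normr0.
move: qc; rewrite (_ : (fun k => _) = cst 0); last by apply/funext => k; exact: q0.
by move=> /cvg_lim <-//; rewrite lim_cst.
Unshelve. all: by end_near. Qed.

End integration_by_parts.

(** * Cut-off functions of a convex polytope *)

Section dot.
Context {R : realType} {n : nat}.
Implicit Types (a b x y : 'rV[R]_n).

Lemma dotmxE a x : dotmx a x = \sum_j a 0 j * x 0 j.
Proof. by rewrite /dotmx big_ord1. Qed.

Lemma dotmxC a x : dotmx a x = dotmx x a.
Proof. by rewrite !dotmxE; apply: eq_bigr => j _; rewrite mulrC. Qed.

Lemma dotmxDr a x y : dotmx a (x + y) = dotmx a x + dotmx a y.
Proof. by rewrite !dotmxE -big_split/=; apply: eq_bigr => j _; rewrite mxE mulrDr. Qed.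

Lemma dotmxZr a (c : R) x : dotmx a (c *: x) = c * dotmx a x.
Proof. by rewrite !dotmxE mulr_sumr; apply: eq_bigr => j _; rewrite mxE mulrCA. Qed.

Lemma dotmx_sq_ge0 x : 0 <= dotmx x x.
Proof. by rewrite dotmxE; apply: sumr_ge0 => j _; rewrite -expr2 sqr_ge0. Qed.

Lemma dotmx_le1 a b : dotmx a a = 1 -> dotmx b b = 1 -> dotmx a b <= 1.
Proof.
move=> ha hb; have := dotmx_sq_ge0 (a + (-1) *: b).
rewrite !(dotmxDr, dotmxZr) !(dotmxC (_ + _)) !(dotmxDr, dotmxZr) ha hb (dotmxC b a).
lra.
Qed.

End dot.

Section polytope.
Context {R : realType} {n : nat} {Om : set 'rV[R]_n} {m : nat}
  {nrm : 'I_m -> 'rV[R]_n} {off : 'I_m -> R}.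
Hypothesis hOm : convex_polytope Om nrm off.
Hypothesis n0 : (0 < n)%N.
Local Notation X := 'rV[R]_n.
Local Notation mu := (leb R n).
Implicit Types (f g : X -> R) (x v : X) (i : 'I_n) (l : 'I_m).

(** As the normals are unit vectors, this is the signed distance to the hyperplane of face [l],
    positive inside. *)
Definition fdist l x := off l - dotmx (nrm l) x.

Lemma OmP x : Om x <-> forall l, 0 < fdist l x.
Proof.
have [-> _ _ _] := hOm; rewrite /=; split => h l; have := h l;
by rewrite /fdist subr_gt0.
Qed.

Lemma nrm1 l : dotmx (nrm l) (nrm l) = 1.
Proof. by have [_ h _ _] := hOm. Qed.

Lemma bounded_Om : bounded_set Om. Proof. by have [_ _ h _] := hOm. Qed.

Lemma smooth_fdist l : smooth (fdist l).
Proof.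
rewrite (_ : fdist l = fun x => off l + (-1) * dotmx (nrm l) x).
  by apply: (smoothD (smooth_cst _) (smoothZ _ (smooth_dotmx _))).
by apply/funext => x; rewrite mulN1r.
Qed.

Lemma continuous_fdist l : continuous (fdist l).
Proof. exact: (smooth_continuous (smooth_fdist l)). Qed.

Lemma partial_fdist l i : partial i (fdist l) = fun=> - nrm l 0 i.
Proof.
rewrite (_ : fdist l = fun x => off l + (-1) * dotmx (nrm l) x); last first.
  by apply/funext => x; rewrite mulN1r.
rewrite (partialD _ (smooth_cst _) (smoothZ _ (smooth_dotmx _))).
rewrite partialZ; last exact: smooth_dotmx.
rewrite partial_dotmx (@is_derive_partial _ _ (fun=> off l) i (fun=> 0)).
by apply/funext => x; rewrite add0r mulN1r.
Qed.

Lemma open_Om : open Om.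
Proof.
rewrite openE => x /OmP h.
have : \forall y \near x, forall l, 0 < fdist l y.
  apply: (@filter_forall _ _ (fun l y => 0 < fdist l y) (nbhs x) _) => l.
  exact: (@cvgr_gt _ _ _ _ (fdist l) _ (@continuous_fdist l x) _ (h l)).
by apply: filterS => y hy; apply/OmP.
Qed.

Lemma mOm : measurable Om. Proof. exact: open_measurable_rV open_Om. Qed.

Lemma Om_fin : (mu Om < +oo)%E.
Proof. exact: leb_bounded mOm bounded_Om. Qed.

(** Without half-spaces [Om] would be the whole space, which is unbounded. The existence of a face
    keeps [lse] positive and provides an index when the trace on some face is wanted. *)
Lemma m_gt0 : (0 < m)%N.
Proof.
have [K K0 hK] := bounded_setP bounded_Om.
rewrite lt0n; apply/eqP => m0.
have : Om (\row__ (K + 1)).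
  by apply/OmP => l; exfalso; move: (ltn_ord l); move: (nat_of_ord l) => a; rewrite m0.
move=> /hK/(_ (Ordinal n0)); rewrite mxE => h.
by have := le_trans (ler_norm _) h; lra.
Qed.

Definition lse (p : R) x := \sum_l expR (- p * fdist l x).

(** For positive [p] it lies between the smallest distance minus [ln m / p] and the smallest
    distance itself. *)
Definition softmin (p : R) x := - p^-1 * ln (lse p x).

(** The weights sum to 1; they are the coefficients of the normals in the gradient of [softmin], up
    to sign. *)
Definition softw (p : R) l x := expR (- p * fdist l x) / lse p x.

Lemma lse_gt0 p x : 0 < lse p x.
Proof.
rewrite /lse (bigD1 (Ordinal m_gt0))//= ltr_pwDl ?expR_gt0//.
by apply: sumr_ge0 => l _; exact: expR_ge0.
Qed.

Lemma smooth_expfdist p l : smooth (fun x => expR (- p * fdist l x)).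
Proof. exact: (smooth_comp (@smooth1_expR R (- p)) (smooth_fdist l)). Qed.

Lemma smooth_lse p : smooth (lse p).
Proof. by apply: smooth_sum => l; exact: smooth_expfdist. Qed.

Lemma smooth_softmin p : smooth (softmin p).
Proof. by apply: smoothZ; apply: smooth_ln; [exact: lse_gt0|exact: smooth_lse]. Qed.

Lemma smooth_softw p l : smooth (softw p l).
Proof.
apply: smoothM; first exact: smooth_expfdist.
by apply: smooth_inv; [exact: lse_gt0|exact: smooth_lse].
Qed.

Lemma partial_softmin p i : p != 0 ->
  partial i (softmin p) = fun x => - \sum_l softw p l x * nrm l 0 i.
Proof.
move=> p0.
have de l x : is_derive x (delta_mx 0 i) (fun x => expR (- p * fdist l x))
    (expR (- p * fdist l x) * (p * nrm l 0 i)).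
  have h1 : is_derive (- p * fdist l x) 1 expR (expR (- p * fdist l x)) by exact: is_derive_expR.
  have h2 : is_derive x (delta_mx 0 i) (fun y => - p * fdist l y) (p * nrm l 0 i).
    have := is_deriveZ (- p) (smooth_is_derive i x (smooth_fdist l)).
    by move=> h; apply: is_derive_eq h _; rewrite partial_fdist /GRing.scale/= mulrNN.
  exact: (@is_derive_comp1 _ _ expR (fun y => - p * fdist l y) x _ _ _ h1 h2).
apply: is_derive_partial => x.
have dl : is_derive x (delta_mx 0 i) (lse p) (\sum_l expR (- p * fdist l x) * (p * nrm l 0 i)).
  have := smooth_is_derive i x (smooth_lse p); rewrite /lse.
  rewrite (partial_sum _ i (smooth_expfdist p)) => h; apply: is_derive_eq h _.
  by apply: eq_bigr => l _; rewrite (is_derive_partial (de l)).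
have h := is_deriveZ (- p^-1) (is_derive_comp1 (is_derive1_ln (lse_gt0 p x)) dl).
apply: is_derive_eq h _; rewrite /GRing.scale/= mulNr mulr_sumr mulr_sumr; congr (- _).
apply: eq_bigr => l _; rewrite /softw; field.
by rewrite p0 gt_eqF// lse_gt0.
Qed.

Lemma softw_ge0 p l x : 0 <= softw p l x.
Proof. by rewrite divr_ge0 ?expR_ge0// ltW// lse_gt0. Qed.

Lemma lse_ge p l x : expR (- p * fdist l x) <= lse p x.
Proof.
rewrite /lse (bigD1 l)//= lerDl; apply: sumr_ge0 => k _; exact: expR_ge0.
Qed.

(** Keep only the term [l'] of the denominator. If face [l'] is strictly nearer than [l], the weight
    of [l] decays exponentially in [p]. *)
Lemma softw_le p l l' x : softw p l x <= expR (- p * (fdist l x - fdist l' x)).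
Proof.
rewrite ler_pdivrMr ?lse_gt0//.
apply: le_trans (ler_wpM2l (expR_ge0 _) (lse_ge p l' x)).
rewrite -expRD (_ : _ + _ = - p * fdist l x)//; ring.
Qed.

Lemma softw_le1 p l x : softw p l x <= 1.
Proof. by rewrite ler_pdivrMr ?lse_gt0// mul1r lse_ge. Qed.

Lemma softmin_le p l x : 0 < p -> softmin p x <= fdist l x.
Proof.
move=> p0; rewrite /softmin mulNr lerNl ler_pdivlMl// mulrN -mulNr.
by rewrite -[leLHS]expRK ler_ln ?posrE ?expR_gt0 ?lse_gt0// lse_ge.
Qed.

Lemma softmin_ge p (c : R) x : 0 < p -> (forall l, c <= fdist l x) ->
  c - ln m%:R / p <= softmin p x.
Proof.
move=> p0 hc; have m0 : (0 : R) < m%:R by rewrite ltr0n m_gt0.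
have : lse p x <= m%:R * expR (- p * c).
  rewrite mulr_natl /lse -[m in leRHS]card_ord -sumr_const; apply: ler_sum => l _.
  by rewrite ler_expR ler_wnM2l// oppr_le0 ltW.
move=> h; have : ln (lse p x) <= ln m%:R - p * c.
  rewrite -[X in _ + X](expRK (- (p * c))) -mulNr -lnM ?posrE ?expR_gt0//.
  by rewrite ler_ln ?posrE ?lse_gt0 ?mulr_gt0 ?expR_gt0.
move=> h2; rewrite /softmin mulNr (mulrC p^-1).
rewrite (_ : c - _ = - ((ln m%:R - p * c) / p)); last by field; rewrite gt_eqF.
rewrite lerN2; apply: ler_wpM2r; last exact: h2.
by rewrite invr_ge0 ltW.
Qed.

(** For positive [k] it vanishes where [softmin] is at most [1/k] and equals 1 from [2/k] on: [k]
    sets the width of the layer, [p] the sharpness of the transition between faces. *)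
Definition cutoff (k p : R) x := step (k * softmin p x - 1).

Lemma cutoff_ge0 k p x : 0 <= cutoff k p x. Proof. exact: step_ge0. Qed.

Lemma cutoff_le1 k p x : cutoff k p x <= 1. Proof. exact: step_le1. Qed.

Lemma smooth_step (f : X -> R) : smooth f -> smooth (fun x => step (f x)).
Proof.
move=> sf; apply: smoothM; first exact: (smooth_comp (@smooth1_flat R 1) sf).
apply: smooth_inv; first by move=> x; exact: flat1_den_gt0.
apply: smoothD; first exact: (smooth_comp (@smooth1_flat R 1) sf).
apply: (smooth_comp (@smooth1_flat R 1)).
rewrite (_ : (fun x => _) = fun x => 1 + (-1) * f x); first exact: (smoothD (smooth_cst _) (smoothZ _ sf)).
by apply/funext => x; rewrite mulN1r.
Qed.

Let smooth_arg k p : smooth (fun x => k * softmin p x - 1).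
Proof. exact: (smoothD (smoothZ _ (smooth_softmin p)) (smooth_cst _)). Qed.

Lemma smooth_cutoff k p : smooth (cutoff k p).
Proof. by apply: smooth_step; exact: smooth_arg. Qed.

Lemma partial_cutoff k p i : p != 0 -> partial i (cutoff k p) =
  fun x => - (k * dstep (k * softmin p x - 1) * \sum_l softw p l x * nrm l 0 i).
Proof.
move=> p0; apply: is_derive_partial => x.
have h := @is_derive_comp1 _ _ step (fun y => k * softmin p y - 1) x _ _ _
  (is_derive_step (k * softmin p x - 1)) (smooth_is_derive i x (smooth_arg k p)).
apply: is_derive_eq h _.
rewrite (partialD _ (smoothZ _ (smooth_softmin p)) (smooth_cst _)).
rewrite (partialZ _ _ (smooth_softmin p)) (partial_softmin _ p0).
rewrite (@is_derive_partial _ _ (fun=> -1) i (fun=> 0)) addr0; ring.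
Qed.

Definition inner (k : R) : set X := [set x | forall l, k^-1 <= fdist l x].

Lemma compact_inner k : 0 < k -> compact (inner k).
Proof.
move=> k0; apply: bounded_closed_compact.
  have [K K0 hK] := bounded_setP bounded_Om; apply: (@bounded_set_coord _ _ _ K).
  move=> x hx; apply: hK; apply/OmP => l; apply: lt_le_trans (hx l).
  by rewrite invr_gt0.
rewrite (_ : inner k = \bigcap_(l in setT) (fdist l @^-1` [set z | k^-1 <= z])).
  apply: closed_bigI => l _; apply: preimage_closed; last exact: closed_ge.
  by move=> y _; exact: continuous_fdist.
by apply/seteqP; split => x h l; [move=> _|]; exact: h.
Qed.

Lemma inner_Om k : 0 < k -> inner k `<=` Om.
Proof. by move=> k0 x hx; apply/OmP => l; apply: lt_le_trans (hx l); rewrite invr_gt0. Qed.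

(** [softmin] lies below every distance, so a single distance smaller than [1/k] puts the point
    where the profile is 0. *)
Lemma cutoff_supp k p x : 0 < k -> 0 < p -> ~ inner k x -> cutoff k p x = 0.
Proof.
move=> k0 p0 nx; apply: step_le0; rewrite subr_le0 leNgt; apply/negP => h; apply: nx => l.
apply: le_trans (softmin_le l x p0); rewrite -[leLHS]mul1r ler_pdivrMr// mulrC.
exact: ltW.
Qed.

Lemma cutoff_eq1 k p x : 0 < k -> 2 / k <= softmin p x -> cutoff k p x = 1.
Proof. by move=> k0 h; apply: step_ge1; move: h; rewrite ler_pdivrMr// mulrC; lra. Qed.

Lemma dcutoff_eq0 k p x : 0 < k -> 2 / k <= softmin p x -> dstep (k * softmin p x - 1) = 0.
Proof. by move=> k0 h; apply: dstep_ge1; move: h; rewrite ler_pdivrMr// mulrC; lra. Qed.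

Lemma test_fun_cutoff k p : 0 < k -> 0 < p -> test_fun Om (cutoff k p).
Proof.
move=> k0 p0; split; first exact: smooth_cutoff.
exists (inner k); split; [exact: compact_inner|exact: inner_Om|].
by move=> x; exact: cutoff_supp.
Qed.

Lemma test_funM f g : smooth f -> test_fun Om g -> test_fun Om (fun x => f x * g x).
Proof.
move=> sf [sg [K [cK KOm g0]]]; split; first exact: smoothM.
by exists K; split => // x /g0 ->; rewrite mulr0.
Qed.

Lemma test_fun_partial i g : test_fun Om g -> test_fun Om (partial i g).
Proof.
move=> [sg [K [cK KOm g0]]]; split; first exact: smooth_partial.
by exists K; split => //; exact: partial_eq0_compact.
Qed.

(* Any [p] with [k * ln m <= p] works: the softmin is then within [1/k] of the
   distance to the boundary. *)
Lemma cutoff_cvg (p_ : nat -> R) x : (forall k, 0 < p_ k) ->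
  (forall k, k.+1%:R * ln m%:R <= p_ k) -> Om x ->
  \forall k \near \oo, cutoff k.+1%:R (p_ k) x = 1.
Proof.
move=> p0 hp /OmP Ox.
have [c c0 hc] : exists2 c : R, 0 < c & forall l, c <= fdist l x.
  have [l _ hl] := @arg_minP _ _ _ (Ordinal m_gt0) predT (fun l => fdist l x) isT.
  by exists (fdist l x) => // k; exact: hl.
near=> k; have k0 : (0 : R) < k.+1%:R by rewrite ltr0n.
apply: cutoff_eq1 => //; apply: le_trans (softmin_ge (p0 k) hc).
have H1 : ln m%:R / p_ k <= k.+1%:R^-1.
  by rewrite ler_pdivrMr ?p0// -ler_pdivrMl ?invr_gt0// invrK.
(* [softmin] is at least [c - 1 / k.+1] and has to reach [2 / k.+1], hence the third. *)
have H2 : k.+1%:R^-1 < c / 3.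
  near: k; exact: (near_infty_natSinv_lt (PosNum (divr_gt0 c0 (ltr0n R 3)))).
move: H1 H2; move: (k.+1%:R^-1) (ln _ / _) => a b; lra.
Unshelve. all: by end_near. Qed.

End polytope.

(** * Weak derivatives *)

Section orthants.
Context {R : realType} {n : nat}.
Local Notation X := 'rV[R]_n.
Local Notation mu := (leb R n).

Definition orthant (c : X) : set X := [set x | forall i, x 0 i < c 0 i].

Lemma measurable_orthant c : measurable (orthant c).
Proof.
rewrite (_ : orthant c = \bigcap_(i in [set: 'I_n])
     ((fun x : X => x 0 i : measurableTypeR R) @^-1` `]-oo, (c 0 i)[%classic)).
  apply: fin_bigcap_measurable => // i _.
  by rewrite -[X in measurable X]setTI; apply: measurable_coord.
by apply/seteqP; split => x /= h i; [move=> _|]; have := h i;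
  rewrite /= in_itv//=; exact.
Qed.

(** Unlike the half-spaces that define the sigma-algebra, the orthants are stable under
    intersection, as Dynkin's theorem requires of a generator. *)
Lemma measurable_rVE : @measurable _ X = <<s range orthant >>.
Proof.
apply/seteqP; split => [A mA|A]; last first.
  apply: smallest_sub; first exact: sigma_algebra_measurable.
  by move=> _ [c _ <-]; exact: measurable_orthant.
have mid : measurable_fun setT (id : g_sigma_algebraType (range orthant) -> X).
  apply: measurable_fun_rV => i.
  apply: (measurability _ (RGenInftyO.measurableE R)) => // _ [_ [a ->] <-].
  (* The half-space [x 0 i < a] is the union over [N] of the orthants whose corner has [a] at place
     [i] and [N] at all other places. *)
  rewrite setTI; rewrite [X in measurable X](_ : _ = \bigcup_(N in [set: nat])
    (orthant (\row_j (if j == i then a else N%:R)) : set (g_sigma_algebraType (range orthant)))).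
    apply: bigcup_measurable => N _; apply: sub_sigma_algebra.
    by eexists.
  apply/seteqP; split => x /=; last first.
    by move=> [N _ /(_ i)]; rewrite mxE eqxx in_itv.
  rewrite in_itv/= => xa; pose B := \sum_j `|x 0 j|.
  exists (Num.bound B) => //= j; rewrite mxE; case: eqP => [->//|_].
  apply: le_lt_trans (archi_boundP _); last by apply: sumr_ge0.
  by apply: le_trans (ler_norm _) _; rewrite /B (bigD1 j)//= lerDl sumr_ge0.
by have := mid measurableT A mA; rewrite setTI.
Qed.

(* Dynkin's theorem: the half-open orthants are a generating pi-system. *)
Lemma orthant_ae0 (D : set X) (f : X -> R) : measurable D -> bounded_set D ->
  intg mu D f -> (forall c, \int[mu]_(x in D) (f x * \1_(orthant c) x) = 0) ->
  ae_eq mu D f (cst 0).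
Proof.
move=> mD bD fi h.
have fi1 A : measurable A -> intg mu D (fun x => f x * \1_A x).
  move=> mA; apply: (@le_intg _ _ _ mu D mD _ (fun x => `|f x|)) => //.
  - apply: measurable_funM; [exact: intg_meas fi|exact: measurable_indic].
  - move=> x _; rewrite normrM indicE; case: (_ \in _); rewrite ?normr1 ?mulr1//.
    by rewrite normr0 mulr0.
  - exact: intg_norm.
suff H A : measurable A -> \int[mu]_(x in D) (f x * \1_A x) = 0.
  have : ae_eq mu D (EFin \o f) (cst 0%E).
    apply: integral_ae_eq => //.
    move=> E ED mE; rewrite integral0.
    have fE : mu.-integrable E (EFin \o f) by exact: integrableS fi.
    have := H E mE.
    rewrite (_ : \int[mu]_(x in D) _ = \int[mu]_(x in E) f x).
      by move=> e; rewrite -[LHS]fineK ?integrable_fin_num// [fine _]e.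
    rewrite -{2}(setIidr ED) Rintegral_mkcondr; apply: eq_Rintegral => x _.
    by rewrite /patch indicE; case: ifP; rewrite ?mulr1 ?mulr0.
  by apply: filterS => x hx Dx; have [] := hx Dx.
rewrite measurable_rVE; move: A.
apply: (@dynkin_induction _ X (range orthant)
   (fun A => \int[mu]_(x in D) (f x * \1_A x) = 0)).
- exact: measurable_rVE.
- move=> _ _ [c _ <-] [d _ <-]; exists (\row_i Num.min (c 0 i) (d 0 i)) => //.
  apply/seteqP; split => x /=.
    by move=> hx; split => i; have := hx i; rewrite mxE lt_min => /andP[].
  by move=> [h1 h2] i; rewrite mxE lt_min h1 h2.
(* The bounded set [D] lies in the orthant with corner [K + 1], so the assumption on orthants
   already covers the integral over all of [D]. *)
- have [K K0 hK] := bounded_setP bD.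
  rewrite -[RHS](h (\row_i (K + 1))); apply: eq_Rintegral => x; rewrite inE => Dx.
  rewrite !indicE !mem_set// => i; rewrite mxE.
  by apply: le_lt_trans (ler_norm _) _; have := hK _ Dx i; lra.
- by move=> _ [c _ <-]; exact: h.
- move=> S mS hS.
  have hT : \int[mu]_(x in D) f x = 0.
    have [K K0 hK] := bounded_setP bD.
    rewrite -[RHS](h (\row_i (K + 1))); apply: eq_Rintegral => x; rewrite inE => Dx.
    rewrite indicE mem_set ?mulr1// => i; rewrite mxE.
    by apply: le_lt_trans (ler_norm _) _; have := hK _ Dx i; lra.
  rewrite (_ : \int[mu]_(x in D) _ = \int[mu]_(x in D) (f x - f x * \1_S x)).
    by rewrite RintegralB// ?hT ?hS ?subr0//; exact: fi1.
  apply: eq_Rintegral => x _; rewrite !indicE in_setC.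
  by case: (_ \in _); rewrite /= ?mulr1 ?mulr0 ?subrr ?subr0.
- move=> F mF tF hF.
  have c0 : (fun N => \int[mu]_(x in D) (\sum_(k < N) f x * \1_(F k) x)) @ \oo -->
      \int[mu]_(x in D) (f x * \1_(\bigcup_k F k) x).
    have sumE x N : \sum_(k < N) f x * \1_(F k) x =
        f x * \1_(\bigcup_(k < N) F k) x.
      rewrite -mulr_sumr; congr (_ * _).
      have [[k /= kN Fkx]|nF] := pselect ((\bigcup_(k < N) F k) x).
        rewrite indicE mem_set; last by exists k.
        rewrite (bigD1 (Ordinal kN))//= indicE mem_set//= big1 ?addr0// => l lk.
        rewrite indicE memNset// => Flx; move/eqP: lk; apply; apply/val_inj => /=.
        by apply: (tF l k) => //; exists x.
      rewrite indicE memNset// big1// => l _; rewrite indicE memNset// => Flx.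
      by apply: nF; exists l => //=.
    apply: (@dominated_cvg_Rintegral _ _ _ mu D mD _ _ (fun x => `|f x|)).
    + move=> N; apply: measurable_sum => k; apply: measurable_funM; first exact: intg_meas fi.
      exact: measurable_indic.
    + apply: measurable_funM; first exact: intg_meas fi.
      by apply: measurable_indic; apply: bigcup_measurable.
    + move=> x Dx; apply: cvg_near_cst.
      have [[k _ Fkx]|nF] := pselect ((\bigcup_k F k) x).
        near=> N; rewrite sumE !indicE !mem_set//; first by exists k.
        by exists k => //=; near: N; exact: nbhs_infty_gt.
      near=> N; rewrite sumE !indicE !memNset// => -[k _ Fkx]; apply: nF; by exists k.
    + exact: intg_norm.
    + move=> N x _; rewrite sumE normrM indicE; case: (_ \in _); rewrite ?normr1 ?mulr1//.
      by rewrite normr0 mulr0.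
  move: c0; rewrite (_ : (fun N => _) = cst 0).
    by move=> /cvg_lim <-//; rewrite lim_cst.
  apply/funext => N; rewrite Rintegral_sum//; last by move=> k; exact: fi1.
  by rewrite big1.
Unshelve. all: by end_near. Qed.

End orthants.

Section weak.
Context {R : realType} {n : nat} {Om : set 'rV[R]_n} {m : nat}
  {nrm : 'I_m -> 'rV[R]_n} {off : 'I_m -> R}.
Hypothesis hOm : convex_polytope Om nrm off.
Hypothesis n0 : (0 < n)%N.
Local Notation X := 'rV[R]_n.
Local Notation mu := (leb R n).
Implicit Types (f g : X -> R) (x v : X) (i : 'I_n) (l : 'I_m).

Let mD : measurable Om := mOm hOm.

(** Meets the two conditions of [cutoff_cvg]: it dominates [k.+1 * ln m], and the leading 1 keeps it
    positive when [ln m] is 0. *)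
Definition sharpness (k : nat) : R := 1 + k.+1%:R * `|ln m%:R|.

Lemma sharpness_gt0 k : 0 < sharpness k.
Proof. by rewrite ltr_pwDl// mulr_ge0. Qed.

Lemma sharpness_ge k : k.+1%:R * ln m%:R <= sharpness k.
Proof.
rewrite /sharpness; have : k.+1%:R * ln m%:R <= k.+1%:R * `|ln m%:R : R|.
  by rewrite ler_wpM2l// ler_norm.
lra.
Qed.

Definition chi k := cutoff (nrm := nrm) (off := off) k.+1%:R (sharpness k).

Lemma test_chi k : test_fun Om (chi k).
Proof. exact: (test_fun_cutoff hOm n0 _ (sharpness_gt0 k)). Qed.

Lemma chi_cvg x : Om x -> \forall k \near \oo, chi k x = 1.
Proof. exact: (cutoff_cvg hOm n0 sharpness_gt0 sharpness_ge). Qed.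

Lemma L1loc_intg f (psi : X -> R) : L1loc Om f -> test_fun Om psi ->
  intg mu Om (fun x => f x * psi x).
Proof.
move=> [mf hf] [sp [K [cK KOm p0]]].
have cp := smooth_continuous sp.
have [C C0 hC] := continuous_bounded_compact cp cK.
have mK := compact_measurable_rV cK.
have : intg mu K (fun x => f x * psi x).
  apply: (@integrableMl _ _ _ mu K mK (EFin \o f) psi (hf K cK KOm)).
    by apply: measurable_funTS; exact: continuous_measurable_rV.
  exists C; split; first exact: num_real.
  by move=> y Cy x Kx; apply: le_trans (hC _ Kx) (ltW Cy).
move=> /(integrable_mkcond _ mK).1 /(integrableS measurableT mD (@subsetT _ _)).
apply: eq_integrable => // x _; rewrite /patch/=.
by case: ifPn => //; rewrite notin_setE => /p0 ->; rewrite mulr0.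
Qed.

(** Multiplying by [chi k] makes [f] integrable; testing with smooth approximations of the
    indicators of orthants then brings in [orthant_ae0] in place of mollifiers. At each point
    [chi k] is eventually 1, which removes the cut-off. *)
Lemma fundamental f : L1loc Om f ->
  (forall psi, test_fun Om psi -> \int[mu]_(x in Om) (f x * psi x) = 0) ->
  ae_eq mu Om f (cst 0).
Proof.
move=> lf h0; have mf := lf.1.
have H k : ae_eq mu Om (fun x => f x * chi k x) (cst 0).
  have fi := L1loc_intg lf (test_chi k).
  apply: (orthant_ae0 mD (bounded_Om hOm) fi) => c.
  (* Each factor tends to 1 where [x 0 i < c 0 i] and vanishes elsewhere, as [step] is 0 up to 0
     included; the limit of the product is the indicator of the open orthant. *)
  pose psi j x : R := (\prod_i step (j.+1%:R * (c 0 i - x 0 i))) * chi k x.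
  have tpsi j : test_fun Om (psi j).
    apply: test_funM (test_chi k); apply: smooth_prod => i; apply: smooth_step.
    rewrite (_ : (fun x => _) = fun x : X => j.+1%:R * c 0 i + (- j.+1%:R) * x 0 i).
      exact: (smoothD (smooth_cst _) (smoothZ _ (smooth_coord i))).
    by apply/funext => x; ring.
  have : (fun j => \int[mu]_(x in Om) (f x * psi j x)) @ \oo -->
     \int[mu]_(x in Om) (f x * chi k x * \1_(orthant c) x).
    apply: (@dominated_cvg_Rintegral _ _ _ mu Om mD _ _ (fun x => `|f x * chi k x|)).
    - by move=> j; apply: intg_meas; exact: L1loc_intg.
    - apply: measurable_funM; first exact: intg_meas fi.
      by apply: measurable_indic; exact: measurable_orthant.
    - move=> x Ox; apply: cvg_near_cst.
      have [xc|nxc] := pselect (orthant c x).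
        have ev : \forall j \near \oo, forall i, 1 <= j.+1%:R * (c 0 i - x 0 i).
          apply: filter_forall => i; have ci : 0 < c 0 i - x 0 i by rewrite subr_gt0.
          near=> j; rewrite -ler_pdivrMr// div1r -[leLHS]invrK -[leRHS]invrK.
          rewrite lef_pV2 ?posrE ?invr_gt0// ?invrK ?invr_gt0//; apply: ltW; near: j.
          exact: (near_infty_natSinv_lt (PosNum ci)).
        apply: filterS ev => j hj; rewrite indicE mem_set// mulr1 /psi big1 ?mul1r//.
        by move=> i _; apply: step_ge1.
      near=> j; rewrite indicE memNset// mulr0 /psi.
      have [i ci] : exists i, c 0 i <= x 0 i.
        apply/not_existsP => h; apply: nxc => i; rewrite ltNge; apply/negP => ?; exact: (h i).
      have si : step (j.+1%:R * (c 0 i - x 0 i)) = 0.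
        by apply: step_le0; apply: mulr_ge0_le0 => //; rewrite subr_le0.
      by rewrite (bigD1 i)//= si !mul0r mulr0.
    - exact: intg_norm.
    - move=> j x _; rewrite /psi mulrCA normrM ler_piMl//.
      have /andP[p0 p1] : 0 <= \prod_i step (j.+1%:R * (c 0 i - x 0 i)) <= 1.
        elim/big_ind : _ => [|a b /andP[a0 a1] /andP[b0 b1]|i _].
        - by rewrite ler01 lexx.
        - by rewrite mulr_ge0// mulr_ile1.
        - by rewrite step_ge0 step_le1.
      by rewrite ger0_norm.
  rewrite (_ : (fun j => _) = cst 0); last by apply/funext => j; exact: h0.
  by move=> /cvg_lim <-//; rewrite lim_cst.
have := ae_foralln H; apply: filterS => x hx Ox.
have [k hk] := filter_ex (chi_cvg Ox).
by have := hx k Ox; rewrite hk mulr1.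
Unshelve. all: by end_near. Qed.

End weak.

(** * Calculus of weak derivatives in H^1 and H^1_0 *)

Section weak_calculus.
Context {R : realType} {n : nat} {Om : set 'rV[R]_n} {m : nat}
  {nrm : 'I_m -> 'rV[R]_n} {off : 'I_m -> R}.
Hypothesis hOm : convex_polytope Om nrm off.
Hypothesis n0 : (0 < n)%N.
Local Notation X := 'rV[R]_n.
Local Notation mu := (leb R n).
Implicit Types (f g psi : X -> R) (x v : X) (i j : 'I_n) (l : 'I_m).

Let mD : measurable Om := mOm hOm.

Lemma intg_L1loc f : intg mu Om f -> L1loc Om f.
Proof.
move=> fi; split; first exact: intg_meas fi.
by move=> K cK KOm; apply: integrableS fi => //; exact: compact_measurable_rV.
Qed.

Lemma sqi_cst (c : R) : sqi mu Om (fun=> c).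
Proof. by apply: (@sqi_bounded _ _ _ mu Om mD _ `|c|) => //; exact: (Om_fin hOm). Qed.

Lemma sqi_intg f : sqi mu Om f -> intg mu Om f.
Proof.
move=> sf; apply: (@eq_intg _ _ _ mu Om mD (fun x => f x * 1)).
  by move=> x _; rewrite mulr1.
exact: (sqi_mul mD sf (sqi_cst 1)).
Qed.

Lemma sqi_L1loc f : sqi mu Om f -> L1loc Om f.
Proof. by move=> /sqi_intg/intg_L1loc. Qed.

Lemma test_supp_intg psi : test_fun Om psi -> intg mu Om psi.
Proof.
move=> [sp [K [cK KOm p0]]]; apply: (supp_intg mD _ cK p0).
exact: smooth_continuous.
Qed.

Lemma bounded_smooth psi : smooth psi -> exists2 C : R, 0 <= C & forall x, Om x -> `|psi x| <= C.
Proof.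
move=> sp; have [K K0 hK] := bounded_setP (bounded_Om hOm).
pose Q := [set x : X | forall i, `|x 0 i| <= K].
have cQ : compact Q.
  apply: bounded_closed_compact; first by apply: (@bounded_set_coord _ _ _ K).
  rewrite (_ : Q = \bigcap_(i in setT) ((fun x : X => x 0 i) @^-1` [set z | `|z| <= K])).
    apply: closed_bigI => i _; apply: preimage_closed.
      by move=> x _; exact: coord_continuous.
    apply: (@preimage_closed _ _ (@Num.Def.normr R R) [set z | z <= K]); last exact: closed_le.
    by move=> x _; exact: norm_continuous.
  by apply/seteqP; split => x h i; [move=> _|]; exact: h.
have [C C0 hC] := continuous_bounded_compact (smooth_continuous sp) cQ.
by exists C => // x Ox; apply: hC => i; exact: hK.
Qed.

Lemma sqi_smooth psi : smooth psi -> sqi mu Om psi.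
Proof.
move=> sp; have [C C0 hC] := bounded_smooth sp.
apply: (@sqi_bounded _ _ _ mu Om mD _ C) => //; first exact: (Om_fin hOm).
by apply: measurable_funTS; apply: continuous_measurable_rV; exact: smooth_continuous.
Qed.

Lemma L1locD f g : L1loc Om f -> L1loc Om g -> L1loc Om (fun x => f x + g x).
Proof.
move=> [mf hf] [mg hg]; split; first exact: measurable_funD.
move=> K cK KOm; have mK := compact_measurable_rV cK.
exact: (intgD mK (hf K cK KOm) (hg K cK KOm)).
Qed.

Lemma L1locZ (c : R) f : L1loc Om f -> L1loc Om (fun x => c * f x).
Proof.
move=> [mf hf]; split; first exact: measurable_funM.
move=> K cK KOm; have mK := compact_measurable_rV cK.
exact: (intgZ mK c (hf K cK KOm)).
Qed.

Lemma wp_unique i f g g' : weak_partial Om i f g -> weak_partial Om i f g' ->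
  ae_eq mu Om g g'.
Proof.
move=> [_ lg hg] [_ lg' hg'].
have : ae_eq mu Om (fun x => g x + (-1) * g' x) (cst 0).
  apply: (fundamental hOm n0); first by apply: L1locD => //; exact: L1locZ.
  move=> psi tp.
  have E : \int[mu]_(x in Om) ((g x + -1 * g' x) * psi x) =
     \int[mu]_(x in Om) (g x * psi x - g' x * psi x).
    by apply: eq_Rintegral => x _; ring.
  rewrite E RintegralB//; [|exact: L1loc_intg hOm _ _ lg tp|exact: L1loc_intg hOm _ _ lg' tp].
  by have := hg _ tp; rewrite hg'// => /oppr_inj ->; rewrite subrr.
by apply: filterS => x h Ox; have := h Ox; rewrite mulN1r => /eqP; rewrite subr_eq0 => /eqP.
Qed.

Lemma wD_spec i f : (exists g, weak_partial Om i f g) -> weak_partial Om i f (wD Om i f).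
Proof. by move=> h; rewrite /wD; case: xgetP => [g -> //|nh]; case: h => g /nh. Qed.

(** [wD] is an arbitrary choice; by uniqueness, any weak derivative computed explicitly may replace
    it under an integral. *)
Lemma wD_ae i f g : weak_partial Om i f g -> ae_eq mu Om (wD Om i f) g.
Proof. by move=> h; exact: (wp_unique (wD_spec (ex_intro _ g h)) h). Qed.

Lemma wpD i f f' g g' : weak_partial Om i f f' -> weak_partial Om i g g' ->
  weak_partial Om i (fun x => f x + g x) (fun x => f' x + g' x).
Proof.
move=> [lf lf' hf] [lg lg' hg]; split; [exact: L1locD|exact: L1locD|].
move=> psi tp; have tp' := test_fun_partial i tp.
have E1 : \int[mu]_(x in Om) ((f x + g x) * partial i psi x) =
    \int[mu]_(x in Om) (f x * partial i psi x + g x * partial i psi x).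
  by apply: eq_Rintegral => x _; ring.
have E2 : \int[mu]_(x in Om) ((f' x + g' x) * psi x) =
    \int[mu]_(x in Om) (f' x * psi x + g' x * psi x).
  by apply: eq_Rintegral => x _; ring.
rewrite E1 E2 !RintegralD// ?hf ?hg// ?opprD//;
  by [exact: L1loc_intg hOm _ _ lf tp'|exact: L1loc_intg hOm _ _ lg tp'|
      exact: L1loc_intg hOm _ _ lf' tp|exact: L1loc_intg hOm _ _ lg' tp].
Qed.

Lemma wpZ i (c : R) f f' : weak_partial Om i f f' ->
  weak_partial Om i (fun x => c * f x) (fun x => c * f' x).
Proof.
move=> [lf lf' hf]; split; [exact: L1locZ|exact: L1locZ|].
move=> psi tp; have tp' := test_fun_partial i tp.
have E1 : \int[mu]_(x in Om) ((c * f x) * partial i psi x) =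
    \int[mu]_(x in Om) (c * (f x * partial i psi x)).
  by apply: eq_Rintegral => x _; ring.
have E2 : \int[mu]_(x in Om) ((c * f' x) * psi x) =
    \int[mu]_(x in Om) (c * (f' x * psi x)).
  by apply: eq_Rintegral => x _; ring.
rewrite E1 E2 !RintegralZl// ?hf// ?mulrN//;
  by [exact: L1loc_intg hOm _ _ lf tp'|exact: L1loc_intg hOm _ _ lf' tp].
Qed.

Lemma wp_ae i f f' g : measurable_fun Om f' -> ae_eq mu Om f f' ->
  weak_partial Om i f g -> weak_partial Om i f' g.
Proof.
move=> mf' e [[mf lf] lg h]; split => //.
  split=> // K cK KOm; have mK := compact_measurable_rV cK.
  apply: (ae_eq_intg mK _ (ae_eq_subset KOm e) (lf K cK KOm)).
  exact: measurable_funS mf'.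
move=> psi tp; rewrite -h//; have tp' := test_fun_partial i tp.
have mp : measurable_fun Om (partial i psi).
  by apply: measurable_funTS; apply: continuous_measurable_rV; apply: smooth_continuous; case: tp'.
apply: (ae_eq_Rintegral mD); [exact: measurable_funM|exact: measurable_funM|].
by apply: filterS e => x hx Ox; rewrite hx.
Qed.

(** The product of [psi] with a test function has compact support in [Om], so the integral of its
    derivative over the whole space is 0, and nothing is lost by restricting to [Om]. *)
Lemma smooth_wp i psi : smooth psi -> weak_partial Om i psi (partial i psi).
Proof.
move=> sp; have sp' := smooth_partial i sp.
split; [exact/sqi_L1loc/sqi_smooth|exact/sqi_L1loc/sqi_smooth|].
move=> eta te; have [se [K [cK KOm e0]]] := te; have te' := test_fun_partial i te.
have T f g : smooth f -> test_fun Om g -> intg mu Om (fun x => f x * g x).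
  by move=> sf tg; apply: test_supp_intg; exact: test_funM.
apply/eqP; rewrite -addr_eq0; apply/eqP; rewrite -RintegralD//; [|exact: T|exact: T].
have z x : ~ K x -> psi x * eta x = 0 by move=> /e0 ->; rewrite mulr0.
rewrite -[RHS](Rintegral_partial0 i (smoothM sp se) cK z).
rewrite [LHS]Rintegral_mkcond; apply: eq_Rintegral => x _.
rewrite (partialM i sp se) /patch; case: ifPn => [_|]; first by rewrite (mulrC (eta x)).
rewrite notin_setE => nO; have nK : ~ K x by move=> /KOm.
by rewrite (e0 _ nK) (partial_eq0_compact i cK e0 nK) mulr0 mul0r addr0.
Qed.

Lemma H1_wp f i : H1 Om f -> weak_partial Om i f (wD Om i f).
Proof. by move=> [_ h]; apply: wD_spec; have [] := h i. Qed.

Lemma H1_sqi f : H1 Om f -> sqi mu Om f. Proof. by case. Qed.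

Lemma H1_sqi_wD f i : H1 Om f -> sqi mu Om (wD Om i f).
Proof. by move=> [_ h]; have [] := h i. Qed.

Lemma H1_intro f : sqi mu Om f ->
  (forall i, exists2 g, weak_partial Om i f g & sqi mu Om g) -> H1 Om f.
Proof.
move=> sf h; split => // i; have [g wg sg] := h i; split; first by exists g.
have [_ [mw _] _] : weak_partial Om i f (wD Om i f) by apply: wD_spec; exists g.
by apply: (ae_eq_sqi mD mw _ sg); apply: ae_eq_sym; exact: wD_ae.
Qed.

Lemma H1D f g : H1 Om f -> H1 Om g -> H1 Om (fun x => f x + g x).
Proof.
move=> hf hg; apply: H1_intro; first by apply: (sqiD mD); exact: H1_sqi.
move=> i; exists (fun x => wD Om i f x + wD Om i g x).
  by apply: wpD; exact: H1_wp.
by apply: (sqiD mD); exact: H1_sqi_wD.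
Qed.

Lemma H1Z (c : R) f : H1 Om f -> H1 Om (fun x => c * f x).
Proof.
move=> hf; apply: H1_intro; first by apply: (sqiZ mD); exact: H1_sqi.
move=> i; exists (fun x => c * wD Om i f x); first by apply: wpZ; exact: H1_wp.
by apply: (sqiZ mD); exact: H1_sqi_wD.
Qed.

Lemma H1_smooth psi : smooth psi -> H1 Om psi.
Proof.
move=> sp; apply: H1_intro; first exact: sqi_smooth.
move=> i; exists (partial i psi); first exact: smooth_wp.
by apply: sqi_smooth; exact: smooth_partial.
Qed.

Lemma wDZ_ae i (c : R) f : H1 Om f ->
  ae_eq mu Om (wD Om i (fun x => c * f x)) (fun x => c * wD Om i f x).
Proof. by move=> hf; apply: wD_ae; apply: wpZ; exact: H1_wp. Qed.

Lemma wDB_ae i f g : H1 Om f -> H1 Om g ->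
  ae_eq mu Om (wD Om i (fun x => f x - g x)) (fun x => wD Om i f x - wD Om i g x).
Proof.
move=> hf hg; apply: wD_ae.
have := wpD (H1_wp i hf) (wpZ (-1) (H1_wp i hg)).
rewrite (_ : (fun x => f x + -1 * g x) = fun x => f x - g x); last first.
  by apply/funext => x; rewrite mulN1r.
rewrite (_ : (fun x => wD Om i f x + -1 * wD Om i g x) = fun x => wD Om i f x - wD Om i g x)//.
by apply/funext => x; rewrite mulN1r.
Qed.

Lemma H1B f g : H1 Om f -> H1 Om g -> H1 Om (fun x => f x - g x).
Proof.
move=> hf hg; rewrite (_ : (fun x => f x - g x) = fun x => f x + (-1) * g x).
  by apply: H1D => //; exact: H1Z.
by apply/funext => x; rewrite mulN1r.
Qed.

Lemma L2norm_le_H1norm f : L2norm Om f <= H1norm Om f.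
Proof.
rewrite /H1norm -{1}[L2norm Om f]ger0_norm ?sqrtr_ge0// -sqrtr_sqr.
by rewrite ler_wsqrtr// lerDl sqr_ge0.
Qed.

Lemma sqi_mxip_vec (w : X -> X) : (forall i, sqi mu Om (fun x => w x 0 i)) ->
  mxip Om w w = \sum_i \int[mu]_(x in Om) (w x 0 i * w x 0 i).
Proof.
move=> hw; rewrite -Rintegral_sum//; last by move=> i; exact: sqi_mul.
by apply: eq_Rintegral => x _; rewrite dotmxE.
Qed.

Lemma mxL2norm_sq k k' (w : X -> 'M[R]_(k, k')) : mxL2norm Om w ^+ 2 = mxip Om w w.
Proof.
rewrite sqr_sqrtr//; apply: Rintegral_ge0 => x _.
by apply: sumr_ge0 => i _; apply: sumr_ge0 => j _; rewrite -expr2 sqr_ge0.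
Qed.

Lemma L2n_wD_le_H1norm f i : H1 Om f -> L2n mu Om (wD Om i f) <= H1norm Om f.
Proof.
move=> hf.
have H : L2n mu Om (wD Om i f) <= mxL2norm Om (grad Om f).
  rewrite ler_wsqrtr// sqi_mxip_vec; last first.
    by move=> j; rewrite /grad; under eq_fun do rewrite mxE; exact: H1_sqi_wD.
  rewrite (bigD1 i)//= -[leLHS]addr0; apply: lerD.
    by rewrite le_eqVlt; apply/orP; left; apply/eqP; apply: eq_Rintegral => x _; rewrite !mxE.
  by apply: sumr_ge0 => j _; exact: sqi_int_ge0.
apply: le_trans H _; rewrite /H1norm -{1}[mxL2norm _ _]ger0_norm ?sqrtr_ge0// -sqrtr_sqr.
by rewrite ler_wsqrtr// lerDr sqr_ge0.
Qed.

Lemma ae_eq_L2n f g : measurable_fun Om f -> measurable_fun Om g ->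
  ae_eq mu Om f g -> L2n mu Om f = L2n mu Om g.
Proof.
move=> mf mg e; congr Num.sqrt; apply: (ae_eq_Rintegral mD); try exact: measurable_funM.
by apply: filterS e => x hx Ox; rewrite hx.
Qed.

(** [H1norm] involves the chosen weak derivative of the difference, which agrees almost everywhere
    with the classical derivative of [v_ k] minus [wD Om i f]. *)
Lemma H1_cvg (v_ : nat -> X -> R) f : H1 Om f -> (forall k : nat, smooth (v_ k)) ->
  (fun k => H1norm Om (fun x => v_ k x - f x)) @ \oo --> (0 : R) ->
  (fun k => L2n mu Om (fun x => v_ k x - f x)) @ \oo --> (0 : R) /\
  forall i, (fun k => L2n mu Om (fun x => partial i (v_ k) x - wD Om i f x)) @ \oo --> (0 : R).
Proof.
move=> hf sv h; split => [|i].
  apply: (@squeeze_cvgr _ _ _ _ (fun=> 0) (fun k => H1norm Om (fun x => v_ k x - f x)));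
    [|exact: cvg_cst|exact: h].
  by apply: nearW => k; rewrite L2n_ge0/=; exact: L2norm_le_H1norm.
apply: (@squeeze_cvgr _ _ _ _ (fun=> 0) (fun k => H1norm Om (fun x => v_ k x - f x)));
  [|exact: cvg_cst|exact: h].
apply: nearW => k; rewrite L2n_ge0/=.
have hv := H1_smooth (sv k).
apply: le_trans (L2n_wD_le_H1norm i (H1B hv hf)).
rewrite le_eqVlt; apply/orP; left; apply/eqP; apply: ae_eq_L2n.
- apply: measurable_funB; last exact: sqi_meas (H1_sqi_wD i hf).
  exact: sqi_meas (sqi_smooth (smooth_partial i (sv k))).
- exact: sqi_meas (H1_sqi_wD i (H1B hv hf)).
- apply: ae_eq_sym; have e1 := wDB_ae i hv hf; have e2 := wD_ae (smooth_wp i (sv k)).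
  by move: e1 e2; apply: filterS2 => x h1 h2 Ox; rewrite h1// h2.
Qed.

Lemma H10_H1 f : H10 Om f -> H1 Om f. Proof. by case. Qed.

Lemma H10_approx f : H10 Om f -> exists2 psi : nat -> X -> R,
  (forall k, test_fun Om (psi k)) &
  (fun k => L2n mu Om (fun x => psi k x - f x)) @ \oo --> (0 : R) /\
  forall i, (fun k => L2n mu Om (fun x => partial i (psi k) x - wD Om i f x)) @ \oo --> (0 : R).
Proof.
move=> [hf [psi [tp h]]]; exists psi => //; apply: H1_cvg => // k; by have [] := tp k.
Qed.

(** For test functions this is the definition of the weak derivative of [f]; both sides are
    continuous along the approximation of [u]. *)
Lemma H10_ibp i f (u : X -> R) : H1 Om f -> H10 Om u ->
  \int[mu]_(x in Om) (f x * wD Om i u x) = - \int[mu]_(x in Om) (wD Om i f x * u x).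
Proof.
move=> hf hu; have [psi tp [c0 c1]] := H10_approx hu.
have sp k : smooth (psi k) by have [] := tp k.
have hu1 := H10_H1 hu.
have l1 := L2n_cvg_int mD (H1_sqi hf) (H1_sqi_wD i hu1)
  (fun k => sqi_smooth (smooth_partial i (sp k))) (c1 i).
have l2 := L2n_cvg_int mD (H1_sqi_wD i hf) (H1_sqi hu1) (fun k => sqi_smooth (sp k)) c0.
have [_ _ hw] := H1_wp i hf.
move: l1; rewrite (_ : (fun k => _) = fun k => - \int[mu]_(x in Om) (wD Om i f x * psi k x)).
  by move=> l1; apply: (cvg_unique _ l1 (cvgN l2)).
by apply/funext => k; rewrite hw.
Qed.

(** The product of two H^1 functions is only in L^1. For smooth [psi k], the product [psi k * eta]
    is a legitimate test function for [f], and the three integrals that arise converge, each being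
    an L^2 pairing. As any smooth approximation of [u] is allowed, the rule serves H^1_0 functions
    and functions that come with a trace alike. *)
Lemma H1_mul_wp i f (u : X -> R) (psi : nat -> X -> R) : H1 Om f -> H1 Om u ->
  (forall k, smooth (psi k)) ->
  (fun k => H1norm Om (fun x => psi k x - u x)) @ \oo --> (0 : R) ->
  weak_partial Om i (fun x => f x * u x) (fun x => f x * wD Om i u x + wD Om i f x * u x).
Proof.
move=> hf hu1 sp /(H1_cvg hu1 sp)[c0 c1].
have i1 : intg mu Om (fun x => f x * wD Om i u x).
  by apply: (sqi_mul mD); [exact: H1_sqi|exact: H1_sqi_wD].
have i2 : intg mu Om (fun x => wD Om i f x * u x).
  by apply: (sqi_mul mD); [exact: H1_sqi_wD|exact: H1_sqi].
have i0 : intg mu Om (fun x => f x * u x) by apply: (sqi_mul mD); exact: H1_sqi.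
split; [exact: intg_L1loc|by apply: intg_L1loc; exact: intgD|].
move=> eta te; have [se _] := te; have se' := smooth_partial i se.
have B g s : sqi mu Om g -> smooth s -> sqi mu Om (fun x => s x * g x).
  move=> sg ss; have [C C0 hC] := bounded_smooth ss.
  exact: (sqiM mD (sqi_meas (sqi_smooth ss)) hC sg).
have l1 := L2n_cvg_int mD (B _ _ (H1_sqi hf) se') (H1_sqi hu1) (fun k => sqi_smooth (sp k)) c0.
have l2 := L2n_cvg_int mD (B _ _ (H1_sqi hf) se) (H1_sqi_wD i hu1)
  (fun k => sqi_smooth (smooth_partial i (sp k))) (c1 i).
have l3 := L2n_cvg_int mD (B _ _ (H1_sqi_wD i hf) se) (H1_sqi hu1) (fun k => sqi_smooth (sp k)) c0.
have key k : \int[mu]_(x in Om) (partial i eta x * f x * psi k x) =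
   - (\int[mu]_(x in Om) (eta x * f x * partial i (psi k) x) +
      \int[mu]_(x in Om) (eta x * wD Om i f x * psi k x)).
  have [_ _ hw] := H1_wp i hf.
  have tpe : test_fun Om (fun x => psi k x * eta x) by exact: (test_funM (sp k) te).
  have := hw _ tpe; rewrite (partialM i (sp k) se) => E.
  have S1 : intg mu Om (fun x => eta x * f x * partial i (psi k) x).
    by apply: (sqi_mul mD); [exact: (B _ _ (H1_sqi hf) se)|exact: (sqi_smooth (smooth_partial i (sp k)))].
  have S2 : intg mu Om (fun x => eta x * wD Om i f x * psi k x).
    by apply: (sqi_mul mD); [exact: (B _ _ (H1_sqi_wD i hf) se)|exact: (sqi_smooth (sp k))].
  have S3 : intg mu Om (fun x => partial i eta x * f x * psi k x).
    by apply: (sqi_mul mD); [exact: (B _ _ (H1_sqi hf) se')|exact: (sqi_smooth (sp k))].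
  have E1 : \int[mu]_(x in Om) (f x * (psi k x * partial i eta x + eta x * partial i (psi k) x)) =
     \int[mu]_(x in Om) (partial i eta x * f x * psi k x) + \int[mu]_(x in Om) (eta x * f x * partial i (psi k) x).
    by rewrite -RintegralD//; apply: eq_Rintegral => x _; ring.
  have E2 : \int[mu]_(x in Om) (wD Om i f x * (psi k x * eta x)) = \int[mu]_(x in Om) (eta x * wD Om i f x * psi k x).
    by apply: eq_Rintegral => x _; ring.
  by move: E; rewrite E1 E2; lra.
have l4 := cvgN (cvgD l2 l3).
have l1' : (fun k => - (\int[mu]_(x in Om) (eta x * f x * partial i (psi k) x) +
      \int[mu]_(x in Om) (eta x * wD Om i f x * psi k x))) @ \oo -->
     \int[mu]_(x in Om) (partial i eta x * f x * u x).
  by rewrite -(_ : (fun k => \int[mu]_(x in Om) (partial i eta x * f x * psi k x)) = fun k => _)//; apply/funext.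
have U := cvg_unique _ l1' (l4 _ _).
have E3 : \int[mu]_(x in Om) (f x * u x * partial i eta x) =
    \int[mu]_(x in Om) (partial i eta x * f x * u x) by apply: eq_Rintegral => x _; ring.
rewrite E3 U // -RintegralD//.
- by congr (- _); apply: eq_Rintegral => x _; ring.
- by apply: (sqi_mul mD); [apply: B => //; exact: H1_sqi|exact: H1_sqi_wD].
- by apply: (sqi_mul mD); [apply: B => //; exact: H1_sqi_wD|exact: H1_sqi].
Qed.

Lemma H1_mul_H10_wp i f (u : X -> R) : H1 Om f -> H10 Om u ->
  weak_partial Om i (fun x => f x * u x) (fun x => f x * wD Om i u x + wD Om i f x * u x).
Proof.
move=> hf [hu [psi [tp h]]]; apply: (@H1_mul_wp i f u psi) => // k.
by have [] := tp k.
Qed.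

(** The two halves of the product rule have opposite integrals by [H10_ibp]. This removes the
    transport term from the mass balance. *)
Lemma int_H1_mul_H10 i f (u : X -> R) : H1 Om f -> H10 Om u ->
  \int[mu]_(x in Om) wD Om i (fun x => f x * u x) x = 0.
Proof.
move=> hf hu; have hu1 := H10_H1 hu.
have w := H1_mul_H10_wp i hf hu.
have [_ [mw _] _] := wD_spec (ex_intro _ _ w).
have i1 : intg mu Om (fun x => f x * wD Om i u x).
  by apply: (sqi_mul mD); [exact: H1_sqi|exact: H1_sqi_wD].
have i2 : intg mu Om (fun x => wD Om i f x * u x).
  by apply: (sqi_mul mD); [exact: H1_sqi_wD|exact: H1_sqi].
rewrite (ae_eq_Rintegral mD mw _ (wD_ae w)); last exact: (intg_meas (intgD mD i1 i2)).
by rewrite RintegralD// (H10_ibp i hf hu) addNr.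
Qed.

End weak_calculus.

(** * Hardy's inequality along a face and Green's formula *)

(** [(phi d - phi 0)^2] is at most [d] times the integral of [dphi^2], by Cauchy-Schwarz against the
    constant 1. *)
Lemma FTC_square_bound {R : realType} (phi dphi : R -> R) (d : R) : 0 < d ->
  (forall t : R, is_derive t 1 phi (dphi t)) -> continuous dphi ->
  phi 0 ^+ 2 <= 2 * phi d ^+ 2 +
    2 * d * \int[@lebesgue_measure R]_(s in `[0, d[) (dphi s ^+ 2).
Proof.
move=> d0 hd cd.
have cphi : continuous phi by exact: is_derive_continuous hd.
have ftc : \int[@lebesgue_measure R]_(s in `[0, d]) dphi s = phi d - phi 0.
  rewrite /Rintegral (@continuous_FTC2 _ dphi phi 0 d)//.
  - exact: continuous_subspaceT.
  - split.
    + by move=> x _; exact: (@ex_derive _ _ _ _ _ _ _ (hd x)).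
    + by apply: cvg_at_right_filter; exact: cphi.
    + by apply: cvg_at_left_filter; exact: cphi.
  - by move=> x _; rewrite derive1E; exact: (@derive_val _ _ _ _ _ _ _ (hd x)).
have m0 : measurable (`[0, d]%classic : set (measurableTypeR R)) by exact: measurable_itv.
have fin : (@lebesgue_measure R `[0%R, d]%classic < +oo)%E.
  by rewrite [ltLHS](@lebesgue_measure_itv R `[0, d])/=; case: ifP; rewrite -?EFinD ltry.
have sd : sqi (@lebesgue_measure R) `[0, d]%classic dphi.
  have [c _ hc] : exists2 c : R, c \in `[0, d] & forall t : R, t \in `[0, d] -> `|dphi t| <= `|dphi c|.
    apply: EVT_max; first exact: ltW.
    by apply: continuous_subspaceT => x; apply: cvg_norm; exact: cd.
  apply: (@sqi_bounded _ _ _ _ _ m0 _ `|dphi c|) => //.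
  by apply: measurable_funTS; exact: continuous_measurable_fun.
have s1 : sqi (@lebesgue_measure R) `[0, d]%classic (fun=> 1 : R).
  by apply: (@sqi_bounded _ _ _ _ _ m0 _ 1) => // x _; rewrite normr1.
have CS := cauchy_schwarz m0 sd s1.
have E1 : \int[@lebesgue_measure R]_(s in `[0, d]) (dphi s * 1) = phi d - phi 0.
  by rewrite -ftc; apply: eq_Rintegral => x _; rewrite mulr1.
have E2 : \int[@lebesgue_measure R]_(s in `[0, d]) ((1 : R) * 1) = d.
  rewrite Rintegral_cst// mulr1 mul1r [X in fine X](@lebesgue_measure_itv R `[0, d])/=.
  by rewrite lte_fin d0 -EFinB subr0.
have E3 : \int[@lebesgue_measure R]_(s in `[0, d]) (dphi s * dphi s) =
    \int[@lebesgue_measure R]_(s in `[0, d[) (dphi s ^+ 2).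
  rewrite -(@Rintegral_itv_bndo_bndc _ (BLeft 0) d (fun s => dphi s * dphi s)).
  - by apply: eq_Rintegral => x _; rewrite expr2.
  - apply: (integrableS _ _ _ (sqi_mul m0 sd sd)); [exact: measurable_itv|exact: measurable_itv|].
    by move=> x /=; rewrite !in_itv/= => /andP[-> /ltW].
move: CS; rewrite E1 E2 E3; move: (\int[_]_(_ in _) _) => I CS.
(* With [a = phi 0] and [b = phi d], the difference [2 b^2 + 2 (b - a)^2 - a^2] is [(a - 2 b)^2]. *)
have := sqr_ge0 (phi 0 - 2 * phi d); nra.
Qed.

Section strip.
Context {R : realType} {n : nat} {Om : set 'rV[R]_n} {m : nat}
  {nrm : 'I_m -> 'rV[R]_n} {off : 'I_m -> R}.
Hypothesis hOm : convex_polytope Om nrm off.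
Hypothesis n0 : (0 < n)%N.
Local Notation X := 'rV[R]_n.
Local Notation mu := (leb R n).
Local Notation fd := (fdist (nrm := nrm) (off := off)).
Implicit Types (f g psi : X -> R) (x v : X) (i j : 'I_n) (l : 'I_m).

Let mD : measurable Om := mOm hOm.

Lemma fdistD l x v : fd l (x + v) = fd l x - dotmx (nrm l) v.
Proof. by rewrite /fdist dotmxDr opprD addrA. Qed.

Lemma fdist_convex l x y (t : R) :
  fd l ((1 - t) *: x + t *: y) = (1 - t) * fd l x + t * fd l y.
Proof. by rewrite /fdist dotmxDr !dotmxZr; ring. Qed.

Lemma hprojE l x : hproj (nrm l) (off l) x = x + fd l x *: nrm l.
Proof. by rewrite /hproj -scaleNr opprB. Qed.

Lemma fdist_nrm l (s : R) x : fd l (x + s *: nrm l) = fd l x - s.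
Proof. by rewrite fdistD dotmxZr (nrm1 hOm) mulr1. Qed.

Lemma hproj_nrm l (s : R) x :
  hproj (nrm l) (off l) (x + s *: nrm l) = hproj (nrm l) (off l) x.
Proof. by rewrite !hprojE fdist_nrm -addrA -scalerDl addrCA subrr addr0. Qed.

Lemma closure_Om_fdist y l : closure Om y -> 0 <= fd l y.
Proof.
move=> cy; suff : closed [set x | 0 <= fd l x].
  move=> /closure_id h; suff : [set x | 0 <= fd l x] y by [].
  by rewrite h; apply: closure_subset cy => x /(OmP hOm)/(_ l)/ltW.
apply: (@preimage_closed _ _ (fd l) [set z | 0 <= z]); last exact: closed_ge.
by move=> x _; exact: continuous_fdist.
Qed.

(** The distances are affine, so a small move from [y] towards the interior point [x] makes all of
    them positive. *)
Lemma fdist_closure x y : Om x -> (forall l, 0 <= fd l y) -> closure Om y.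
Proof.
move=> /(OmP hOm) hx hy B /nbhs_ballP[e e0 he].
pose S : R := 1 + \sum_i `|x 0 i - y 0 i|.
have S0 : 0 < S by rewrite ltr_pwDl// sumr_ge0.
pose t : R := Num.min (1 / 2) (e / (2 * S)).
have t0 : 0 < t by rewrite lt_min divr_gt0//= divr_gt0// mulr_gt0.
have t1 : t < 1 by rewrite gt_min; apply/orP; left; lra.
exists ((1 - t) *: y + t *: x); split.
  apply/(OmP hOm) => l; rewrite fdist_convex ltr_wpDl//.
    by rewrite mulr_ge0// subr_ge0 ltW.
  by rewrite mulr_gt0.
apply: he; split => // i j; rewrite ord1 !mxE /ball/=.
have -> : y 0 j - ((1 - t) * y 0 j + t * x 0 j) = - (t * (x 0 j - y 0 j)) by ring.
rewrite normrN normrM (gtr0_norm t0).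
have xS : `|x 0 j - y 0 j| <= S by rewrite /S (bigD1 j)//= addrCA lerDl addr_ge0// sumr_ge0.
apply: le_lt_trans (ler_wpM2l (ltW t0) xS) _.
have : t <= e / (2 * S) by rewrite ge_min lexx orbT.
rewrite ler_pdivlMr ?mulr_gt0// => h; move: e0 => /= e0; nra.
Qed.

(** The condition on the projection keeps the layer above the face itself rather than above its
    hyperplane, so that the segment from [x] to its foot, the foot excluded, stays in [Om]. *)
Definition strip l (tau : R) : set X :=
  [set x | [/\ Om x, fd l x < tau & closure Om (hproj (nrm l) (off l) x)]].

Lemma strip_Om l tau : strip l tau `<=` Om. Proof. by move=> x []. Qed.

Lemma measurable_hproj l : measurable_fun setT (hproj (nrm l) (off l)).
Proof.
apply/measurable_coordP => i; apply: continuous_measurable_rV.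
rewrite (_ : (fun x => _) = fun x => x 0 i + nrm l 0 i * fd l x).
  apply: smooth_continuous.
  exact: (smoothD (smooth_coord i) (smoothZ _ (smooth_fdist l))).
by apply/funext => x; rewrite hprojE !mxE mulrC.
Qed.

Lemma measurable_closure_hproj l : measurable [set x | closure Om (hproj (nrm l) (off l) x)].
Proof.
rewrite -[X in measurable X]setTI; apply: (@measurable_hproj l measurableT).
by apply: closed_measurable_rV; exact: closed_closure.
Qed.

Lemma measurable_fdist l : measurable_fun setT (fd l).
Proof. by apply: continuous_measurable_rV; exact: continuous_fdist. Qed.

Lemma measurable_strip l tau : measurable (strip l tau).
Proof.
rewrite (_ : strip l tau = Om `&` ((fd l @^-1` `]-oo, tau[%classic) `&`
   [set x | closure Om (hproj (nrm l) (off l) x)])); last first.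
  by apply/seteqP; split => x /=; rewrite in_itv/=;
    [move=> [? ? ?]; split|move=> [? [? ?]]; split].
apply: measurableI => //; apply: measurableI; last exact: measurable_closure_hproj.
by rewrite -[X in measurable X]setTI; apply: measurable_fdist => //; exact: measurable_itv.
Qed.

Lemma measurable_prism l : measurable (prism Om (nrm l) (off l)).
Proof.
rewrite (_ : prism _ _ _ = (fd l @^-1` `](-1), 0[%classic) `&`
   [set x | closure Om (hproj (nrm l) (off l) x)]); last first.
  apply/seteqP; split => x /=; rewrite in_itv/= /fdist => -[/andP[h1 h2] h3]; split => //;
  by apply/andP; split; lra.
apply: measurableI; last exact: measurable_closure_hproj.
by rewrite -[X in measurable X]setTI; apply: measurable_fdist => //; exact: measurable_itv.
Qed.

Lemma closure_Om_bounded : exists2 K : R, 0 < K & forall y, closure Om y -> forall i, `|y 0 i| <= K.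
Proof.
have [K K0 hK] := bounded_setP (bounded_Om hOm); exists K => // y cy i.
suff : closed [set x : X | `|x 0 i| <= K].
  move=> /closure_id h; suff : [set x : X | `|x 0 i| <= K] y by [].
  by rewrite h; apply: closure_subset cy => x Ox /=; exact: hK.
apply: (@preimage_closed _ _ (fun x : X => `|x 0 i|) [set z | z <= K]); last exact: closed_le.
move=> x _; apply: (@continuous_comp _ _ _ (fun x : X => x 0 i) (@Num.Def.normr R R)).
  exact: coord_continuous.
exact: norm_continuous.
Qed.

Lemma prism_fin l : (mu (prism Om (nrm l) (off l)) < +oo)%E.
Proof.
apply: leb_bounded; first exact: measurable_prism.
have [K K0 hK] := closure_Om_bounded.
apply: (@bounded_set_coord _ _ _ (K + \sum_i `|nrm l 0 i|)) => x [/andP[h1 h2] /hK h3] i.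
have := h3 i; rewrite hprojE mxE mxE => h4.
have -> : x 0 i = (x 0 i + fd l x * nrm l 0 i) - fd l x * nrm l 0 i by ring.
rewrite (le_trans (ler_normB _ _))// lerD// normrM.
have d1 : `|fd l x| <= 1 by rewrite /fdist ler_norml; apply/andP; split; lra.
apply: le_trans (ler_wpM2r (normr_ge0 _) d1) _; rewrite mul1r (bigD1 i)//= lerDl.
by apply: sumr_ge0.
Qed.

Lemma sqi_prism l psi : smooth psi ->
  sqi mu (prism Om (nrm l) (off l)) (psi \o hproj (nrm l) (off l)).
Proof.
move=> sp; have [K K0 hK] := closure_Om_bounded.
have cC : compact (closure Om).
  apply: bounded_closed_compact; last exact: closed_closure.
  exact: bounded_set_coord hK.
have [C C0 hC] := continuous_bounded_compact (smooth_continuous sp) cC.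
apply: (@sqi_bounded _ _ _ mu _ (measurable_prism l) _ C) => //.
- exact: prism_fin.
- apply: measurable_funTS; apply: measurableT_comp (@measurable_hproj l).
  by apply: continuous_measurable_rV; exact: smooth_continuous.
- by move=> x [_ /hC].
Qed.

(** The point is a convex combination, with positive weight on [x], of [x] and of its foot on the
    face, whose distances are nonnegative. *)
Lemma strip_segment l tau x (s : R) : strip l tau x -> 0 <= s -> s < fd l x ->
  strip l tau (x + s *: nrm l).
Proof.
move=> [Ox dt cx] s0 sd; have d0 : 0 < fd l x := (OmP hOm x).1 Ox l.
split; last by rewrite hproj_nrm.
- apply/(OmP hOm) => k.
  have -> : x + s *: nrm l = (1 - s / fd l x) *: x + (s / fd l x) *: hproj (nrm l) (off l) x.
    rewrite hprojE scalerDr scalerA divfK ?gt_eqF// addrA -scalerDl subrK scale1r//.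
  rewrite fdist_convex ltr_wpDr//.
    by rewrite mulr_ge0// ?divr_ge0// ?(ltW d0)//; exact: closure_Om_fdist.
  apply: mulr_gt0; last exact: ((OmP hOm x).1 Ox k).
  by rewrite subr_gt0 ltr_pdivrMr// mul1r.
- by rewrite fdist_nrm; lra.
Qed.

(** Translation by the unit normal carries a layer of width at most 1 into the unit prism outside
    the face and preserves the foot. As traces are measured on that prism, layer and face are
    compared by translation invariance alone. *)
Lemma strip_prism l tau x : tau <= 1 -> strip l tau x ->
  prism Om (nrm l) (off l) (x + nrm l).
Proof.
move=> t1 [Ox dt cx]; have := hproj_nrm l 1 x; rewrite scale1r /prism /= => ->; split => //.
have d0 : 0 < fd l x := (OmP hOm x).1 Ox l.
have := fdist_nrm l 1 x; rewrite scale1r {1}/fdist => h.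
by apply/andP; split; lra.
Qed.

Definition dnrm l psi x := \sum_i nrm l 0 i * partial i psi x.

Lemma dnrmE l psi x : dnrm l psi x = \sum_i nrm l 0 i * partial i psi x.
Proof. by []. Qed.

Lemma smooth_dnrm l psi : smooth psi -> smooth (dnrm l psi).
Proof. by move=> sp; apply: smooth_sum => i; apply: smoothZ; exact: smooth_partial. Qed.

(** Exchange the integrals. For fixed [s], translation by [s *: nrm l] maps the points of the strip
    with [s < fd l x] into the strip again, so the inner integral is at most that over the strip,
    while [s] ranges over an interval of length [tau]. *)
Lemma fubini_strip l (tau : R) psi : 0 < tau -> smooth psi ->
  measurable_fun (strip l tau) (fun x => \int[@lebesgue_measure R]_(s in `[0%R, fd l x[)
     (dnrm l psi (x + s *: nrm l)%R ^+ 2)%:E)%E /\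
  (\int[mu]_(x in strip l tau) \int[@lebesgue_measure R]_(s in `[0%R, fd l x[)
     (dnrm l psi (x + s *: nrm l)%R ^+ 2)%:E <=
   tau%:E * \int[mu]_(x in strip l tau) (dnrm l psi x ^+ 2)%:E)%E.
Proof.
move=> t0 sp; have sd := smooth_dnrm l sp.
have mG := measurable_strip l tau.
have md : measurable_fun setT (dnrm l psi).
  by apply: continuous_measurable_rV; exact: smooth_continuous.
pose A : set (measurableTypeR R * X) := [set p | [/\ strip l tau p.2, 0 <= p.1 & p.1 < fd l p.2]].
have mf : measurable_fun setT (fun p : measurableTypeR R * X => fd l p.2 - p.1 : R).
  apply: measurable_funB; last exact: measurable_fst.
  exact: (measurableT_comp (@measurable_fdist l) measurable_snd).
have mA : measurable A.
  rewrite (_ : A = (snd @^-1` strip l tau) `&` ((fst @^-1` `[0, +oo[%classic) `&`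
      ((fun p => fd l p.2 - p.1) @^-1` `]0, +oo[%classic))).
    apply: measurableI; first by rewrite -[X in measurable X]setTI; exact: measurable_snd.
    apply: measurableI; first by rewrite -[X in measurable X]setTI; apply: measurable_fst => //; exact: measurable_itv.
    by rewrite -[X in measurable X]setTI; apply: mf => //; exact: measurable_itv.
  apply/seteqP; split => p /=; rewrite !in_itv/= !andbT subr_gt0.
    by move=> [].
  by move=> [? [? ?]].
have mt : measurable_fun setT (fun p : measurableTypeR R * X => p.2 + p.1 *: nrm l).
  apply: measurable_fun_rV => i; under eq_fun do rewrite !mxE.
  apply: measurable_funD; first exact: (measurableT_comp (@measurable_coord R n i) measurable_snd).
  by apply: measurable_funM; [exact: measurable_fst|exact: measurable_cst].
pose h p : R := \1_A p * dnrm l psi (p.2 + p.1 *: nrm l) ^+ 2.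
have mh : measurable_fun setT (EFin \o h).
  apply/measurable_EFinP; apply: measurable_funM; first exact: measurable_indic.
  by apply: measurable_funX; exact: measurableT_comp md mt.
have h0 p : (0 <= (EFin \o h) p)%E.
  by rewrite lee_fin mulr_ge0 ?sqr_ge0// indicE.
have L x : ((fun x => \int[@lebesgue_measure R]_(s in `[0%R, fd l x[)
     (dnrm l psi (x + s *: nrm l)%R ^+ 2)%:E)%E \_ (strip l tau)) x =
   (\int[@lebesgue_measure R]_s (h (s, x))%:E)%E.
  rewrite /patch.
  case: ifPn => [|]; rewrite ?inE ?notin_setE => xG; last first.
    rewrite integral0_eq// => s _; rewrite /h indicE memNset ?mul0r//.
    by move=> [].
  rewrite integral_mkcond; apply: eq_integral => s _; rewrite /patch /h indicE.
  case: ifPn; rewrite ?inE ?notin_setE/= in_itv/= => hs.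
    by rewrite mem_set ?mul1r//; case/andP: hs.
  by rewrite memNset ?mul0r// => -[_ /= h1 h2]; apply: hs; rewrite h1.
have E1 := @fubini_tonelli1 _ _ _ _ R lebesgue_measure mu (EFin \o h) mh h0.
have E2 := @fubini_tonelli2 _ _ _ _ R lebesgue_measure mu (EFin \o h) mh h0.
split.
  apply/(measurable_restrictT _ mG); apply: (eq_measurable_fun (fubini_G lebesgue_measure (EFin \o h))).
    by move=> x _; rewrite L.
  exact: measurable_fun_fubini_tonelli_G.
have L' : (\int[mu]_(x in strip l tau) \int[@lebesgue_measure R]_(s in `[0%R, fd l x[)
     (dnrm l psi (x + s *: nrm l)%R ^+ 2)%:E =
   \int[mu]_x \int[@lebesgue_measure R]_s (h (s, x))%:E)%E.
  by rewrite integral_mkcond; apply: eq_integral => x _; exact: L.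
rewrite L' -[leLHS]E2 E1 /fubini_F.
pose I := (\int[mu]_(x in strip l tau) (dnrm l psi x ^+ 2)%:E)%E.
have I0 : (0 <= I)%E by apply: integral_ge0 => x _; rewrite lee_fin sqr_ge0.
have IE : I = (\int[mu]_x (\1_(strip l tau) x * dnrm l psi x ^+ 2)%:E)%E.
  rewrite /I integral_mkcond; apply: eq_integral => x _; rewrite /patch indicE.
  by case: ifP; rewrite ?mul1r ?mul0r.
have mI : measurable_fun setT (fun x => (\1_(strip l tau) x * dnrm l psi x ^+ 2)%:E).
  apply/measurable_EFinP; apply: measurable_funM; first exact: measurable_indic.
  exact: measurable_funX.
have I1 x : (0 <= (\1_(strip l tau) x * dnrm l psi x ^+ 2)%:E)%E.
  by rewrite lee_fin mulr_ge0 ?sqr_ge0// indicE.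
apply: (@le_trans _ _ (\int[@lebesgue_measure R]_(s in `[0%R, tau[) I)%E); last first.
  rewrite integral_cst//.
  by rewrite [X in (_ * X)%E](@lebesgue_measure_itv R `[0, tau[)/= lte_fin t0 -EFinB subr0 muleC.
rewrite [leRHS]integral_mkcond; apply: ge0_le_integral => //.
- by move=> s _; apply: integral_ge0 => x _; exact: h0.
- by apply: measurable_fun_fubini_tonelli_F.
- by apply/(measurable_restrictT _ (measurable_itv _)); exact: measurable_cst.
move=> s _; rewrite /patch; case: ifPn; rewrite ?inE ?notin_setE/= in_itv/= => hs.
  rewrite IE -(ge0_integral_shift (s *: nrm l) mI I1).
  apply: ge0_le_integral => //.
  - by move=> x _; exact: h0.
  - by apply: measurableT_comp mh _; exact: measurable_pair1.
  - by apply: measurableT_comp mI _; exact: measurable_shift.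
  move=> x _ /=; rewrite lee_fin /h /= ler_wpM2r ?sqr_ge0//.
  rewrite !indicE; case: (boolP (_ \in A)) => //; rewrite inE => -[/= h1 h2 h3].
  by rewrite (@mem_set _ (strip l tau)); [exact: lexx|exact: strip_segment].
rewrite integral0_eq// => x _; rewrite /h /= indicE memNset ?mul0r//.
move=> [/= [_ ht _] h2 h3]; apply: hs; rewrite h2/=; exact: lt_trans h3 ht.
Qed.

End strip.

Section hardy.
Context {R : realType} {n : nat} {Om : set 'rV[R]_n} {m : nat}
  {nrm : 'I_m -> 'rV[R]_n} {off : 'I_m -> R}.
Hypothesis hOm : convex_polytope Om nrm off.
Hypothesis n0 : (0 < n)%N.
Local Notation X := 'rV[R]_n.
Local Notation mu := (leb R n).
Local Notation fd := (fdist (nrm := nrm) (off := off)).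
Local Notation strip := (strip (Om := Om) (nrm := nrm) (off := off)).
Local Notation prism l := (prism Om (nrm l) (off l)).
Local Notation hpr l := (hproj (nrm l) (off l)).
Local Notation dnrm := (dnrm (nrm := nrm)).
Implicit Types (f g psi : X -> R) (x v : X) (i j : 'I_n) (l : 'I_m).

Let mD : measurable Om := mOm hOm.

Lemma EFin_Rintegral (E : set X) f : measurable E -> intg mu E f ->
  ((\int[mu]_(x in E) f x)%:E = \int[mu]_(x in E) (f x)%:E)%E.
Proof. by move=> mE fi; rewrite /Rintegral fineK// integrable_fin_num. Qed.

Lemma strip_hproj_le l (tau : R) psi : tau <= 1 -> smooth psi ->
  (\int[mu]_(x in strip l tau) (psi (hpr l x) ^+ 2)%:E <=
   \int[mu]_(x in prism l) (psi (hpr l x) ^+ 2)%:E)%E.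
Proof.
move=> t1 sp.
have mf : measurable_fun setT (fun x => psi (hpr l x) ^+ 2).
  apply: measurable_funX; apply: measurableT_comp (@measurable_hproj _ _ _ nrm off l).
  by apply: continuous_measurable_rV; exact: smooth_continuous.
have mG := measurable_strip hOm l tau.
have mP : measurable (prism l) := @measurable_prism _ _ Om _ nrm off l.
rewrite integral_mkcond [leRHS]integral_mkcond.
have mfP : measurable_fun setT ((fun x => (psi (hpr l x) ^+ 2)%:E) \_ (prism l)).
  by apply/(measurable_restrictT _ mP); apply: measurable_funTS; apply/measurable_EFinP.
rewrite -(ge0_integral_shift (nrm l) mfP); last first.
  by move=> x; apply: erestrict_ge0 => y _; rewrite lee_fin sqr_ge0.
apply: ge0_le_integral => //.
- by move=> x _; apply: erestrict_ge0 => y _; rewrite lee_fin sqr_ge0.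
- by apply/(measurable_restrictT _ mG); apply: measurable_funTS; apply/measurable_EFinP.
- by apply: measurableT_comp mfP _; exact: measurable_shift.
move=> x _; rewrite /patch; case: ifPn => [|_]; last first.
  by case: ifP => // _; rewrite lee_fin sqr_ge0.
rewrite inE => Gx; rewrite mem_set; last exact: strip_prism Gx.
by have := hproj_nrm hOm l 1 x; rewrite scale1r => ->.
Qed.

(** [FTC_square_bound] is integrated over the normal segments, whose length is less than [tau]: the
    end-point term passes to the prism by [strip_hproj_le], and the derivative term gains a second
    factor [tau] from [fubini_strip]. *)
Lemma hardy_smooth l (tau : R) psi : 0 < tau -> tau <= 1 -> smooth psi ->
  L2n mu (strip l tau) psi ^+ 2 <=
  2 * L2n mu (prism l) (psi \o hpr l) ^+ 2 +
  2 * tau ^+ 2 * L2n mu (strip l tau) (dnrm l psi) ^+ 2.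
Proof.
move=> t0 t1 sp; have sd : smooth (dnrm l psi) by exact: smooth_dnrm.
have mG := measurable_strip hOm l tau.
have mP : measurable (prism l) := @measurable_prism _ _ Om _ nrm off l.
have GO := @strip_Om _ _ Om _ nrm off l tau.
have s1 := sqi_subset mG mD GO (sqi_smooth hOm sp).
have s2 := sqi_subset mG mD GO (sqi_smooth hOm sd).
have s3 := sqi_prism hOm l sp.
have [mJ FJ] := fubini_strip hOm l t0 sp.
set J := (fun x => \int[@lebesgue_measure R]_(s in _) _)%E in mJ FJ.
rewrite !L2n_sq -lee_fin EFinD !EFinM EFin_Rintegral//; last exact: (sqi_mul mG s1 s1).
rewrite (EFin_Rintegral mP (sqi_mul mP s3 s3)) (EFin_Rintegral mG (sqi_mul mG s2 s2)).
have J0 x : strip l tau x -> (0 <= J x)%E.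
  by move=> _; apply: integral_ge0 => s _; rewrite lee_fin sqr_ge0.
have mh : measurable_fun (strip l tau) (fun x => (psi (hpr l x) ^+ 2)%:E).
  apply: measurable_funTS; apply/measurable_EFinP; apply: measurable_funX.
  apply: measurableT_comp (@measurable_hproj _ _ _ nrm off l).
  by apply: continuous_measurable_rV; exact: smooth_continuous.
have H0 x : strip l tau x -> (0 <= (psi (hpr l x) ^+ 2)%:E)%E by rewrite lee_fin sqr_ge0.
apply: (@le_trans _ _ (\int[mu]_(x in strip l tau) (2%:E * (psi (hpr l x) ^+ 2)%:E + (2 * tau)%:E * J x)))%E.
  apply: ge0_le_integral => //.
  - by move=> x _; rewrite lee_fin -expr2 sqr_ge0.
  - apply/measurable_EFinP; apply: measurable_funM; exact: sqi_meas s1.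
  - by apply: emeasurable_funD; apply: measurable_funeM.
  move=> x [Ox dt cx]; have d0 : 0 < fd l x := (OmP hOm x).1 Ox l.
  pose phi (s : R) := psi (x + s *: nrm l); pose dphi (s : R) := dnrm l psi (x + s *: nrm l).
  have hd (t : R) : is_derive t 1 phi (dphi t).
    apply: is_derive_line; exact: is_derive_smooth.
  have cd : continuous dphi.
    have := @is_derive_continuous R (fun s : R => dnrm l psi (x + s *: nrm l)); apply => t.
    by apply: is_derive_line; exact: is_derive_smooth.
  have := FTC_square_bound d0 hd cd; rewrite {1 2}/phi scale0r addr0 -hprojE => F.
  have fJ : J x = (\int[@lebesgue_measure R]_(s in `[0, fd l x[) (dphi s ^+ 2))%:E.
    rewrite /J /Rintegral fineK//; apply: integrable_fin_num => //.
    have [c _ hc] : exists2 c : R, c \in `[0, fd l x] & forall t : R, t \in `[0, fd l x] -> `|dphi t| <= `|dphi c|.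
      apply: EVT_max; first exact: ltW.
      by apply: continuous_subspaceT => s; apply: cvg_norm; exact: cd.
    have m0 : measurable (`[0, fd l x[%classic : set (measurableTypeR R)) by exact: measurable_itv.
    apply: (@sqi_sq _ _ _ (@lebesgue_measure R) `[0, fd l x[%classic dphi).
    apply: (@sqi_bounded _ _ _ _ _ m0 _ `|dphi c|) => //.
    - by rewrite [ltLHS](@lebesgue_measure_itv R `[0, fd l x[)/=; case: ifP; rewrite -?EFinD ltry.
    - by apply: measurable_funTS; exact: continuous_measurable_fun.
    - by move=> s; rewrite /= in_itv/= => /andP[s0 sd']; apply: hc; rewrite in_itv/= s0 ltW.
  rewrite fJ -!EFinM -EFinD lee_fin; move: F; rewrite -expr2.
  have I0 : 0 <= \int[@lebesgue_measure R]_(s in `[0, fd l x[) (dphi s ^+ 2).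
    by apply: Rintegral_ge0 => s _; exact: sqr_ge0.
  move: I0; move: (\int[_]_(_ in _) _) => I I0 F; nra.
rewrite ge0_integralD//; first last.
- exact: measurable_funeM.
- by move=> x Gx; apply: mule_ge0; rewrite ?lee_fin ?mulr_ge0 ?(ltW t0)//; exact: J0.
- exact: measurable_funeM.
- by move=> x Gx; apply: mule_ge0; rewrite ?lee_fin//; exact: H0.
rewrite !ge0_integralZl//; last by rewrite lee_fin mulr_ge0// ltW.
apply: leeD.
  apply: lee_wpmul2l => //.
  apply: le_trans (strip_hproj_le l t1 sp) _; rewrite le_eqVlt; apply/orP; left; apply/eqP.
  by apply: eq_integral => x _; rewrite expr2.
rewrite [X in (_ <= X * _)%E](_ : _ = ((2 * tau)%:E * tau%:E)%E); last first.
  by rewrite -!EFinM; congr EFin; ring.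
rewrite -muleA; apply: lee_wpmul2l.
  by rewrite lee_fin mulr_ge0// ltW.
by apply: le_trans FJ _; apply: lee_wpmul2l; rewrite ?lee_fin ?(ltW t0)//; rewrite le_eqVlt; apply/orP; left; apply/eqP;
  apply: eq_integral => x _; rewrite expr2.
Qed.

End hardy.

Lemma seq_cvg_ge {R : realType} (a l : R) (u : nat -> R) :
  (forall k, a <= u k) -> u @ \oo --> l -> a <= l.
Proof.
by move=> h hu; rewrite -(cvg_lim _ hu)//; apply: limr_ge; [apply/cvg_ex; exists l|exact: nearW].
Qed.

Lemma cvg0Z {R : realType} (c : R) (u : nat -> R) :
  u @ \oo --> (0 : R) -> (fun k => c * u k) @ \oo --> (0 : R).
Proof.
by move=> hu; have := @cvgM _ _ _ _ (fun=> c) u _ _ (cvg_cst _) hu; rewrite mulr0; apply.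
Qed.

Lemma cvg0D {R : realType} (u v : nat -> R) :
  u @ \oo --> (0 : R) -> v @ \oo --> (0 : R) -> (fun k => u k + v k) @ \oo --> (0 : R).
Proof. by move=> hu hv; have := cvgD hu hv; rewrite addr0; apply. Qed.

Lemma cvg0_sum {R : realType} (I : Type) (s : seq I) (c : I -> R) (u : I -> nat -> R) :
  (forall i, u i @ \oo --> (0 : R)) ->
  (fun k => \sum_(i <- s) c i * u i k) @ \oo --> (0 : R).
Proof.
move=> hu; elim: s => [|a s IH].
  rewrite (_ : (fun k => _) = fun=> 0); first exact: cvg_cst.
  by apply/funext => k; rewrite big_nil.
rewrite (_ : (fun k => _) = fun k => c a * u a k + \sum_(i <- s) c i * u i k).
  by apply: cvg0D IH; exact: cvg0Z.
by apply/funext => k; rewrite big_cons.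
Qed.

(** * Hardy's estimate for normal traces and Green's formula by exhaustion *)

Section green.
Context {R : realType} {n : nat} {Om : set 'rV[R]_n} {m : nat}
  {nrm : 'I_m -> 'rV[R]_n} {off : 'I_m -> R}.
Hypothesis hOm : convex_polytope Om nrm off.
Hypothesis n0 : (0 < n)%N.
Local Notation X := 'rV[R]_n.
Local Notation mu := (leb R n).
Local Notation fd := (fdist (nrm := nrm) (off := off)).
Local Notation strip := (strip (Om := Om) (nrm := nrm) (off := off)).
Local Notation prism l := (prism Om (nrm l) (off l)).
Local Notation hpr l := (hproj (nrm l) (off l)).
Local Notation dnrm := (dnrm (nrm := nrm)).
Implicit Types (f g psi : X -> R) (x v : X) (i j : 'I_n) (l : 'I_m).

Let mD : measurable Om := mOm hOm.

Definition flux (w : 'I_n -> X -> R) l x := \sum_i nrm l 0 i * w i x.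

(** [hardy_smooth] is applied to the normal components [zeta k] of smooth approximations, and [k]
    tends to infinity at fixed [tau]: the face term disappears since the trace has no normal
    component, and the normal derivative tends to [Dz]. *)
Lemma hardy l (w : 'I_n -> X -> R) (g : X -> X) : (forall i, H1 Om (w i)) ->
  (forall i, trace_on Om (nrm l) (off l) (w i) (vcomp g i)) ->
  {ae mu, forall x, prism l x -> dotmx (nrm l) (g (hpr l x)) = 0} ->
  exists2 C : R, 0 <= C & forall tau, 0 < tau -> tau <= 1 ->
    L2n mu (strip l tau) (flux w l) <= C * tau.
Proof.
move=> hw htr hg0.
have mP : measurable (prism l) := @measurable_prism _ _ Om _ nrm off l.
have /choice[psi hpsi] i : exists psi : nat -> X -> R, [/\ forall k, smooth (psi k),
    (fun k => H1norm Om (fun x => psi k x - w i x)) @ \oo --> (0 : R) &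
    (fun k => L2norm (prism l) ((fun x => psi k x - vcomp g i x) \o hpr l)) @ \oo --> (0 : R)].
  by have [_] := htr i.
have sp i k : smooth (psi i k) by have [] := hpsi i.
have hc i := H1_cvg hOm n0 (hw i) (sp i) (let: And3 _ h _ := hpsi i in h).
have sg i : sqi mu (prism l) (vcomp g i \o hpr l) by have [] := htr i.
pose Dz x := \sum_j nrm l 0 j * flux (fun i => wD Om j (w i)) l x.
pose zeta k x := flux (fun i => psi i k) l x.
have szeta k : smooth (zeta k) by apply: smooth_sum => i; exact: smoothZ.
have sflux (v : 'I_n -> X -> R) (E : set X) : measurable E ->
    (forall i, sqi mu E (v i)) -> sqi mu E (flux v l).
  by move=> mE hv; apply: (sqi_sum mE) => i; exact: sqiZ.
have sz : sqi mu Om (flux w l) by apply: sflux => // i; exact: H1_sqi.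
have sDz : sqi mu Om Dz.
  apply: (sqi_sum mD) => j; apply: (sqiZ mD); apply: sflux => // i; exact: H1_sqi_wD.
have pz k j : partial j (zeta k) = flux (fun i => partial j (psi i k)) l.
  rewrite /zeta /flux partial_sum; last by move=> i; exact: smoothZ.
  by apply/funext => x; apply: eq_bigr => i _; rewrite partialZ.
have bnd (E : set X) (mE : measurable E) (v v' : 'I_n -> X -> R) :
    (forall i, sqi mu E (v i)) -> (forall i, sqi mu E (v' i)) ->
    L2n mu E (fun x => flux v l x - flux v' l x) <=
    \sum_i `|nrm l 0 i| * L2n mu E (fun x => v i x - v' i x).
  move=> sv sv'.
  have -> : L2n mu E (fun x => flux v l x - flux v' l x) =
      L2n mu E (fun x => \sum_i nrm l 0 i * (v i x - v' i x)).
    congr Num.sqrt; apply: eq_Rintegral => x _; rewrite /flux -sumrB.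
    by under [in RHS]eq_bigr do rewrite mulrBr.
  apply: le_trans (L2n_sum mE _ _) _; first by move=> i; apply: (sqiZ mE); exact: sqiB.
  by apply: ler_sum => i _; rewrite L2nZ//; exact: sqiB.
pose a k := \sum_i `|nrm l 0 i| * L2n mu Om (fun x => psi i k x - w i x).
pose b k := \sum_j `|nrm l 0 j| * \sum_i `|nrm l 0 i| *
  L2n mu Om (fun x => partial j (psi i k) x - wD Om j (w i) x).
pose c k := \sum_i `|nrm l 0 i| * L2n mu (prism l) ((fun x => psi i k x - vcomp g i x) \o hpr l).
have ca : a @ \oo --> (0 : R) by apply: cvg0_sum => i; exact: (hc i).1.
have cb : b @ \oo --> (0 : R).
  by apply: cvg0_sum => j; apply: cvg0_sum => i; exact: (hc i).2.
have cc : c @ \oo --> (0 : R) by apply: cvg0_sum => i; have [] := hpsi i.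
have az k : L2n mu Om (fun x => zeta k x - flux w l x) <= a k.
  by apply: bnd => // i; [exact: (sqi_smooth hOm)|exact: H1_sqi].
have bz k : L2n mu Om (fun x => dnrm l (zeta k) x - Dz x) <= b k.
  have -> : L2n mu Om (fun x => dnrm l (zeta k) x - Dz x) = L2n mu Om (fun x =>
     \sum_j nrm l 0 j * (flux (fun i => partial j (psi i k)) l x - flux (fun i => wD Om j (w i)) l x)).
    congr Num.sqrt; apply: eq_Rintegral => x _; rewrite /Dz dnrmE -sumrB.
    by under eq_bigr do rewrite pz -mulrBr.
  have s1 j : sqi mu Om (fun x => flux (fun i => partial j (psi i k)) l x - flux (fun i => wD Om j (w i)) l x).
    apply: (sqiB mD); apply: sflux => // i; last exact: H1_sqi_wD.
    by apply: (sqi_smooth hOm); exact: smooth_partial.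
  apply: le_trans (L2n_sum mD _ _) _; first by move=> j; exact: sqiZ.
  apply: ler_sum => j _; rewrite L2nZ// ler_wpM2l//; apply: bnd => // i; last exact: H1_sqi_wD.
  by apply: (sqi_smooth hOm); exact: smooth_partial.
have cz k : L2n mu (prism l) (zeta k \o hpr l) <= c k.
  have sph i := sqi_prism hOm l (sp i k).
  (* The normal component of the trace is 0 almost everywhere on the prism, so it may be subtracted;
     what remains is the error in the approximation of the trace. *)
  rewrite (_ : L2n _ _ _ = L2n mu (prism l) (fun x => flux (fun i => psi i k \o hpr l) l x -
     flux (fun i => vcomp g i \o hpr l) l x)); first exact: bnd.
  congr Num.sqrt; have sd : sqi mu (prism l) (fun x => flux (fun i => psi i k \o hpr l) l x -
     flux (fun i => vcomp g i \o hpr l) l x) by apply: (sqiB mP); exact: sflux.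
  have szh := sqi_prism hOm l (szeta k).
  apply: (ae_eq_Rintegral mP); [exact: measurable_funM szh.1 szh.1|exact: measurable_funM sd.1 sd.1|].
  apply: filterS hg0 => x hx Px; have := hx Px; rewrite dotmxE => h0 /=.
  suff -> : flux (fun i => vcomp g i \o hpr l) l x = 0 by rewrite subr0.
  exact: h0.
exists (2 * L2n mu Om Dz); first by rewrite mulr_ge0// L2n_ge0.
move=> tau t0 t1; have mG := measurable_strip hOm l tau.
have GO := @strip_Om _ _ Om _ nrm off l tau.
have H k : L2n mu (strip l tau) (flux w l) <= a k + 2 * c k + 2 * tau * b k + 2 * L2n mu Om Dz * tau.
  have sdz : smooth (dnrm l (zeta k)) by exact: smooth_dnrm.
  have e1 : L2n mu (strip l tau) (flux w l) <=
     L2n mu (strip l tau) (fun x => zeta k x - flux w l x) + L2n mu (strip l tau) (zeta k).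
    have s1 := sqi_subset mG mD GO (sqi_smooth hOm (szeta k)).
    have s2 := sqi_subset mG mD GO sz.
    have := L2nD mG (sqiZ mG (-1) (sqiB mG s1 s2)) s1.
    rewrite L2nZ; [|exact: mG|exact: sqiB]; rewrite normrN normr1 mul1r.
    rewrite (_ : (fun x => -1 * (zeta k x - flux w l x) + zeta k x) = flux w l)//.
    by apply/funext => x; ring.
  have e2 := L2n_subset mG mD GO (sqiB mD (sqi_smooth hOm (szeta k)) sz).
  have e3 := hardy_smooth hOm l t0 t1 (szeta k).
  have e4 := L2n_subset mG mD GO (sqi_smooth hOm sdz).
  have e5 : L2n mu Om (dnrm l (zeta k)) <= L2n mu Om (fun x => dnrm l (zeta k) x - Dz x) + L2n mu Om Dz.
    have := L2nD mD (sqiB mD (sqi_smooth hOm sdz) sDz) sDz.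
    rewrite (_ : (fun x => dnrm l (zeta k) x - Dz x + Dz x) = dnrm l (zeta k))//.
    by apply/funext => x; rewrite subrK.
  have := az k; have := bz k; have := cz k.
  move: e1 e2 e3 e4 e5 (L2n_ge0 mu (strip l tau) (zeta k)) (L2n_ge0 mu (prism l) (zeta k \o hpr l))
     (L2n_ge0 mu (strip l tau) (dnrm l (zeta k))).
  move: (L2n mu (strip l tau) (flux w l)) (L2n mu (strip l tau) (fun x => zeta k x - flux w l x))
     (L2n mu (strip l tau) (zeta k)) (L2n mu Om (fun x => zeta k x - flux w l x))
     (L2n mu (prism l) (zeta k \o hpr l)) (L2n mu (strip l tau) (dnrm l (zeta k)))
     (L2n mu Om (dnrm l (zeta k))) (L2n mu Om (fun x => dnrm l (zeta k) x - Dz x)) (L2n mu Om Dz)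
     (a k) (b k) (c k).
  move=> z1 z2 z3 z4 p1 d1 d2 d3 d4 ak bk ck e1 e2 e3 e4 e5 z30 p10 d10 k1 k2 k3.
  (* [2 p1^2 + 2 (tau d1)^2] is at most [4 (p1 + tau d1)^2]; this 2 is the one in the constant
     [2 * L2n mu Om Dz]. *)
  have z3le : z3 <= 2 * (p1 + tau * d1).
    rewrite -ler_sqr ?nnegrE ?mulr_ge0 ?addr_ge0 ?mulr_ge0 ?(ltW t0)//.
    have := sqr_ge0 p1; have := sqr_ge0 (tau * d1); have : 0 <= p1 * (tau * d1) by rewrite !mulr_ge0// ltW.
    by move: e3; rewrite -mulrA -exprMn; move: (tau * d1) => q; nra.
  have td : tau * d1 <= tau * (bk + d4) by rewrite ler_wpM2l ?(ltW t0)//; lra.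
  lra.
have h := cvg0D (cvg0D ca (cvg0Z 2 cc)) (cvg0Z (2 * tau) cb).
have := @cvgD _ _ _ _ _ _ (fun=> 2 * L2n mu Om Dz * tau) _ _ h (cvg_cst _).
by rewrite add0r => h'; apply: (seq_cvg_ge H); exact: h'.
Qed.

(** On this set the weight of face [l] tends to 0 with growing sharpness; off it face [l] is a
    nearest one and [softmin_strip] applies. *)
Definition interior_face l : set X := [set x | exists l', fd l' x < fd l x].

Lemma measurable_interior_face l : measurable (interior_face l).
Proof.
rewrite (_ : interior_face l = \bigcup_(l' in [set: 'I_m]) (fun x => fd l x - fd l' x) @^-1` `]0, +oo[%classic).
  apply: fin_bigcup_measurable => // l' _.
  rewrite -[X in measurable X]setTI; apply: measurable_funB => //; exact: measurable_fdist.
apply/seteqP; split => x /=.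
  by move=> [l' h]; exists l' => //=; rewrite in_itv/= andbT subr_gt0.
by move=> [l' _]; rewrite /= in_itv/= andbT subr_gt0 => h; exists l'.
Qed.

(** The distance from the foot to face [l'] is [fd l' x - fd l x * dotmx (nrm l') (nrm l)],
    nonnegative because face [l] is nearest and unit vectors have inner product at most 1; so the
    foot lies in the closed polytope. The 3 is the 2 of the transition zone plus 1 for the gap
    between [softmin] and the distance. *)
Lemma softmin_strip l (k p : R) x : 0 < k -> 0 < p -> k * ln m%:R <= p -> Om x ->
  ~ interior_face l x -> softmin (nrm := nrm) (off := off) p x < 2 / k -> strip l (3 / k) x.
Proof.
move=> k0 p0 kp Ox nV D2.
have near l' : fd l x <= fd l' x by rewrite leNgt; apply/negP => h; apply: nV; exists l'.
have d0 : 0 < fd l x := (OmP hOm x).1 Ox l.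
split => //.
  have := softmin_ge hOm n0 p0 near.
  have lp : ln m%:R / p <= 1 / k by rewrite ler_pdivrMr// mulrAC ler_pdivlMr// mul1r mulrC.
  have e2 : 2 / k = 1 / k + 1 / k by field; rewrite gt_eqF.
  have e3 : 3 / k = 1 / k + 1 / k + 1 / k by field; rewrite gt_eqF.
  by move: D2 lp; rewrite e2 e3; move: (1 / k) (ln _ / p) => a b; lra.
apply: (fdist_closure hOm Ox) => l'; rewrite hprojE fdistD dotmxZr.
have := dotmx_le1 (nrm1 hOm l') (nrm1 hOm l); have := near l'.
by move: (dotmx _ _) => a h1 h2; nra.
Qed.

Lemma L2n_norm (E : set X) f : L2n mu E (fun x => `|f x|) = L2n mu E f.
Proof.
congr Num.sqrt; apply: eq_Rintegral => x _.
by rewrite -!expr2 real_normK// num_real.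
Qed.

Lemma sqi_norm (E : set X) f : measurable E -> sqi mu E f -> sqi mu E (fun x => `|f x|).
Proof.
move=> mE [mf fi]; split; first exact: measurableT_comp.
by apply: eq_integrable fi => // x _; rewrite real_normK// num_real.
Qed.

(** Every point of [Om] eventually leaves the strips. The face terms of [green] owe their smallness
    to this, as Hardy's gain is used up by the gradient of the cut-off. *)
Lemma L2n_strip_cvg0 l f : sqi mu Om f ->
  (fun k => L2n mu (strip l (3 / k.+1%:R)) f) @ \oo --> (0 : R).
Proof.
move=> sf; rewrite -(@sqrtr0 R).
have mG k := measurable_strip hOm l (3 / k.+1%:R : R).
have i1 := sqi_mul mD sf sf.
have h : (fun k => \int[mu]_(x in Om) (f x * f x * \1_(strip l (3 / k.+1%:R)) x)) @ \oo -->
    \int[mu]_(x in Om) (cst 0 x : R).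
  apply: (@dominated_cvg_Rintegral _ _ _ mu Om mD _ _ (fun x => f x * f x)) => //.
  - move=> k; apply: measurable_funM; [exact: intg_meas i1|exact: measurable_indic].
  - move=> x Ox; apply: cvg_near_cst; have d0 : 0 < fd l x := (OmP hOm x).1 Ox l.
    near=> k; rewrite indicE memNset ?mulr0// => -[_ h _].
    have : k.+1%:R^-1 < fd l x / 3.
      near: k; exact: (near_infty_natSinv_lt (PosNum (divr_gt0 d0 (ltr0n R 3)))).
    by move: h; move: (k.+1%:R^-1) => a; lra.
  - move=> k x _; rewrite normrM -expr2 (ger0_norm (sqr_ge0 _)) ler_piMr ?sqr_ge0// indicE.
    by case: (_ \in _); rewrite ?normr1 ?normr0.
have hE k : \int[mu]_(x in strip l (3 / k.+1%:R)) (f x * f x) =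
    \int[mu]_(x in Om) (f x * f x * \1_(strip l (3 / k.+1%:R)) x).
  have GO := @strip_Om _ _ Om _ nrm off l (3 / k.+1%:R).
  rewrite -{1}(setIidr GO) Rintegral_mkcondr; apply: eq_Rintegral => x _.
  by rewrite /patch indicE; case: ifP => _; rewrite ?mulr1 ?mulr0.
rewrite (_ : (fun k => _) = Num.sqrt \o (fun k => \int[mu]_(x in strip l (3 / k.+1%:R)) (f x * f x))) //.
apply: continuous_cvg; first exact: sqrt_continuous.
rewrite (_ : (fun k => _) = (fun k => \int[mu]_(x in Om) (f x * f x * \1_(strip l (3 / k.+1%:R)) x))).
  by move: h; rewrite Rintegral_cst// mul0r.
by apply/funext => k; exact: hE.
Unshelve. all: by end_near. Qed.

(** Where a face is nearer by [c > 0], the weight is at most [exp (- j.+1 c)], hence at most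
    [1 / (j.+1 c)]; domination is by [|f|]. *)
Lemma softw_cvg0 l f : intg mu Om f ->
  (fun j : nat => \int[mu]_(x in Om) (`|f x| *
     (softw (nrm := nrm) (off := off) j.+1%:R l x * \1_(interior_face l) x))) @ \oo --> (0 : R).
Proof.
move=> fi.
have h : (fun j : nat => \int[mu]_(x in Om) (`|f x| *
     (softw (nrm := nrm) (off := off) j.+1%:R l x * \1_(interior_face l) x))) @ \oo -->
     \int[mu]_(x in Om) (cst 0 x : R).
  have sw0 := softw_ge0 hOm n0; have sw1 := softw_le1 hOm n0.
  apply: (@dominated_cvg_Rintegral _ _ _ mu Om mD _ _ (fun x => `|f x|)) => //.
  - move=> j; apply: measurable_funM; first by apply: measurableT_comp => //; exact: intg_meas fi.
    apply: measurable_funM; last by apply: measurable_indic; exact: measurable_interior_face.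
    apply: measurable_funTS; apply: continuous_measurable_rV; apply: smooth_continuous.
    exact: (smooth_softw hOm n0).
  - move=> x Ox; rewrite indicE; have [[l' hl]|nV] := pselect (interior_face l x); last first.
      by rewrite memNset//; under eq_fun do rewrite !mulr0; exact: cvg_cst.
    rewrite mem_set; last by exists l'.
    apply: cvg0Z; under eq_fun do rewrite mulr1.
    have c0 : 0 < fd l x - fd l' x by rewrite subr_gt0.
    apply: (@squeeze_cvgr _ _ _ _ (fun=> 0) (fun j : nat => (fd l x - fd l' x)^-1 * j.+1%:R^-1)).
    + apply: nearW => j; rewrite sw0/=; apply: le_trans (softw_le hOm n0 _ l l' x) _.
      have j0 : (0 : R) < j.+1%:R by rewrite ltr0n.
      rewrite mulNr expRN -invfM mulrC lef_pV2 ?posrE ?expR_gt0 ?mulr_gt0//.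
      by apply: le_trans (expR_ge1Dx _); rewrite lerDr.
    + exact: cvg_cst.
    + by apply: cvg0Z; exact: cvg_harmonic.
  - exact: intg_norm.
  - move=> j x _; rewrite normrM normr_id ler_piMr// normrM indicE.
    by case: (_ \in _); rewrite ?normr1 ?normr0 ?mulr1 ?mulr0// ger0_norm.
by move: h; rewrite Rintegral_cst// mul0r.
Unshelve. all: by end_near. Qed.

(** The gradient of the cut-off vanishes once [softmin] reaches [2/k]. Below that value, a nearest
    face has the point in its strip, and its weight is bounded by 1; for any other face the weight
    is kept, to be made small by the sharpness. *)
Lemma cutoff_flux_bound : exists2 C : R, 0 <= C & forall (w : 'I_n -> X -> R) (v : X -> R) (k p : R) x,
  0 < k -> 0 < p -> k * ln m%:R <= p -> Om x ->
  `|v x * \sum_i w i x * partial i (cutoff (nrm := nrm) (off := off) k p) x| <=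
  \sum_l (k * C) * (`|v x * flux w l x| * \1_(strip l (3 / k)) x +
     `|v x * flux w l x| * (softw (nrm := nrm) (off := off) p l x * \1_(interior_face l) x)).
Proof.
have [C C0 hC] := @dstep_bound R; exists C => // w v k p x k0 p0 kp Ox.
have sw0 := softw_ge0 hOm n0 p; have sw1 := softw_le1 hOm n0 p.
have pn0 : p != 0 by rewrite gt_eqF.
have E : \sum_i w i x * partial i (cutoff (nrm := nrm) (off := off) k p) x =
   - (k * dstep (k * softmin (nrm := nrm) (off := off) p x - 1)) *
   \sum_l softw (nrm := nrm) (off := off) p l x * flux w l x.
  rewrite /flux; under [in RHS]eq_bigr do rewrite mulr_sumr.
  rewrite exchange_big/= mulr_sumr; apply: eq_bigr => i _.
  rewrite (partial_cutoff hOm n0 k i pn0) !mulr_sumr mulrN mulr_sumr -sumrN.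
  by apply: eq_bigr => l _; ring.
rewrite E mulrCA normrM normrN normrM (gtr0_norm k0).
have [D2|D2] := leP (2 / k) (softmin (nrm := nrm) (off := off) p x).
  rewrite (dcutoff_eq0 k0 D2) normr0 mulr0 mul0r; apply: sumr_ge0 => l _.
  rewrite mulr_ge0 ?mulr_ge0 ?(ltW k0)// addr_ge0// mulr_ge0// ?indicE//.
  by rewrite mulr_ge0.
rewrite mulr_sumr (le_trans (ler_wpM2l _ (ler_norm_sum _ _ _)))//.
  by rewrite mulr_ge0// ltW.
rewrite mulr_sumr; apply: ler_sum => l _.
apply: ler_pM => //; first by rewrite mulr_ge0// ltW.
  by rewrite ler_wpM2l ?(ltW k0).
rewrite mulrCA normrM (ger0_norm (sw0 l x)) -mulrDr mulrC ler_wpM2l// !indicE.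
have [V|nV] := pselect (interior_face l x).
  by rewrite [in X in _ + X]mem_set// mulr1 lerDr.
rewrite (mem_set (softmin_strip k0 p0 kp Ox nV D2)) memNset// mulr0 addr0.
exact: sw1.
Qed.

(** The order of choices matters: for each [k] the index [j_ k] is taken so large that the terms of
    the faces that are not nearest, their factor [k.+1] included, sum to at most [1 / k.+1]. In the
    strips that factor cancels against the Hardy width [3 / k.+1], and the norm of [v] over the
    strip still tends to 0. *)
Lemma green (w : 'I_n -> X -> R) (v : X -> R) : (forall i, H1 Om (w i)) ->
  (forall i, exists psi : nat -> X -> R, (forall k, smooth (psi k)) /\
    (fun k => H1norm Om (fun x => psi k x - w i x)) @ \oo --> (0 : R)) ->
  (forall l, exists2 C : R, 0 <= C & forall tau, 0 < tau -> tau <= 1 ->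
    L2n mu (strip l tau) (flux w l) <= C * tau) ->
  H1 Om v ->
  \int[mu]_(x in Om) (\sum_i (v x * wD Om i (w i) x + wD Om i v x * w i x)) = 0.
Proof.
move=> hw hap hfl hv.
have /choice[Cf hCf] l : exists C : R, 0 <= C /\ forall tau, 0 < tau -> tau <= 1 ->
    L2n mu (strip l tau) (flux w l) <= C * tau.
  by have [C C0 hC] := hfl l; exists C.
have [C C0 hC] := cutoff_flux_bound.
pose g x := \sum_i (v x * wD Om i (w i) x + wD Om i v x * w i x).
pose cut k p := cutoff (nrm := nrm) (off := off) k p.
have sv := H1_sqi hv; have sw i := H1_sqi (hw i).
have gi1 i : intg mu Om (fun x => v x * wD Om i (w i) x + wD Om i v x * w i x).
  by apply: (intgD mD); apply: (sqi_mul mD) => //; exact: H1_sqi_wD.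
have gi : intg mu Om g by exact: (intg_sum mD).
have sz l : sqi mu Om (flux w l) by apply: (sqi_sum mD) => i; exact: sqiZ.
have zi l : intg mu Om (fun x => v x * flux w l x) by exact: (sqi_mul mD).
have gE k p : 0 < k -> 0 < p -> \int[mu]_(x in Om) (g x * cut k p x) =
    - \int[mu]_(x in Om) (v x * \sum_i w i x * partial i (cut k p) x).
  move=> k0 p0; have tc := test_fun_cutoff hOm n0 k0 p0.
  have E1 : \int[mu]_(x in Om) (g x * cut k p x) = \int[mu]_(x in Om)
     (\sum_i (v x * wD Om i (w i) x + wD Om i v x * w i x) * cut k p x).
    by apply: eq_Rintegral => x _; rewrite /g mulr_suml.
  have E2 : \int[mu]_(x in Om) (v x * \sum_i w i x * partial i (cut k p) x) =
     \int[mu]_(x in Om) (\sum_i v x * w i x * partial i (cut k p) x).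
    by apply: eq_Rintegral => x _; rewrite mulr_sumr; under eq_bigr do rewrite mulrA.
  have wp i : weak_partial Om i (fun x => v x * w i x)
      (fun x => v x * wD Om i (w i) x + wD Om i v x * w i x).
    have [psi [sp hpsi]] := hap i; exact: (H1_mul_wp hOm n0 i hv (hw i) sp hpsi).
  rewrite E1 E2 !(Rintegral_sum mD).
  - rewrite -sumrN; apply: eq_bigr => i _; have [_ _ h] := wp i.
    by rewrite (h _ tc) opprK.
  - by move=> i; have [l _ _] := wp i; apply: (L1loc_intg hOm l); exact: test_fun_partial.
  - by move=> i; have [_ l _] := wp i; apply: (L1loc_intg hOm l).
pose u l (j : nat) := \int[mu]_(x in Om) (`|v x * flux w l x| *
     (softw (nrm := nrm) (off := off) j.+1%:R l x * \1_(interior_face l) x)).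
have /choice[j_ hj] : forall k : nat, exists j : nat, k.+1%:R * ln m%:R <= j.+1%:R :> R /\
    \sum_l (k.+1%:R * C) * u l j <= k.+1%:R^-1.
  move=> k.
  have h : (fun j : nat => \sum_l (k.+1%:R * C) * u l j) @ \oo --> (0 : R).
    by apply: cvg0_sum => l; exact: softw_cvg0.
  have k0 : (0 : R) < k.+1%:R^-1 by rewrite invr_gt0 ltr0n.
  move/cvgr_le : (h) => /(_ _ k0) e1.
  have e2 : \forall N \near \oo, k.+1%:R * ln m%:R <= N.+1%:R :> R.
    near=> N; apply: (@le_trans _ _ N%:R); last by rewrite ler_nat.
    by near: N; exact: nbhs_infty_ger.
  have [j [h1 h2]] := filter_ex (filterI e1 e2).
  by exists j.
pose p_ k : R := (j_ k).+1%:R.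
have p0 k : 0 < p_ k by rewrite ltr0n.
have pk k : k.+1%:R * ln m%:R <= p_ k by have [] := hj k.
have a_cvg : (fun k => \int[mu]_(x in Om) (g x * cut k.+1%:R (p_ k) x)) @ \oo --> \int[mu]_(x in Om) g x.
  apply: (@dominated_cvg_Rintegral _ _ _ mu Om mD _ _ (fun x => `|g x|)).
  - move=> k; apply: measurable_funM; first exact: intg_meas gi.
    apply: measurable_funTS; apply: continuous_measurable_rV; apply: smooth_continuous.
    exact: (smooth_cutoff hOm n0).
  - exact: intg_meas gi.
  - move=> x Ox; apply: cvg_near_cst; have := cutoff_cvg hOm n0 p0 pk Ox.
    by apply: filterS => k hk; rewrite /cut hk mulr1.
  - exact: intg_norm.
  - by move=> k x _; rewrite normrM ler_piMr// ger0_norm ?cutoff_ge0 ?cutoff_le1.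
pose V l (k : nat) := L2n mu (strip l (3 / k.+1%:R)) v.
(* [hfl] is available for widths up to 1, and [3 / k.+1 <= 1] from [k = 2] on. *)
have a_bnd k : (2 <= k)%N -> `|\int[mu]_(x in Om) (g x * cut k.+1%:R (p_ k) x)| <=
    \sum_l (3 * C * Cf l) * V l k + k.+1%:R^-1.
  move=> k2; set K : R := k.+1%:R; have K0 : 0 < K by rewrite ltr0n.
  have K3 : 3 / K <= 1 by rewrite ler_pdivrMr// mul1r ler_nat.
  have t0 : 0 < 3 / K by rewrite divr_gt0.
  have mG l := measurable_strip hOm l (3 / K).
  have GO l := @strip_Om _ _ Om _ nrm off l (3 / K).
  have sc := smooth_cutoff hOm n0 K (p_ k).
  have Fi : intg mu Om (fun x => v x * \sum_i w i x * partial i (cut K (p_ k)) x).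
    apply: (sqi_mul mD) => //; apply: (sqi_sum mD) => i.
    have sci := smooth_partial i sc.
    have [B B0 hB] := bounded_smooth hOm sci.
    rewrite (_ : (fun x => _) = fun x => partial i (cut K (p_ k)) x * w i x); last first.
      by apply/funext => x; rewrite mulrC.
    exact: (sqiM mD (sqi_meas (sqi_smooth hOm sci)) hB (sw i)).
  have i1 l : intg mu Om (fun x => `|v x * flux w l x| * \1_(strip l (3 / K)) x).
    apply: (@le_intg _ _ _ mu Om mD _ (fun x => `|v x * flux w l x|)); last exact: (intg_norm (zi l)).
      apply: measurable_funM; last exact: measurable_indic.
      by apply: measurableT_comp => //; exact: intg_meas (zi l).
    move=> x _; rewrite normrM normr_id ler_piMr// indicE.
    by case: (_ \in _); rewrite ?normr1 ?normr0.
  have i2 l : intg mu Om (fun x => `|v x * flux w l x| *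
     (softw (nrm := nrm) (off := off) (p_ k) l x * \1_(interior_face l) x)).
    have sw0 := softw_ge0 hOm n0 (p_ k); have sw1 := softw_le1 hOm n0 (p_ k).
    apply: (@le_intg _ _ _ mu Om mD _ (fun x => `|v x * flux w l x|)); last exact: (intg_norm (zi l)).
      apply: measurable_funM; first by apply: measurableT_comp => //; exact: intg_meas (zi l).
      apply: measurable_funM; last by apply: measurable_indic; exact: measurable_interior_face.
      apply: measurable_funTS; apply: continuous_measurable_rV; apply: smooth_continuous.
      exact: (smooth_softw hOm n0).
    move=> x _; rewrite normrM normr_id ler_piMr// normrM indicE.
    by case: (_ \in _); rewrite ?normr1 ?normr0 ?mulr1 ?mulr0// ger0_norm.
  rewrite gE// normrN.
  apply: le_trans (le_normr_Rintegral mD Fi) _.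
  apply: (@le_trans _ _ (\int[mu]_(x in Om) (\sum_l (K * C) * (`|v x * flux w l x| * \1_(strip l (3 / K)) x +
     `|v x * flux w l x| * (softw (nrm := nrm) (off := off) (p_ k) l x * \1_(interior_face l) x))))).
    apply: (le_Rintegral mD); [exact: (intg_norm Fi)| |].
      by apply: (intg_sum mD) => l; apply: (intgZ mD); exact: (intgD mD).
    move=> x Ox; exact: (hC w v K (p_ k) x K0 (p0 k) (pk k) Ox).
  rewrite (Rintegral_sum mD); last by move=> l; apply: (intgZ mD); exact: (intgD mD).
  have [_ hjk] := hj k; apply: le_trans (lerD (lexx _) hjk).
  rewrite -big_split/=; apply: ler_sum => l _.
  rewrite RintegralZl//; last exact: (intgD mD).
  rewrite (RintegralD mD (i1 l) (i2 l)) mulrDr lerD2r.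
  have -> : \int[mu]_(x in Om) (`|v x * flux w l x| * \1_(strip l (3 / K)) x) =
      \int[mu]_(x in strip l (3 / K)) (`|v x| * `|flux w l x|).
    rewrite -[in RHS](setIidr (GO l)) Rintegral_mkcondr; apply: eq_Rintegral => x _.
    by rewrite /patch indicE normrM; case: ifP => _; rewrite ?mulr1 ?mulr0.
  have s1 := sqi_subset (mG l) mD (GO l) sv; have s2 := sqi_subset (mG l) mD (GO l) (sz l).
  have CS := cauchy_schwarz_norm (mG l) (sqi_norm (mG l) s1) (sqi_norm (mG l) s2).
  rewrite !L2n_norm in CS.
  have H1 := le_trans (ler_norm _) CS.
  have H2 : L2n mu (strip l (3 / K)) v * L2n mu (strip l (3 / K)) (flux w l) <=
      V l k * (Cf l * (3 / K)).
    by apply: ler_wpM2l; [exact: L2n_ge0|have [_] := hCf l; exact].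
  have -> : 3 * C * Cf l * V l k = (K * C) * (V l k * (Cf l * (3 / K))).
    by field; rewrite gt_eqF.
  by apply: ler_wpM2l; [rewrite mulr_ge0// ltW|exact: le_trans H1 H2].
have b0 : (fun k => \sum_l (3 * C * Cf l) * V l k + k.+1%:R^-1) @ \oo --> (0 : R).
  apply: cvg0D; last exact: cvg_harmonic.
  by apply: cvg0_sum => l; exact: L2n_strip_cvg0.
have a0 : (fun k => \int[mu]_(x in Om) (g x * cut k.+1%:R (p_ k) x)) @ \oo --> (0 : R).
  apply: norm_cvg0; apply: (@squeeze_cvgr _ _ _ _ (fun=> 0)
     (fun k => \sum_l (3 * C * Cf l) * V l k + k.+1%:R^-1)); [|exact: cvg_cst|exact: b0].
  by near=> k; rewrite normr_ge0/=; apply: a_bnd; near: k; exact: nbhs_infty_ge.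
exact: (cvg_unique _ a_cvg a0).
Unshelve. all: by end_near. Qed.

End green.

(** * Ladyzhenskaya's inequality *)

(** The derivative of [phi^2] is integrated from a point on the left of the support. *)
Lemma sqr_le_integral_deriv {R : realType} (phi dphi : R -> R) (B t : R) :
  (forall s : R, is_derive s 1 phi (dphi s)) -> continuous dphi ->
  (forall s, B < `|s| -> phi s = 0) ->
  ((phi t ^+ 2)%:E <= \int[@lebesgue_measure R]_s (2 * `|phi s * dphi s|)%:E)%E.
Proof.
move=> hd cd h0; have cphi : continuous phi by exact: is_derive_continuous hd.
have mpd : measurable_fun setT (fun s => phi s * dphi s).
  by apply: measurable_funM; exact: continuous_measurable_fun.
have nn s : (0 <= (2 * `|phi s * dphi s|)%:E)%E by rewrite lee_fin mulr_ge0.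
(* The sign of [B] is unknown; the absolute value and the 1 ensure [B < |A|], so that [phi] vanishes
   at [A] and to the left of it. *)
pose A := - (`|B| + 1).
have [tA|tA] := leP t A.
  rewrite h0 ?expr0n/=; first by apply: integral_ge0 => s _; exact: nn.
  have : `|B| + 1 <= `|t| by rewrite -(normrN t) (le_trans _ (ler_norm _))//; move: tA; rewrite /A; lra.
  by have := ler_norm B; lra.
have dsq (s : R) : is_derive s 1 (fun s => phi s ^+ 2) (2 * (phi s * dphi s)).
  apply: (is_derive_eq (is_deriveM (hd s) (hd s))).
  by rewrite /GRing.scale/=; ring.
have csq : continuous (fun s => 2 * (phi s * dphi s)).
  move=> s; apply: (@continuous_comp _ _ _ (fun s => phi s * dphi s) (fun y : R => 2 * y)).
    by apply: cvgM; [exact: cphi|exact: cd].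
  exact: mulrl_continuous.
have ftc : (\int[@lebesgue_measure R]_(s in `[A, t]) (2 * (phi s * dphi s))%:E =
    (phi t ^+ 2)%:E - (phi A ^+ 2)%:E)%E.
  apply: (@continuous_FTC2 _ _ (fun s => phi s ^+ 2)) => //.
  - exact: continuous_subspaceT.
  - have c2 : continuous (fun s => phi s ^+ 2) by exact: is_derive_continuous dsq.
    split.
    + by move=> x _; exact: (@ex_derive _ _ _ _ _ _ _ (dsq x)).
    + by apply: cvg_at_right_filter; exact: c2.
    + by apply: cvg_at_left_filter; exact: c2.
  - by move=> x _; rewrite derive1E; exact: (@derive_val _ _ _ _ _ _ _ (dsq x)).
have A0 : phi A = 0.
  apply: h0; rewrite /A normrN ger0_norm ?addr_ge0//.
  by have := ler_norm B; lra.
move: ftc; rewrite A0 expr0n/= sube0 => <-.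
have m2 : measurable_fun setT (fun s => (2 * (phi s * dphi s))%:E).
  by apply/measurable_EFinP; exact: continuous_measurable_fun.
apply: le_trans (le_trans (lee_abs _) (le_abse_integral _ _ _)) _ => //.
  exact: measurable_funTS.
apply: (@le_trans _ _ (\int[@lebesgue_measure R]_(s in `[A, t]) (2 * `|phi s * dphi s|)%:E)%E).
  rewrite le_eqVlt; apply/orP; left; apply/eqP; apply: eq_integral => s _.
  by rewrite /= normrM ger0_norm.
apply: ge0_subset_integral => //.
apply/measurable_EFinP; apply: measurable_funM => //.
exact: measurableT_comp.
Qed.

Section slices.
Context {R : realType}.

Definition cube_supp n (B : R) (f : 'rV[R]_n -> R) :=
  forall x : 'rV[R]_n, ~ (forall i, `|x 0 i| <= B) -> f x = 0.

(** Support in a cube, rather than in some compact set, passes to slices with the same bound [B]. *)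
Definition test_cube n B (f : 'rV[R]_n -> R) := smooth f /\ cube_supp B f.

Lemma consv0 n (a : R) (y : 'rV[R]_n) : consv (a, y) 0 ord0 = a.
Proof. by have := consvK (a, y) => -[]. Qed.

Lemma consv_lift n (a : R) (y : 'rV[R]_n) i : consv (a, y) 0 (lift ord0 i) = y 0 i.
Proof. by have := consvK (a, y) => -[_] /rowP/(_ i); rewrite mxE. Qed.

Lemma consv_rowP n (x : 'rV[R]_n.+1) (a : R) (y : 'rV[R]_n) :
  x 0 ord0 = a -> (forall i, x 0 (lift ord0 i) = y 0 i) -> x = consv (a, y).
Proof.
move=> h0 hi; apply/rowP => j; have [i ->|->] := unliftP ord0 j.
  by rewrite consv_lift hi.
by rewrite consv0 h0.
Qed.

Lemma consv_line0 n (t : R) (y : 'rV[R]_n) :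
  consv (t, y) = consv (0, y) + t *: delta_mx 0 ord0.
Proof.
apply/esym/consv_rowP => [|i].
  by rewrite mxE consv0 !mxE !eqxx/= mulr1 add0r.
by rewrite mxE consv_lift !mxE/= mulr0 addr0.
Qed.

Lemma consv_line_lift n (a s : R) (y : 'rV[R]_n) i :
  consv (a, y + s *: delta_mx 0 i) = consv (a, y) + s *: delta_mx 0 (lift ord0 i).
Proof.
apply/esym/consv_rowP => [|k].
  by rewrite mxE consv0 !mxE/= mulr0 addr0.
by rewrite mxE consv_lift !mxE/= (inj_eq (@lift_inj _ ord0)).
Qed.

Definition slice n (a : R) (f : 'rV[R]_n.+1 -> R) : 'rV[R]_n -> R := fun y => f (consv (a, y)).

Lemma is_derive_slice n a (f : 'rV[R]_n.+1 -> R) i y : smooth f ->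
  is_derive y (delta_mx 0 i) (slice a f) (slice a (partial (lift ord0 i) f) y).
Proof.
move=> sf; apply: line_is_derive.
rewrite (_ : (fun s : R => _) = fun s : R => f (consv (a, y) + s *: delta_mx 0 (lift ord0 i))).
  apply: is_derive_line; rewrite scale0r addr0; exact: smooth_is_derive.
by apply/funext => s; rewrite /slice consv_line_lift.
Qed.

Lemma smooth_slice n a (f : 'rV[R]_n.+1 -> R) : smooth f -> smooth (slice a f).
Proof.
move=> sf; apply: (@smooth_coind _ _ (fun g => exists2 f, smooth f & g = slice a f)); last by exists f.
move=> _ [g sg ->]; split.
  have cc : continuous (fun y : 'rV[R]_n => consv (a, y)).
    apply: continuous_rV => j; have [i ->|->] := unliftP ord0 j.
      rewrite (_ : (fun y : 'rV[R]_n => _) = fun y => y 0 i); first exact: coord_continuous.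
      by apply/funext => y; rewrite consv_lift.
    rewrite (_ : (fun y : 'rV[R]_n => _) = fun=> a); first exact: cst_continuous.
    by apply/funext => y; rewrite consv0.
  by move=> y; apply: (@continuous_comp _ _ _ (fun y => consv (a, y)) g); [exact: cc|exact: smooth_continuous].
move=> i; exists (slice a (partial (lift ord0 i) g)).
  exact: (ex_intro2 _ _ (partial (lift ord0 i) g) (smooth_partial _ sg) erefl).
by move=> y; exact: is_derive_slice.
Qed.

Lemma partial_slice n a (f : 'rV[R]_n.+1 -> R) i : smooth f ->
  partial i (slice a f) = slice a (partial (lift ord0 i) f).
Proof. by move=> sf; apply: is_derive_partial => y; exact: is_derive_slice. Qed.

Lemma test_cube_slice n B a (f : 'rV[R]_n.+1 -> R) : test_cube B f -> test_cube B (slice a f).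
Proof.
move=> [sf hf]; split; first exact: smooth_slice.
move=> y hy; apply: hf => h; apply: hy => i.
by have := h (lift ord0 i); rewrite consv_lift.
Qed.

Lemma sqr_le_integral_slice n B (f : 'rV[R]_n.+1 -> R) a y : test_cube B f ->
  ((f (consv (a, y)) ^+ 2)%:E <= \int[@lebesgue_measure R]_t
     (2 * `|f (consv (t, y)) * partial ord0 f (consv (t, y))|)%:E)%E.
Proof.
move=> [sf hf].
have h (s : R) : is_derive s 1 (fun t => f (consv (t, y))) (partial ord0 f (consv (s, y))).
  rewrite (_ : (fun t : R => _) = fun t : R => f (consv (0, y) + t *: delta_mx 0 ord0)).
    by rewrite consv_line0; apply: is_derive_line; exact: smooth_is_derive.
  by apply/funext => t; rewrite consv_line0.
apply: (@sqr_le_integral_deriv R (fun t => f (consv (t, y))) (fun t => partial ord0 f (consv (t, y))) B a h).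
- have sp := smooth_partial ord0 sf.
  apply: (@is_derive_continuous R _ (fun t => partial ord0 (partial ord0 f) (consv (t, y)))) => s.
  rewrite (_ : (fun t : R => _) = fun t : R => partial ord0 f (consv (0, y) + t *: delta_mx 0 ord0)).
    by rewrite consv_line0; apply: is_derive_line; exact: smooth_is_derive.
  by apply/funext => t; rewrite consv_line0.
- move=> s Bs; apply: hf => /(_ ord0); rewrite consv0 leNgt; apply/negP; by rewrite negbK.
Qed.

Lemma test_cube_compact n B (f : 'rV[R]_n -> R) : test_cube B f ->
  exists2 K : set 'rV[R]_n, compact K & forall x, ~ K x -> f x = 0.
Proof.
move=> [sf hf]; exists [set x : 'rV[R]_n | forall i, `|x 0 i| <= B]; last first.
  by move=> x nx; apply: hf.
apply: bounded_closed_compact; first by apply: (@bounded_set_coord _ _ _ B).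
rewrite (_ : [set _ | _] = \bigcap_(i in setT) ((fun x : 'rV[R]_n => x 0 i) @^-1` [set z | `|z| <= B])).
  apply: closed_bigI => i _; apply: preimage_closed.
    by move=> x _; exact: coord_continuous.
  apply: (@preimage_closed _ _ (@Num.Def.normr R R) [set z | z <= B]); last exact: closed_le.
  by move=> x _; exact: norm_continuous.
by apply/seteqP; split => x h i; [move=> _|]; exact: h.
Qed.

Lemma test_cube_sqi n B (f : 'rV[R]_n -> R) : test_cube B f ->
  sqi (leb R n) setT f /\ forall i, sqi (leb R n) setT (partial i f).
Proof.
move=> tf; have [K cK f0] := test_cube_compact tf; have [sf _] := tf.
have H (g : 'rV[R]_n -> R) : continuous g -> (forall x, ~ K x -> g x = 0) -> sqi (leb R n) setT g.
  move=> cg g0; split; first exact: continuous_measurable_rV.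
  apply: (@supp_intg _ _ (fun x => g x ^+ 2) K setT) => //.
    by move=> x; apply: (@continuous_comp _ _ _ g (fun y : R => y ^+ 2)); [exact: cg|exact: exprn_continuous].
  by move=> x /g0 ->; rewrite expr0n.
split; first by apply: H => //; exact: smooth_continuous.
move=> i; apply: H; last exact: partial_eq0_compact.
by apply: smooth_continuous; exact: smooth_partial.
Qed.

Lemma measurable_slice n (f : 'rV[R]_n.+1 -> R) (a : R) : smooth f ->
  measurable_fun setT (fun y : 'rV[R]_n => f (consv (a, y))).
Proof.
by move=> sf; apply: continuous_measurable_rV; apply: smooth_continuous; exact: smooth_slice.
Qed.

Lemma ge0_integral_consv2 n (f : 'rV[R]_n.+1 -> \bar R) :
  measurable_fun setT f -> (forall x, 0 <= f x)%E ->
  (\int[leb R n.+1]_x f x =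
   \int[leb R n]_y \int[@lebesgue_measure R]_t f (consv (t, y)))%E.
Proof.
move=> mf f0; rewrite (ge0_integral_consv mf f0).
have mc : measurable_fun setT (f \o @consv R n).
  by apply: measurableT_comp mf _; exact: measurable_consv.
have c0 p : (0 <= (f \o @consv R n) p)%E by exact: f0.
by rewrite -(@fubini_tonelli1 _ _ _ _ R lebesgue_measure (leb R n) _ mc c0)
  (@fubini_tonelli2 _ _ _ _ R lebesgue_measure (leb R n) _ mc c0).
Qed.

End slices.

Section ladyzhenskaya.
Context {R : realType}.

Lemma EFin_L2n_sq n (f : 'rV[R]_n -> R) : sqi (leb R n) setT f ->
  ((L2n (leb R n) setT f ^+ 2)%:E = \int[leb R n]_x (f x ^+ 2)%:E)%E.
Proof.
move=> sf; rewrite L2n_sq (EFin_Rintegral measurableT); last exact: (sqi_mul measurableT sf sf).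
by apply: eq_integral => x _; rewrite expr2.
Qed.

Lemma integral_rV1 (h : 'rV[R]_1 -> \bar R) : measurable_fun setT h ->
  (forall x, 0 <= h x)%E ->
  (\int[leb R 1]_x h x = \int[@lebesgue_measure R]_t h (consv (t, 0%R : 'rV[R]_0)))%E.
Proof.
move=> mh h0; rewrite (ge0_integral_consv mh h0); apply: eq_integral => t _ /=.
rewrite integral_dirac// ?diracT ?mul1e//.
by apply: measurableT_comp mh _; apply: measurableT_comp (@measurable_consv R 0) _; exact: measurable_pair1.
Qed.

(** This is the absolute value of the derivative of [f^2] along axis [i]; integrated over a line
    parallel to that axis it bounds [f^2] on the line. *)
Definition cross n i (f : 'rV[R]_n -> R) x := 2 * `|f x * partial i f x|.

Lemma cross_ge0 n i (f : 'rV[R]_n -> R) x : (0 <= (cross i f x)%:E)%E.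
Proof. by rewrite lee_fin mulr_ge0. Qed.

Lemma measurable_cross n i (f : 'rV[R]_n -> R) : smooth f ->
  measurable_fun setT (fun x => (cross i f x)%:E).
Proof.
move=> sf; apply/measurable_EFinP; apply: measurable_funM => //.
apply: measurableT_comp => //; apply: measurable_funM; apply: continuous_measurable_rV.
  exact: smooth_continuous.
by apply: smooth_continuous; exact: smooth_partial.
Qed.

Lemma integral_cross n B i (f : 'rV[R]_n -> R) : test_cube B f ->
  (\int[leb R n]_x (cross i f x)%:E <=
   (2 * (L2n (leb R n) setT f * L2n (leb R n) setT (partial i f)))%:E)%E.
Proof.
move=> tf; have [s0 /(_ i) s1] := test_cube_sqi tf.
have n0 := sqi_norm measurableT s0; have n1 := sqi_norm measurableT s1.
have im := sqi_mul measurableT n0 n1.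
have -> : (\int[leb R n]_x (cross i f x)%:E)%E =
    (2 * \int[leb R n]_x (`|f x| * `|partial i f x|))%:E.
  rewrite EFinM (EFin_Rintegral measurableT im) -ge0_integralZl//.
  - by apply: eq_integral => x _; rewrite /cross normrM EFinM.
  - exact: measurable_int im.
rewrite lee_fin ler_wpM2l//.
have := le_trans (ler_norm _) (cauchy_schwarz_norm measurableT n0 n1).
by rewrite !L2n_norm.
Qed.

Lemma sqr_le_integral_cross1 B (g : 'rV[R]_1 -> R) y : test_cube B g ->
  ((g y ^+ 2)%:E <= \int[leb R 1]_x (cross ord0 g x)%:E)%E.
Proof.
move=> tg; rewrite integral_rV1; last 2 first.
- by apply: measurable_cross; case: tg.
- by move=> x; exact: cross_ge0.
rewrite (@consv_rowP _ _ y (y 0 ord0) 0 erefl); last by move=> -[].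
exact: (sqr_le_integral_slice _ _ tg).
Qed.

(** One factor [f^2] is bounded by an integral along the first axis, the other along the second. The
    first bound depends on the second coordinate only and conversely, so the integral of their
    product splits. *)
Lemma ladyzhenskaya2 B (f : 'rV[R]_2 -> R) : test_cube B f ->
  (\int[leb R 2]_x (f x ^+ 4)%:E <=
   (2 * L2n (leb R 2) setT f ^+ 2 * \sum_i L2n (leb R 2) setT (partial i f) ^+ 2)%:E)%E.
Proof.
move=> tf; have [sf hf] := tf.
pose i1 : 'I_2 := lift ord0 ord0.
have m0 := measurable_cross ord0 sf; have m1 := measurable_cross i1 sf.
have mc0 : measurable_fun setT ((fun x => (cross ord0 f x)%:E) \o @consv R 1).
  by apply: measurableT_comp m0 _; exact: measurable_consv.
have mc1 : measurable_fun setT ((fun x => (cross i1 f x)%:E) \o @consv R 1).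
  by apply: measurableT_comp m1 _; exact: measurable_consv.
pose A y := (\int[@lebesgue_measure R]_t (cross ord0 f (consv (t, y)))%:E)%E.
pose C a := (\int[leb R 1]_y (cross i1 f (consv (a, y)))%:E)%E.
have A0 y : (0 <= A y)%E by apply: integral_ge0 => t _; exact: cross_ge0.
have C0 y : (0 <= C y)%E by apply: integral_ge0 => t _; exact: cross_ge0.
have mA : measurable_fun setT A.
  by apply: (measurable_fun_fubini_tonelli_G _ mc0) => p; exact: cross_ge0.
have mC : measurable_fun setT C.
  by apply: (measurable_fun_fubini_tonelli_F _ mc1) => p; exact: cross_ge0.
have m4 : measurable_fun setT (fun x => (f x ^+ 4)%:E).
  apply/measurable_EFinP; apply: measurable_funX; apply: continuous_measurable_rV.
  exact: smooth_continuous.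
have f4 x : (0 <= (f x ^+ 4)%:E)%E by rewrite lee_fin exprn_even_ge0.
have H : (\int[leb R 2]_x (f x ^+ 4)%:E <=
    (\int[leb R 2]_x (cross ord0 f x)%:E) * (\int[leb R 2]_x (cross i1 f x)%:E))%E.
  rewrite (ge0_integral_consv m4 f4) (ge0_integral_consv2 m0); last by move=> x; exact: cross_ge0.
  rewrite (ge0_integral_consv m1); last by move=> x; exact: cross_ge0.
  rewrite -/(A _) -/(C _) -[leRHS](ge0_integralZl _ measurableT mC (fun a _ => C0 a)); last first.
    by apply: integral_ge0 => y _; exact: A0.
  apply: ge0_le_integral => //.
  - by move=> a _; apply: integral_ge0 => y _; exact: f4.
  - apply: (measurable_fun_fubini_tonelli_F ((fun x => (f x ^+ 4)%:E) \o @consv R 1)).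
      by apply: measurableT_comp m4 _; exact: measurable_consv.
    by move=> p; exact: f4.
  - exact: measurable_funeM.
  move=> a _; rewrite muleC -(ge0_integralZl _ measurableT mA (fun y _ => A0 y) (C0 a)).
  apply: ge0_le_integral => //.
  - by apply/measurable_EFinP; apply: measurable_funX; exact: measurable_slice.
  - exact: measurable_funeM.
  move=> y _; rewrite (_ : f _ ^+ 4 = f (consv (a, y)) ^+ 2 * f (consv (a, y)) ^+ 2); last by rewrite -exprD.
  rewrite EFinM; apply: lee_pmul; rewrite ?lee_fin ?sqr_ge0//.
    have := @sqr_le_integral_cross1 B (slice a f) y (test_cube_slice a tf).
    rewrite /C /cross partial_slice//.
  exact: (sqr_le_integral_slice _ _ tf).
apply: le_trans H _.
have H0 := integral_cross ord0 tf; have H1 := integral_cross i1 tf.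
apply: le_trans (lee_pmul _ _ H0 H1) _.
- by apply: integral_ge0 => x _; exact: cross_ge0.
- by apply: integral_ge0 => x _; exact: cross_ge0.
rewrite -EFinM lee_fin big_ord_recl big_ord1.
move: (L2n _ _ f) (L2n_ge0 (leb R 2) setT f) => a a0.
move: (L2n _ _ _) (L2n _ _ _) => b c.
(* Turns the product [4 a^2 b c] into [2 a^2 (b^2 + c^2)]. *)
have : 0 <= a ^+ 2 * (b - c) ^+ 2 by rewrite mulr_ge0 ?sqr_ge0.
by rewrite sqrrB; nra.
Qed.

(** The planar inequality is used on every slice. Its L^2 factor is bounded by [S] uniformly in the
    slice, by the integral of [cross ord0 f] across the slices; the gradient factor is then
    integrated over the slices. *)
Lemma ladyzhenskaya3 B (f : 'rV[R]_3 -> R) : test_cube B f ->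
  (\int[leb R 3]_x (f x ^+ 4)%:E <=
   (2 * (2 * (L2n (leb R 3) setT f * L2n (leb R 3) setT (partial ord0 f))) *
     \sum_i L2n (leb R 3) setT (partial (lift ord0 i) f) ^+ 2)%:E)%E.
Proof.
move=> tf; have [sf hf] := tf.
have [s0 s1] := test_cube_sqi tf.
set S := 2 * (L2n (leb R 3) setT f * _).
have S0 : 0 <= S by rewrite mulr_ge0// mulr_ge0// L2n_ge0.
have m0 := measurable_cross ord0 sf.
have m4 : measurable_fun setT (fun x => (f x ^+ 4)%:E).
  apply/measurable_EFinP; apply: measurable_funX; apply: continuous_measurable_rV.
  exact: smooth_continuous.
have f4 x : (0 <= (f x ^+ 4)%:E)%E by rewrite lee_fin exprn_even_ge0.
have ma a : L2n (leb R 2) setT (slice a f) ^+ 2 <= S.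
  have [sa _] := test_cube_sqi (test_cube_slice a tf).
  rewrite -lee_fin (EFin_L2n_sq sa).
  apply: le_trans (integral_cross ord0 tf).
  rewrite (ge0_integral_consv2 m0); last by move=> x; exact: cross_ge0.
  apply: ge0_le_integral => //.
  - by move=> y _; rewrite lee_fin sqr_ge0.
  - by apply/measurable_EFinP; apply: measurable_funX; exact: measurable_slice.
  - apply: (measurable_fun_fubini_tonelli_G ((fun x => (cross ord0 f x)%:E) \o @consv R 2)).
      by apply: measurableT_comp m0 _; exact: measurable_consv.
    by move=> p; exact: cross_ge0.
  by move=> y _; exact: (sqr_le_integral_slice _ _ tf).
pose e x := \sum_i partial (lift ord0 i) f x ^+ 2.
have e0 x : (0 <= (e x)%:E)%E by rewrite lee_fin sumr_ge0// => i _; exact: sqr_ge0.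
have me : measurable_fun setT (fun x => (e x)%:E).
  apply/measurable_EFinP; apply: measurable_sum => i; apply: measurable_funX.
  by apply: continuous_measurable_rV; apply: smooth_continuous; exact: smooth_partial.
have eE : (\int[leb R 3]_x (e x)%:E = (\sum_i L2n (leb R 3) setT (partial (lift ord0 i) f) ^+ 2)%:E)%E.
  rewrite /e -EFin_Rintegral//; last first.
    apply: (intg_sum measurableT) => i; exact: (sqi_sq (s1 _)).
  congr EFin; rewrite (Rintegral_sum measurableT); last by move=> i; exact: (sqi_sq (s1 _)).
  by apply: eq_bigr => i _; rewrite L2n_sq; apply: eq_Rintegral => x _; rewrite expr2.
have mE : measurable_fun setT (fun a => \int[leb R 2]_y (e (consv (a, y)))%:E)%E.
  apply: (measurable_fun_fubini_tonelli_F ((fun x => (e x)%:E) \o @consv R 2)).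
    by apply: measurableT_comp me _; exact: measurable_consv.
  by move=> p; exact: e0.
rewrite EFinM -eE (ge0_integral_consv m4 f4) (ge0_integral_consv me e0) -ge0_integralZl//; first last.
- by rewrite lee_fin mulr_ge0.
- by move=> a _; apply: integral_ge0 => y _; exact: e0.
apply: ge0_le_integral => //.
- by move=> a _; apply: integral_ge0 => y _; exact: f4.
- apply: (measurable_fun_fubini_tonelli_F ((fun x => (f x ^+ 4)%:E) \o @consv R 2)).
    by apply: measurableT_comp m4 _; exact: measurable_consv.
  by move=> p; exact: f4.
- exact: measurable_funeM.
move=> a _; have tfa := test_cube_slice a tf; have [sa s1a] := test_cube_sqi tfa.
apply: le_trans (ladyzhenskaya2 tfa) _.
have -> : (\int[leb R 2]_y (e (consv (a, y)))%:E =
    (\sum_i L2n (leb R 2) setT (partial i (slice a f)) ^+ 2)%:E)%E.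
  transitivity (\int[leb R 2]_y (\sum_i partial i (slice a f) y ^+ 2)%:E)%E.
    by apply: eq_integral => y _; congr EFin; apply: eq_bigr => i _; rewrite partial_slice.
  rewrite -EFin_Rintegral//; last first.
    apply: (intg_sum measurableT) => i; exact: (sqi_sq (s1a _)).
  congr EFin; rewrite (Rintegral_sum measurableT); last by move=> i; exact: (sqi_sq (s1a _)).
  by apply: eq_bigr => i _; rewrite L2n_sq; apply: eq_Rintegral => x _; rewrite expr2.
rewrite -EFinM lee_fin ler_wpM2r//; first by apply: sumr_ge0 => i _; exact: sqr_ge0.
by rewrite ler_wpM2l.
Qed.

(** Both dimensions are weakened to a common bound by the squared H^1 norm, which is what the
    density argument can control. *)
Lemma ladyzhenskaya n B (f : 'rV[R]_n -> R) : n = 2%N \/ n = 3%N -> test_cube B f ->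
  (\int[leb R n]_x (f x ^+ 4)%:E <= (2 * (L2n (leb R n) setT f ^+ 2 +
     \sum_i L2n (leb R n) setT (partial i f) ^+ 2) ^+ 2)%:E)%E.
Proof.
move=> [nE|nE] tf; subst n.
  apply: le_trans (ladyzhenskaya2 tf) _; rewrite lee_fin.
  have : 0 <= \sum_i L2n (leb R 2) setT (partial i f) ^+ 2 by apply: sumr_ge0 => i _; exact: sqr_ge0.
  by have := sqr_ge0 (L2n (leb R 2) setT f); move: (_ ^+ 2) (\sum_i _) => a b; nra.
apply: le_trans (ladyzhenskaya3 tf) _; rewrite lee_fin [in leRHS]big_ord_recl.
have : 0 <= \sum_i L2n (leb R 3) setT (partial (lift ord0 i) f) ^+ 2 by apply: sumr_ge0 => i _; exact: sqr_ge0.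
move: (\sum_i _) => s s0.
move: (L2n _ _ f) (L2n _ _ (partial ord0 f)) => a b.
have h : 2 * (a * b) <= a ^+ 2 + b ^+ 2 by have := sqr_ge0 (a - b); rewrite sqrrB; lra.
have a2 := sqr_ge0 a; have b2 := sqr_ge0 b.
move: h a2 b2; move: (a * b) (a ^+ 2) (b ^+ 2) => ab a2 b2 h ha hb.
have : 2 * (2 * ab) * s <= 2 * (a2 + b2) * s by rewrite ler_wpM2r//; lra.
nra.
Qed.

End ladyzhenskaya.

Lemma L2n_mul_le {dsp : measure_display} {T : measurableType dsp} {R : realType}
    (mu : {measure set T -> \bar R}) (D : set T) (c f : T -> R) (K : R) :
  measurable D -> measurable_fun D c -> 0 <= K -> (forall x, D x -> `|c x| <= K) ->
  sqi mu D f -> L2n mu D (fun x => c x * f x) <= K * L2n mu D f.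
Proof.
move=> mD mc K0 hc sf; have scf := sqiM mD mc hc sf.
rewrite -{1}(ger0_norm K0) -L2nZ// ler_wsqrtr//; apply: le_Rintegral => //.
- exact: (sqi_mul mD).
- by apply: (sqi_mul mD); exact: sqiZ.
move=> x Dx; rewrite -!expr2 !exprMn ler_wpM2r ?sqr_ge0//.
by rewrite -(real_normK (num_real (c x))) lerXn2r ?nnegrE// hc.
Qed.

(** * Products of L^4 functions with H^1_0 functions *)

Section mul_L4.
Context {R : realType} {n : nat} {Om : set 'rV[R]_n} {m : nat}
  {nrm : 'I_m -> 'rV[R]_n} {off : 'I_m -> R}.
Hypothesis hOm : convex_polytope Om nrm off.
Hypothesis n23 : n = 2%N \/ n = 3%N.
Local Notation X := 'rV[R]_n.
Local Notation mu := (leb R n).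
Implicit Types (f g psi : X -> R) (x v : X) (i j : 'I_n).

Let mD : measurable Om := mOm hOm.
Let n0 : (0 < n)%N. Proof. by case: n23 => ->. Qed.

Lemma L2n_test psi : (forall x, ~ Om x -> psi x = 0) -> L2n mu setT psi = L2n mu Om psi.
Proof.
move=> h; congr Num.sqrt; rewrite [RHS]Rintegral_mkcond; apply: eq_Rintegral => x _.
by rewrite /patch; case: ifPn => //; rewrite notin_setE => /h ->; rewrite mul0r.
Qed.

Lemma test_fun_L4 psi : test_fun Om psi ->
  intg mu Om (fun x => psi x ^+ 4) /\
  \int[mu]_(x in Om) (psi x ^+ 4) <=
  2 * (L2n mu Om psi ^+ 2 + \sum_i L2n mu Om (partial i psi) ^+ 2) ^+ 2.
Proof.
move=> tp; have [sp [K [cK KOm p0]]] := tp.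
have i4 : intg mu Om (fun x => psi x ^+ 4).
  apply: (@supp_intg _ _ _ K Om mD) => //.
    move=> x; apply: (@continuous_comp _ _ _ psi (fun y : R => y ^+ 4)); last exact: exprn_continuous.
    exact: smooth_continuous.
  by move=> x /p0 ->; rewrite expr0n.
split => //; have [B B0 hB] := bounded_setP (bounded_Om hOm).
have tc : test_cube B psi.
  by split => // x nx; apply: p0 => /KOm/hB.
rewrite -(L2n_test (fun x nO => p0 x (fun Kx => nO (KOm _ Kx)))).
rewrite (eq_bigr (fun i => L2n mu setT (partial i psi) ^+ 2)); last first.
  move=> i _; rewrite L2n_test// => x nO; apply: (partial_eq0_compact i cK p0) => /KOm.
  exact: nO.
rewrite -lee_fin (EFin_Rintegral mD i4); apply: le_trans (ladyzhenskaya n23 tc).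
apply: ge0_subset_integral => //.
- apply/measurable_EFinP; apply: measurable_funX; apply: continuous_measurable_rV.
  exact: smooth_continuous.
- by move=> x _; rewrite lee_fin exprn_even_ge0.
Qed.

(* The H^1 bound is transported from the approximating test functions to [u]
   through the truncations [min |f| N], which act boundedly on L^2. *)
Lemma H10_mul_L4 f (u : X -> R) : measurable_fun Om f ->
  intg mu Om (fun x => f x ^+ 4) -> H10 Om u -> sqi mu Om (fun x => f x * u x).
Proof.
move=> mf f4 hu; have [psi tp [c0 c1]] := H10_approx hOm n0 hu.
have hu1 := H10_H1 hu; have su := H1_sqi hu1.
have sp k : smooth (psi k) by have [] := tp k.
(* The approximants and their derivatives are eventually within 1 of their limits in L^2, so [Hm]
   bounds their squared H^1 norms. *)
pose Hm := (1 + L2n mu Om u) ^+ 2 + \sum_i (1 + L2n mu Om (wD Om i u)) ^+ 2.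
have bnd (g : X -> R) (g_ : nat -> X -> R) : sqi mu Om g -> (forall k, sqi mu Om (g_ k)) ->
    (fun k => L2n mu Om (fun x => g_ k x - g x)) @ \oo --> (0 : R) ->
    \forall k \near \oo, L2n mu Om (g_ k) ^+ 2 <= (1 + L2n mu Om g) ^+ 2.
  move=> sg sg_ /cvgr_le/(_ _ ltr01); apply: filterS => k hk.
  rewrite lerXn2r ?nnegrE ?addr_ge0 ?L2n_ge0//.
  have := L2nD mD (sqiB mD (sg_ k) sg) sg.
  rewrite (_ : (fun x => g_ k x - g x + g x) = g_ k); last by apply/funext => x; rewrite subrK.
  by move: hk; move: (L2n _ _ _) (L2n _ _ _) (L2n _ _ _) => a b c; lra.
have bH : \forall k \near \oo, L2n mu Om (psi k) ^+ 2 + \sum_i L2n mu Om (partial i (psi k)) ^+ 2 <= Hm.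
  have b1 := bnd _ _ su (fun k => sqi_smooth hOm (sp k)) c0.
  have b2 : \forall k \near \oo, forall i, L2n mu Om (partial i (psi k)) ^+ 2 <= (1 + L2n mu Om (wD Om i u)) ^+ 2.
    apply: filter_forall => i; apply: bnd (c1 i); first exact: H1_sqi_wD.
    by move=> k; apply: (sqi_smooth hOm); exact: smooth_partial.
  by move: b1 b2; apply: filterS2 => k h1 h2; apply: lerD => //; apply: ler_sum.
(* By [2 a b <= a^2 + b^2] and Ladyzhenskaya's inequality for [psi k], this bounds the integral of
   [(f psi)^2]; it is independent of the truncation level [N]. *)
pose W := 2^-1 * (\int[mu]_(x in Om) (f x ^+ 4) + 2 * Hm ^+ 2).
pose c (N : nat) x := Num.min `|f x| N%:R.
have c_ge0 N x : 0 <= c N x by rewrite /c le_min normr_ge0 ler0n.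
have c_leN N x : `|c N x| <= N%:R by rewrite ger0_norm// /c ge_min lexx orbT.
have c_lef N x : c N x <= `|f x| by rewrite /c ge_min lexx.
have mc N : measurable_fun Om (c N).
  by apply: measurable_minr => //; apply: measurableT_comp.
have scu N : sqi mu Om (fun x => c N x * u x) by exact: (sqiM mD (mc N) (fun x _ => c_leN N x) su).
have key N : \int[mu]_(x in Om) ((c N x * u x) * (c N x * u x)) <= W.
  rewrite -L2n_sq.
  suff : L2n mu Om (fun x => c N x * u x) <= Num.sqrt W.
    have W0 : 0 <= W.
      apply: mulr_ge0 => //; apply: addr_ge0; last by apply: mulr_ge0 => //; exact: sqr_ge0.
      by apply: Rintegral_ge0 => x _; rewrite exprn_even_ge0.
    by move=> h; rewrite -(sqr_sqrtr W0); apply: lerXn2r; rewrite ?nnegrE ?L2n_ge0 ?sqrtr_ge0.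
  have b1 : \forall k \near \oo, L2n mu Om (fun x => c N x * u x) <=
      Num.sqrt W + N%:R * L2n mu Om (fun x => psi k x - u x).
    apply: filterS bH => k hk; have sk := sqi_smooth hOm (sp k).
    have scp := sqiM mD (mc N) (fun x _ => c_leN N x) sk.
    have sB := sqiB mD sk su; have scB := sqiM mD (mc N) (fun x _ => c_leN N x) sB.
    have := L2nD mD scp (sqiZ mD (-1) scB).
    rewrite (L2nZ mD _ scB) normrN normr1 mul1r.
    rewrite (_ : (fun x => c N x * psi k x + -1 * (c N x * (psi k x - u x))) = fun x => c N x * u x); last first.
      by apply/funext => x; ring.
    have h2 := L2n_mul_le mD (mc N) (ler0n _ _) (fun x _ => c_leN N x) sB.
    have h3 : L2n mu Om (fun x => c N x * psi k x) <= Num.sqrt W.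
      rewrite ler_wsqrtr//; have [i4 h4] := test_fun_L4 (tp k).
      have h5 : 2 * (L2n mu Om (psi k) ^+ 2 + \sum_i L2n mu Om (partial i (psi k)) ^+ 2) ^+ 2 <= 2 * Hm ^+ 2.
        have S0 : 0 <= L2n mu Om (psi k) ^+ 2 + \sum_i L2n mu Om (partial i (psi k)) ^+ 2.
          by rewrite addr_ge0 ?sqr_ge0// sumr_ge0// => i _; exact: sqr_ge0.
        by apply: ler_wpM2l => //; apply: lerXn2r; rewrite ?nnegrE// (le_trans S0).
      apply: (@le_trans _ _ (2^-1 * (\int[mu]_(x in Om) (f x ^+ 4) + \int[mu]_(x in Om) (psi k x ^+ 4)))).
        rewrite -RintegralD// -RintegralZl//; last exact: (intgD mD).
        apply: le_Rintegral => //; first exact: (sqi_mul mD).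
          by apply: (intgZ mD); exact: (intgD mD).
        move=> x Ox; have h6 : (c N x) ^+ 2 <= f x ^+ 2.
          by rewrite -(real_normK (num_real (f x))) lerXn2r ?nnegrE.
        rewrite -expr2 exprMn (exprM (f x) 2 2) (exprM (psi k x) 2 2).
        have := sqr_ge0 (c N x); have := sqr_ge0 (psi k x).
        move: (c N x ^+ 2) (f x ^+ 2) (psi k x ^+ 2) h6 => a b d h6 d0 a0.
        have := sqr_ge0 (b - d); have : a * d <= b * d by rewrite ler_wpM2r.
        by rewrite sqrrB !expr2; lra.
      by rewrite ler_wpM2l ?invr_ge0// lerD2l (le_trans h4).
    by move: h2 h3; move: (L2n _ _ _) (L2n _ _ _) (Num.sqrt W) (_ * L2n _ _ _) (L2n _ _ _) => a b w d e; lra.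
  have h : (fun k => Num.sqrt W + N%:R * L2n mu Om (fun x => psi k x - u x)) @ \oo --> Num.sqrt W.
    by rewrite -[X in _ --> X]addr0; apply: cvgD; [exact: cvg_cst|exact: cvg0Z].
  rewrite -(cvg_lim _ h)//.
  by apply: limr_ge => //; apply/cvg_ex; exists (Num.sqrt W); exact: h.
have mu_ : measurable_fun Om u by exact: sqi_meas su.
split; first exact: measurable_funM.
apply/integrableP; split; first by apply/measurable_EFinP; apply: measurable_funX; exact: measurable_funM.
(* The truncations increase to [|f|], so monotone convergence turns the uniform bound [W] into
   integrability. *)
pose g_ N x : \bar R := ((c N x * u x) ^+ 2)%:E.
have mg N : measurable_fun Om (g_ N).
  by apply/measurable_EFinP; apply: measurable_funX; exact: measurable_funM.
have g0 N x : Om x -> (0 <= g_ N x)%E by rewrite lee_fin sqr_ge0.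
have gnd x : Om x -> {homo g_^~ x : N N' / (N <= N')%N >-> (N <= N')%E}.
  move=> _ N N' NN'; rewrite lee_fin !exprMn ler_wpM2r ?sqr_ge0// lerXn2r ?nnegrE//.
  by rewrite /c le_min !ge_min lexx/= ler_nat NN' orbT.
have glim x : limn (g_^~ x) = `|((f x * u x) ^+ 2)%:E|%E.
  apply: lim_near_cst => //; near=> N.
  rewrite /g_ gee0_abs ?lee_fin ?sqr_ge0//; congr EFin; rewrite !exprMn; congr (_ * _).
  rewrite /c min_l ?real_normK ?num_real//; apply: ltW.
  by near: N; exact: nbhs_infty_gtr.
rewrite -(eq_integral _ _ (fun x _ => glim x)) (monotone_convergence _ mD mg g0 gnd).
apply: (@le_lt_trans _ _ W%:E); last exact: ltry.
apply: lime_le; first by apply: ereal_nondecreasing_is_cvgn => N N' NN';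
  apply: ge0_le_integral => // x Ox; [exact: g0|exact: gnd].
apply: nearW => N; have := key N; rewrite -lee_fin (EFin_Rintegral mD); last exact: (sqi_mul mD).
by apply: le_trans; rewrite le_eqVlt; apply/orP; left; apply/eqP; apply: eq_integral => x _; rewrite /g_ expr2.
Unshelve. all: by end_near. Qed.

End mul_L4.

(** * The scheme *)

Section inner_products.
Context {R : realType} {n : nat} {Om : set 'rV[R]_n} {m : nat}
  {nrm : 'I_m -> 'rV[R]_n} {off : 'I_m -> R}.
Hypothesis hOm : convex_polytope Om nrm off.
Hypothesis n0 : (0 < n)%N.
Local Notation X := 'rV[R]_n.
Local Notation mu := (leb R n).
Implicit Types (f g h v : X -> R) (x : X) (i j : 'I_n).

Let mD : measurable Om := mOm hOm.

Lemma ipC f g : ip Om f g = ip Om g f.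
Proof. by apply: eq_Rintegral => x _; rewrite mulrC. Qed.

Lemma ipDl f g h : sqi mu Om f -> sqi mu Om g -> sqi mu Om h ->
  ip Om (fun x => f x + g x) h = ip Om f h + ip Om g h.
Proof.
move=> sf sg sh; rewrite /ip -RintegralD//; [|exact: (sqi_mul mD)|exact: (sqi_mul mD)].
by apply: eq_Rintegral => x _; rewrite mulrDl.
Qed.

Lemma ip0l f : ip Om (fun=> 0) f = 0.
Proof.
rewrite /ip (_ : (fun x => 0 * f x) = cst 0); last by apply/funext => x; rewrite mul0r.
by rewrite Rintegral_cst// mul0r.
Qed.

(** Integrability is assumed of the scaled product alone. For [c = 0] both sides are 0 whatever
    [f * g] is; otherwise one divides by [c]. The scheme uses it with [c] equal to [xi], which may
    vanish. *)
Lemma ip_scale (c : R) f g : intg mu Om (fun x => (c * f x) * g x) ->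
  ip Om (fun x => c * f x) g = c * ip Om f g.
Proof.
move=> hi; have [->|c0] := eqVneq c 0.
  by rewrite mul0r (_ : (fun x => 0 * f x) = fun=> 0) ?ip0l//; apply/funext => x; rewrite mul0r.
rewrite /ip -RintegralZl//; first by apply: eq_Rintegral => x _; rewrite mulrA.
apply: (@eq_intg _ _ _ mu Om mD (fun x => c^-1 * ((c * f x) * g x))); last exact: (intgZ mD).
by move=> x _; rewrite !mulrA mulVf// mul1r.
Qed.

Lemma ipZl (c : R) f g : sqi mu Om f -> sqi mu Om g ->
  ip Om (fun x => c * f x) g = c * ip Om f g.
Proof. by move=> sf sg; apply: ip_scale; apply: (sqi_mul mD) => //; exact: (sqiZ mD). Qed.

Lemma ipBl f g h : sqi mu Om f -> sqi mu Om g -> sqi mu Om h ->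
  ip Om (fun x => f x - g x) h = ip Om f h - ip Om g h.
Proof.
move=> sf sg sh; rewrite (_ : (fun x => f x - g x) = fun x => f x + (-1) * g x).
  by rewrite ipDl ?ipZl ?mulN1r//; exact: (sqiZ mD).
by apply/funext => x; rewrite mulN1r.
Qed.

Lemma ip_ae f g h : measurable_fun Om f -> measurable_fun Om g -> measurable_fun Om h ->
  ae_eq_in Om f g -> ip Om f h = ip Om g h.
Proof.
move=> mf mg mh e; apply: (ae_eq_Rintegral mD); [exact: measurable_funM|exact: measurable_funM|].
by apply: filterS e => x hx Ox; rewrite hx.
Qed.

Lemma ip_suml (I : Type) (s : seq I) (f : I -> X -> R) g :
  (forall k, sqi mu Om (f k)) -> sqi mu Om g ->
  ip Om (fun x => \sum_(k <- s) f k x) g = \sum_(k <- s) ip Om (f k) g.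
Proof.
move=> sf sg; rewrite /ip -(Rintegral_sum mD); last by move=> k; exact: (sqi_mul mD).
by apply: eq_Rintegral => x _; rewrite mulr_suml.
Qed.

Lemma ip_le f g : sqi mu Om f -> sqi mu Om g -> ip Om f g <= 2^-1 * (ip Om f f + ip Om g g).
Proof.
move=> sf sg; have sB := sqiB mD sf sg.
have : 0 <= ip Om (fun x => f x - g x) (fun x => f x - g x) by exact: sqi_int_ge0.
rewrite ipBl// (ipC f) (ipC g) !ipBl// (ipC g f).
by move: (ip _ f f) (ip _ f g) (ip _ g g) => a b c; lra.
Qed.

Lemma mxip_sum k k' (u v : X -> 'M[R]_(k, k')) :
  (forall (a : 'I_k) (b : 'I_k'), intg mu Om (fun x => u x a b * v x a b)) ->
  mxip Om u v = \sum_a \sum_b ip Om (fun x => u x a b) (fun x => v x a b).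
Proof.
move=> h; rewrite /mxip /dotmx (Rintegral_sum mD).
  by apply: eq_bigr => a _; rewrite (Rintegral_sum mD).
by move=> a; apply: (intg_sum mD).
Qed.

Lemma mxip_vec (u v : X -> X) :
  (forall i, intg mu Om (fun x => u x 0 i * v x 0 i)) ->
  mxip Om u v = \sum_i ip Om (vcomp u i) (vcomp v i).
Proof. by move=> h; rewrite mxip_sum ?big_ord1// => a b; rewrite ord1. Qed.

(** Serves [H2B]: the chosen derivative of a difference is the difference of the chosen derivatives
    only almost everywhere, yet it has to be in H^1 again. *)
Lemma H1_ae f g : H1 Om f -> measurable_fun Om g -> ae_eq_in Om f g -> H1 Om g.
Proof.
move=> hf mg e; apply: (H1_intro hOm n0); first exact: (ae_eq_sqi mD mg e (H1_sqi hf)).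
move=> i; exists (wD Om i f); last exact: H1_sqi_wD.
exact: (wp_ae hOm mg e (H1_wp i hf)).
Qed.

Lemma H2_H1 f : H2 Om f -> H1 Om f. Proof. by move=> h; exact: h.1. Qed.

Lemma H2_wD f i : H2 Om f -> H1 Om (wD Om i f). Proof. by move=> h; exact: h.2. Qed.

Lemma H2B f g : H2 Om f -> H2 Om g -> H2 Om (fun x => f x - g x).
Proof.
move=> [hf hf'] [hg hg']; have hB := H1B hOm n0 hf hg; split; [exact: hB|move=> i].
apply: (H1_ae (H1B hOm n0 (hf' i) (hg' i))); first exact: sqi_meas (H1_sqi_wD i hB).
apply: filterS (wDB_ae hOm n0 i hf hg) => x hx Ox.
by rewrite hx.
Qed.

Lemma sqi_lap f : H2 Om f -> sqi mu Om (lap Om f).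
Proof. by move=> hf; apply: (sqi_sum mD) => i; apply: H1_sqi_wD; exact: H2_wD. Qed.

Lemma green_neumann f v : H2 Om f -> neumann0 Om nrm off f -> H1 Om v ->
  ip Om v (lap Om f) = - \sum_i ip Om (wD Om i v) (wD Om i f).
Proof.
move=> hf nf hv; have hw i := H2_wD i hf.
have fl l : exists2 C : R, 0 <= C & forall tau, 0 < tau -> tau <= 1 ->
    L2n mu (strip (Om := Om) (nrm := nrm) (off := off) l tau) (flux (nrm := nrm) (fun i => wD Om i f) l) <= C * tau.
  have [g [hg g0]] := nf l; exact: (hardy hOm n0 hw hg g0).
(* A trace comes with a smooth H^1 approximation over all of [Om]; the one attached to the first
   face is as good as any for [green]. *)
have ap i : exists psi : nat -> X -> R, (forall k, smooth (psi k)) /\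
    (fun k => H1norm Om (fun x => psi k x - wD Om i f x)) @ \oo --> (0 : R).
  have [g [hg _]] := nf (Ordinal (m_gt0 hOm n0)).
  by have [_ [psi [h1 h2 _]]] := hg i; exists psi.
have := green hOm n0 hw ap fl hv.
have i1 i : intg mu Om (fun x => v x * wD Om i (wD Om i f) x).
  by apply: (sqi_mul mD); [exact: H1_sqi|exact: H1_sqi_wD].
have i2 i : intg mu Om (fun x => wD Om i v x * wD Om i f x).
  by apply: (sqi_mul mD); [exact: H1_sqi_wD|exact: (H1_sqi_wD i (H2_H1 hf))].
rewrite (Rintegral_sum mD); last by move=> i; exact: (intgD mD).
rewrite (eq_bigr (fun i => ip Om v (wD Om i (wD Om i f)) + ip Om (wD Om i v) (wD Om i f))); last first.
  by move=> i _; rewrite RintegralD//; [exact: i1|exact: i2].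
rewrite big_split/= => /eqP; rewrite addr_eq0 => /eqP <-.
rewrite ipC ip_suml; first by apply: eq_bigr => i _; rewrite ipC.
  by move=> i; exact: H1_sqi_wD.
exact: H1_sqi.
Qed.

Lemma green_dirichlet f v : H2 Om f -> H10 Om v ->
  ip Om (lap Om f) v = - \sum_i ip Om (wD Om i f) (wD Om i v).
Proof.
move=> hf hv; rewrite ip_suml; last 2 first.
- by move=> i; apply: H1_sqi_wD; exact: H2_wD.
- exact: H1_sqi (H10_H1 hv).
rewrite -sumrN; apply: eq_bigr => i _.
by rewrite /ip (H10_ibp hOm n0 i (H2_wD i hf) hv) opprK.
Qed.

Lemma ip_divergence_free (U : X -> X) f : H2_H10 Om U ->
  ae_eq_in Om (diverg Om U) (cst 0) -> H1 Om f ->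
  \sum_i ip Om (wD Om i f) (vcomp U i) = 0.
Proof.
move=> hU dU hf; have sU i : sqi mu Om (wD Om i (vcomp U i)).
  by apply: H1_sqi_wD; exact: H10_H1 (hU i).2.
have : ip Om (diverg Om U) f = ip Om (cst 0) f.
  by apply: ip_ae dU => //; [exact: sqi_meas (sqi_sum mD _ sU)|exact: sqi_meas (H1_sqi hf)].
rewrite ip0l ip_suml//; last exact: H1_sqi.
move=> e; rewrite (eq_bigr (fun i => - ip Om (wD Om i (vcomp U i)) f)); first by rewrite sumrN e oppr0.
by move=> i _; rewrite (ipC (wD _ _ (vcomp _ _))) /ip (H10_ibp hOm n0 i hf (hU i).2) opprK.
Qed.

End inner_products.

(** * Transport term and double-well potential *)

Section scheme_terms.
Context {R : realType} {n : nat} {Om : set 'rV[R]_n} {m : nat}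
  {nrm : 'I_m -> 'rV[R]_n} {off : 'I_m -> R}.
Hypothesis hOm : convex_polytope Om nrm off.
Hypothesis n0 : (0 < n)%N.
Local Notation X := 'rV[R]_n.
Local Notation mu := (leb R n).
Implicit Types (f g v : X -> R) (U : X -> X) (x : X) (i j : 'I_n).

Let mD : measurable Om := mOm hOm.

Lemma diverg_scaleE f U : diverg Om (fun x => f x *: U x) =
  fun x => \sum_i wD Om i (fun y => f y * vcomp U i y) x.
Proof.
apply/funext => x; apply: eq_bigr => i _; congr (wD Om i _ x).
by apply/funext => y; rewrite /vcomp mxE.
Qed.

Lemma intg_wD_mul f v i : H1 Om f -> H10 Om v -> intg mu Om (wD Om i (fun y => f y * v y)).
Proof.
move=> hf hv; have wp := H1_mul_H10_wp hOm n0 i hf hv.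
apply: (ae_eq_intg mD (f := fun x => f x * wD Om i v x + wD Om i f x * v x)).
- by have [_ [] ] := wD_spec (ex_intro _ _ wp).
- by apply: filterS (wD_ae hOm n0 wp) => x hx Ox; rewrite hx.
apply: (intgD mD); apply: (sqi_mul mD).
- exact: H1_sqi.
- exact: H1_sqi_wD (H10_H1 hv).
- exact: H1_sqi_wD.
- exact: H1_sqi (H10_H1 hv).
Qed.

Lemma intg_diverg_scale f U : H1 Om f -> H2_H10 Om U ->
  intg mu Om (diverg Om (fun x => f x *: U x)).
Proof.
move=> hf hU; rewrite diverg_scaleE; apply: (intg_sum mD) => i.
exact: intg_wD_mul hf (hU i).2.
Qed.

Lemma int_diverg_scale f U : H1 Om f -> H2_H10 Om U ->
  \int[mu]_(x in Om) diverg Om (fun x => f x *: U x) x = 0.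
Proof.
move=> hf hU; rewrite diverg_scaleE (Rintegral_sum mD); last first.
  by move=> i; exact: intg_wD_mul hf (hU i).2.
by apply: big1 => i _; exact: (int_H1_mul_H10 hOm n0 i hf (hU i).2).
Qed.

Variables (eps beta : R).

Lemma derive1_Fpot (s : R) :
  derive1 (Fpot eps beta) s = (eps ^+ 2)^-1 * (s ^+ 3 - s) - beta * s.
Proof.
rewrite derive1E; suff : is_derive (s : R) (1 : R) (Fpot eps beta : R -> R)
    ((eps ^+ 2)^-1 * (s ^+ 3 - s) - beta * s) by move=> h; rewrite derive_val.
rewrite (_ : Fpot eps beta =
  (fun t => (4 * eps ^+ 2)^-1 * (1 - t ^+ 2) ^+ 2 - beta / 2 * t ^+ 2)); last by [].
apply: is_derive_eq; rewrite /GRing.scale/= invfM.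
by move: ((eps ^+ 2)^-1) => e; field.
Qed.

Lemma measurable_dF f : measurable_fun Om f -> measurable_fun Om (dF eps beta f).
Proof.
move=> mf; rewrite (_ : dF eps beta f = fun x => (eps ^+ 2)^-1 * (f x ^+ 3 - f x) - beta * f x).
  apply: measurable_funB; apply: measurable_funM => //.
  by apply: measurable_funB => //; exact: measurable_funX.
by apply/funext => x; rewrite /dF derive1_Fpot.
Qed.

Lemma dF_intg_pow4 f : 0 < eps -> sqi mu Om f -> sqi mu Om (dF eps beta f) ->
  intg mu Om (fun x => f x ^+ 4).
Proof.
move=> e0 sf sF; have s3 : sqi mu Om (fun x => eps ^+ 2 * (dF eps beta f x + beta * f x) + f x).
  by apply: (sqiD mD) => //; apply: (sqiZ mD); apply: (sqiD mD) => //; exact: (sqiZ mD).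
have := sqi_mul mD s3 sf; rewrite (_ : (fun x => _ * f x) = fun x => f x ^+ 4)//.
apply/funext => x; rewrite /dF derive1_Fpot subrK mulrA mulfV ?expf_neq0 ?gt_eqF// mul1r subrK.
by rewrite -exprSr.
Qed.

End scheme_terms.

(** * One time step: tested equations and energy balance *)

Section one_step.
Context {R : realType} {d : nat} {Om : set 'rV[R]_d} {m : nat}
  {nrm : 'I_m -> 'rV[R]_d} {off : 'I_m -> R}.
Hypothesis hOm : convex_polytope Om nrm off.
Hypothesis d23 : d = 2%N \/ d = 3%N.
Local Notation X := 'rV[R]_d.
Local Notation mu := (leb R d).
Context {M lam nu eps beta theta delta0 tau : R}.
Hypotheses (lam0 : 0 < lam) (eps0 : 0 < eps) (tau0 : 0 < tau).
Context {phi muc p : nat -> X -> R} {u uh : nat -> X -> X} {r : nat -> R} {n : nat}.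
Hypotheses (adm0 : admissible Om nrm off phi muc p u n)
  (adm1 : admissible Om nrm off phi muc p u n.+1) (hH : H2_H10 Om (uh n.+1)).
Hypothesis st1 : step1 Om M lam nu eps beta theta delta0 tau phi muc p u uh r n.
Hypothesis E1_gt0 : 0 < E1 Om eps beta (phi n) + delta0.

Let mD : measurable Om := mOm hOm.
Let d0 : (0 < d)%N. Proof. by case: d23 => ->. Qed.
Local Notation P := (phi n).
Local Notation P1 := (phi n.+1).
Local Notation q := (muc n.+1).
Local Notation U i := (vcomp (u n) i).
Local Notation U1 i := (vcomp (u n.+1) i).
Local Notation H i := (vcomp (uh n.+1) i).
Local Notation ksi := (xi Om eps beta delta0 phi r n).
Local Notation Dv := (divuphi Om phi u n).
Local Notation F' := (dF eps beta P).
Local Notation delta := (dtau tau phi n).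
Local Notation g := (gam Om theta p n).
Local Notation adv := (advect Om (u n) (u n)).
Local Notation pgm := (phigradmu Om phi muc n).

Let hP : H2 Om P. Proof. by case: adm0 => -[]. Qed.
Let hP1 : H2 Om P1. Proof. by case: adm1 => -[]. Qed.
Let hq0 : H2 Om (muc n). Proof. by case: adm0 => _ []. Qed.
Let hq : H2 Om q. Proof. by case: adm1 => _ []. Qed.
Let hU : H2_H10 Om (u n). Proof. by case: adm0. Qed.
Let hU1 : H2_H10 Om (u n.+1). Proof. by case: adm1. Qed.
Let hp0 : H1 Om (p n). Proof. by case: adm0. Qed.
Let hp1 : H1 Om (p n.+1). Proof. by case: adm1. Qed.
Let sP := H1_sqi (H2_H1 hP).
Let sP1 := H1_sqi (H2_H1 hP1).
Let sq := H1_sqi (H2_H1 hq).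
Let sU i : sqi mu Om (U i). Proof. exact: H1_sqi (H2_H1 (hU i).1). Qed.
Let sU1 i : sqi mu Om (U1 i). Proof. exact: H1_sqi (H2_H1 (hU1 i).1). Qed.
Let sH i : sqi mu Om (H i). Proof. exact: H1_sqi (H2_H1 (hH i).1). Qed.

Let deltaE : delta = fun x => tau^-1 * (P1 x - P x).
Proof. by apply/funext => x; rewrite mulrC. Qed.

Let hdelta : H1 Om delta.
Proof. by rewrite deltaE; apply: (H1Z hOm d0); apply: (H1B hOm d0); exact: H2_H1. Qed.

Let sdelta := H1_sqi hdelta.

Let wdelta i : ae_eq_in Om (wD Om i delta) (fun x => tau^-1 * (wD Om i P1 x - wD Om i P x)).
Proof.
rewrite deltaE; have hB := H1B hOm d0 (H2_H1 hP1) (H2_H1 hP).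
apply: filterS2 (wDZ_ae hOm d0 i tau^-1 hB) (wDB_ae hOm d0 i (H2_H1 hP1) (H2_H1 hP)) => x h1 h2 Ox.
by rewrite h1// h2.
Qed.

Let intg_Dv : intg mu Om Dv.
Proof. exact: (intg_diverg_scale hOm d0 (H2_H1 hP) hU). Qed.

Let eq1 : ae_eq_in Om (fun x => ksi * Dv x) (fun x => M * lap Om q x - delta x).
Proof. by case: st1 => e _ _; apply: filterS e => x h Ox; rewrite -h// addrAC subrr add0r. Qed.

(** The divergence itself is only known to be integrable; times [xi] it equals
    [M * lap Om q - delta] by the phase equation. This permits testing with [q]. *)
Let s_xiDv : sqi mu Om (fun x => ksi * Dv x).
Proof.
have mDv := intg_meas intg_Dv.
apply: (ae_eq_sqi mD (f := fun x => M * lap Om q x - delta x)).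
- exact: measurable_funM.
- by apply: filterS eq1 => x h Ox; rewrite h.
by apply: (sqiB mD) => //; apply: (sqiZ mD); exact: (sqi_lap hOm).
Qed.

(** The diffusion term integrates to 0 by Green's formula against a constant, the transport term
    because [u n] vanishes on the boundary. *)
Lemma mass_step : ip Om P1 (cst 1) = ip Om P (cst 1).
Proof.
have s1 := sqi_cst hOm 1 : sqi mu Om (cst 1).
have h1 : H1 Om (cst 1) by apply: (H1_smooth hOm d0); exact: smooth_cst.
have nq : neumann0 Om nrm off q by case: adm1 => _ [].
have e : ip Om (fun x => M * lap Om q x - delta x) (cst 1) = 0.
  rewrite -(ip_ae hOm (sqi_meas s_xiDv) _ (sqi_meas s1) eq1); last first.
    by apply: sqi_meas (sqiB mD (sqiZ mD M (sqi_lap hOm hq)) sdelta).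
  rewrite (ip_scale hOm); last exact: (sqi_mul mD).
  rewrite /ip (_ : (fun x => Dv x * cst 1 x) = Dv); last by apply/funext => x; rewrite mulr1.
  by rewrite (int_diverg_scale hOm d0 (H2_H1 hP) hU) mulr0.
have sl := sqi_lap hOm hq.
move: e; rewrite (ipBl hOm (sqiZ mD M sl) sdelta s1) (ipZl hOm _ sl s1) (ipC (lap Om q)).
rewrite (green_neumann hOm d0 hq nq h1) big1 ?oppr0 ?mulr0 ?sub0r; last first.
  move=> i _; rewrite (@ip_ae _ _ _ _ _ _ hOm _ (cst 0)) ?(ip0l hOm)//.
  - exact: sqi_meas (H1_sqi_wD i h1).
  - exact: sqi_meas (H1_sqi_wD i (H2_H1 hq)).
  - have := wD_ae hOm d0 (smooth_wp hOm i (smooth_cst 1)).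
    by apply: filterS => x h Ox; rewrite h// /partial derive_cst.
rewrite deltaE (ipZl hOm _ (sqiB mD sP1 sP) s1) (ipBl hOm sP1 sP s1) => /eqP.
by rewrite oppr_eq0 mulf_eq0 invr_eq0 gt_eqF//= subr_eq0 => /eqP.
Qed.

Lemma potential_step : ip Om q delta + ksi * ip Om q Dv = - (M * \sum_i ip Om (wD Om i q) (wD Om i q)).
Proof.
have nq : neumann0 Om nrm off q by case: adm1 => _ [].
have sl := sqi_lap hOm hq.
rewrite (ipC q Dv) -(ip_scale hOm); last exact: (sqi_mul mD).
rewrite (ip_ae hOm (sqi_meas s_xiDv) (sqi_meas (sqiB mD (sqiZ mD M sl) sdelta)) (sqi_meas sq) eq1).
rewrite (ipBl hOm (sqiZ mD M sl) sdelta sq) (ipZl hOm _ sl sq) !(ipC _ q).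
by rewrite (green_neumann hOm d0 hq nq (H2_H1 hq)) addrC subrK mulrN.
Qed.

Let mF : measurable_fun Om F'.
Proof. by apply: measurable_dF; exact: sqi_meas sP. Qed.

(** The same device for the potential: [F'] is cubic in [phi n], but the equation of [q] expresses
    [xi * F'] by L^2 terms. *)
Let s_xiF : sqi mu Om (fun x => ksi * F' x).
Proof.
have sl := sqi_lap hOm hP1.
apply: (ae_eq_sqi mD (f := fun x => lam^-1 * (q x + lam * lap Om P1 x - lam * beta * P1 x))).
- exact: measurable_funM.
- case: st1 => _ e _; apply: filterS e => x h Ox; rewrite h//.
  by field; rewrite gt_eqF.
apply: (sqiZ mD); apply: (sqiB mD); last exact: (sqiZ mD).
by apply: (sqiD mD) => //; exact: (sqiZ mD).
Qed.

(** The mixed products of old and new values are kept here; [energy_step] estimates them. *)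
Lemma chemical_step : tau * ip Om q delta =
  lam * (\sum_i ip Om (wD Om i P1) (wD Om i P1) - \sum_i ip Om (wD Om i P) (wD Om i P1)) +
  lam * beta * (ip Om P1 P1 - ip Om P P1) + tau * (lam * ksi * ip Om F' delta).
Proof.
have sl := sqi_lap hOm hP1.
have sB := sqiB mD sP1 sP.
have nP1 : neumann0 Om nrm off P1 by case: adm1 => -[].
have e2 : ae_eq_in Om q (fun x => (- lam * lap Om P1 x + lam * beta * P1 x) + lam * (ksi * F' x)).
  by case: st1 => _ e _; apply: filterS e => x h Ox; rewrite h// mulrA.
have s12 := sqiD mD (sqiZ mD (- lam) sl) (sqiZ mD (lam * beta) sP1).
rewrite (ip_ae hOm (sqi_meas sq) _ (sqi_meas sdelta) e2); last first.
  exact: sqi_meas (sqiD mD s12 (sqiZ mD lam s_xiF)).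
rewrite (ipDl hOm s12 (sqiZ mD lam s_xiF) sdelta) (ipZl hOm _ s_xiF sdelta).
rewrite (ip_scale hOm (sqi_mul mD s_xiF sdelta)).
rewrite (ipDl hOm (sqiZ mD _ sl) (sqiZ mD _ sP1) sdelta) (ipZl hOm _ sl sdelta) (ipZl hOm _ sP1 sdelta).
have -> : ip Om P1 delta = tau^-1 * (ip Om P1 P1 - ip Om P P1).
  by rewrite ipC deltaE (ipZl hOm _ sB sP1) (ipBl hOm sP1 sP sP1).
have -> : ip Om (lap Om P1) delta =
    - (tau^-1 * (\sum_i ip Om (wD Om i P1) (wD Om i P1) - \sum_i ip Om (wD Om i P) (wD Om i P1))).
  rewrite ipC (green_neumann hOm d0 hP1 nP1 hdelta) -sumrB mulr_sumr; congr (- _).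
  apply: eq_bigr => i _; have sw1 := H1_sqi_wD i (H2_H1 hP1); have sw := H1_sqi_wD i (H2_H1 hP).
  rewrite (ip_ae hOm _ _ (sqi_meas sw1) (wdelta i)).
  - by rewrite (ipZl hOm _ (sqiB mD sw1 sw) sw1) (ipBl hOm sw1 sw sw1).
  - exact: sqi_meas (H1_sqi_wD i hdelta).
  - exact: sqi_meas (sqiZ mD _ (sqiB mD sw1 sw)).
move: (ip Om P1 P1 - _) (\sum_i _ - _) (ip Om F' delta) => a b c.
by field; rewrite gt_eqF.
Qed.

Let adv_intg i : intg mu Om (fun x => adv x 0 i).
Proof.
rewrite (_ : (fun x => _) = fun x => \sum_j U j x * wD Om j (U i) x); last first.
  by apply/funext => x; rewrite mxE.
apply: (intg_sum mD) => j; apply: (sqi_mul mD) => //.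
by apply: H1_sqi_wD; exact: H2_H1 (hU i).1.
Qed.

Let pgmE i : (fun x => pgm x 0 i) = fun x => P x * wD Om i (muc n) x.
Proof. by apply/funext => x; rewrite !mxE. Qed.

Let pgm_intg i : intg mu Om (fun x => pgm x 0 i).
Proof. by rewrite pgmE; apply: (sqi_mul mD) => //; apply: H1_sqi_wD; exact: H2_H1. Qed.

Let gradE f i : vcomp (grad Om f) i = wD Om i f.
Proof. by apply/funext => x; rewrite /vcomp mxE. Qed.

(** [Z] holds the convective and capillary terms, made of products of two L^2 functions and so a
    priori only in L^1; [S] is the rest of the momentum equation, all of it in L^2. As both agree
    almost everywhere, [Z] may be tested with the predicted velocity. *)
Let Z i x := ksi * (adv x 0 i + pgm x 0 i).
Let S i x := - tau^-1 * (H i x - U i x) + nu * lap Om (H i) x + - (ksi * g) * wD Om i (p n) x.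

Let sS i : sqi mu Om (S i).
Proof.
apply: (sqiD mD); last by apply: (sqiZ mD); exact: H1_sqi_wD.
by apply: (sqiD mD); apply: (sqiZ mD); [exact: (sqiB mD)|exact: (sqi_lap hOm (hH i).1)].
Qed.

Let mZ i : measurable_fun Om (Z i).
Proof. by apply: intg_meas; apply: (intgZ mD); exact: (intgD mD). Qed.

Let ZS i : ae_eq_in Om (S i) (Z i).
Proof.
case: st1 => _ _ e; apply: filterS e => x /[apply] /(congr1 (fun v : X => v 0 i)).
rewrite !mxE /S /Z !mxE /vcomp => h.
have -> a b c e w : - a * b + c + - (ksi * g) * e = w <-> a * b - c = - w - ksi * g * e by split; lra.
by move: h; lra.
Qed.

Let sZ i : sqi mu Om (Z i).
Proof. exact: (ae_eq_sqi mD (mZ i) (ZS i) (sS i)). Qed.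

(* [Rintegral] of a non-integrable function is a junk value, so the two terms can
   only be separated once each of them is known to be integrable. *)
Let ipZ : ksi * (mxip Om (uh n.+1) pgm + mxip Om adv (uh n.+1)) = \sum_i ip Om (Z i) (H i).
Proof.
(* With [ksi = 0] both sides are 0, whatever the integrability of the two brackets. *)
have [k0|k0] := eqVneq ksi 0.
  rewrite k0 mul0r big1// => i _; rewrite /Z k0 -[RHS](ip0l hOm (H i)); congr (ip _ _ _).
  by apply/funext => x; rewrite mul0r.
have sF : sqi mu Om F'.
  have := sqiZ mD ksi^-1 s_xiF; rewrite (_ : (fun x => _ * _) = F')//.
  by apply/funext => x; rewrite mulrA mulVf// mul1r.
have f4 := dF_intg_pow4 hOm eps0 sP sF.
have iG i : intg mu Om (fun x => pgm x 0 i * H i x).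
  have sPH := H10_mul_L4 hOm d23 (sqi_meas sP) f4 (hH i).2.
  have := sqi_mul mD sPH (H1_sqi_wD i (H2_H1 hq0)); apply: eq_intg => // x _.
  by rewrite !mxE mulrAC.
(* The convective term is not estimated directly: it is [ksi^-1 * Z i] minus the capillary term, and
   both are integrable against [H i]. *)
have iA i : intg mu Om (fun x => adv x 0 i * H i x).
  have := intgB mD (intgZ mD ksi^-1 (sqi_mul mD (sZ i) (sH i))) (iG i); apply: eq_intg => // x _.
  by rewrite /Z; field.
rewrite (mxip_vec hOm); last first.
  by move=> i; have := iG i; apply: eq_intg => // x _; rewrite mulrC.
rewrite (mxip_vec hOm); last by move=> i; exact: iA.
rewrite -big_split mulr_sumr; apply: eq_bigr => i _ /=.
rewrite (ip_scale hOm (sqi_mul mD (sZ i) (sH i))); congr (_ * _).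
rewrite ipC /ip addrC -RintegralD//; [|exact: iA|exact: iG].
by apply: eq_Rintegral => x _; rewrite mulrDl.
Qed.

Lemma momentum_step : tau * (ksi * (mxip Om (uh n.+1) pgm + mxip Om adv (uh n.+1))) =
  - (\sum_i ip Om (H i) (H i) - \sum_i ip Om (U i) (H i))
  - tau * nu * \sum_i \sum_j ip Om (wD Om j (H i)) (wD Om j (H i))
  - tau * (ksi * g * mxip Om (grad Om (p n)) (uh n.+1)).
Proof.
rewrite ipZ (mxip_vec hOm); last first.
  move=> i; have := sqi_mul mD (H1_sqi_wD i hp0) (sH i); apply: eq_intg => // x _.
  by rewrite mxE.
rewrite -sumrB !mulr_sumr -!sumrN -!big_split; apply: eq_bigr => i _ /=.
have sl := sqi_lap hOm (hH i).1; have sw := H1_sqi_wD i hp0; have sB := sqiB mD (sH i) (sU i).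
rewrite gradE -(ip_ae hOm (sqi_meas (sS i)) (mZ i) (sqi_meas (sH i)) (ZS i)).
rewrite (ipDl hOm (sqiD mD (sqiZ mD _ sB) (sqiZ mD _ sl)) (sqiZ mD _ sw) (sH i)).
rewrite (ipDl hOm (sqiZ mD _ sB) (sqiZ mD _ sl) (sH i)) (ipZl hOm _ sB (sH i)).
rewrite (ipZl hOm _ sl (sH i)) (ipZl hOm _ sw (sH i)) (ipBl hOm (sH i) (sU i) (sH i)).
rewrite (green_dirichlet hOm d0 (hH i).1 (hH i).2).
by field; rewrite gt_eqF.
Qed.

Lemma projection_step : step3 Om nu theta tau p u uh n ->
  (\sum_i ip Om (U1 i) (U1 i) - \sum_i ip Om (H i) (U1 i)) +
  tau * nu * (\sum_i \sum_j ip Om (wD Om j (U1 i)) (wD Om j (U1 i))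
              - \sum_i \sum_j ip Om (wD Om j (H i)) (wD Om j (U1 i))) = 0.
Proof.
move=> st3; have [W WE] : {W | W = fun i x => U1 i x - H i x} by eexists.
have hW i : H2 Om (W i) by rewrite WE; exact: (H2B hOm d0 (hU1 i).1 (hH i).1).
have sW i : sqi mu Om (W i) by exact: (H1_sqi (H2_H1 (hW i))).
have e i : ae_eq_in Om (fun x => tau^-1 * W i x + - nu * lap Om (W i) x + wD Om i (p n.+1) x)
    (fun x => g * wD Om i (p n) x).
  apply: filterS st3 => x /[apply] /(congr1 (fun v : X => v 0 i)).
  have wE : vcomp (fun y => u n.+1 y - uh n.+1 y) i = W i.
    by rewrite WE; apply/funext => y; rewrite /vcomp !mxE.
  have wx : W i x = u n.+1 x 0 i - uh n.+1 x 0 i by rewrite WE.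
  by rewrite !mxE wE mulNr wx => h; exact: h.
have dU1 : ae_eq_in Om (diverg Om (u n.+1)) (cst 0) by case: adm1.
have z0 := ip_divergence_free hOm d0 hU1 dU1 hp0.
have z1 := ip_divergence_free hOm d0 hU1 dU1 hp1.
have hs i : \sum_j ip Om (wD Om j (W i)) (wD Om j (U1 i)) =
    \sum_j ip Om (wD Om j (U1 i)) (wD Om j (U1 i)) - \sum_j ip Om (wD Om j (H i)) (wD Om j (U1 i)).
  rewrite -sumrB; apply: eq_bigr => j _; have h1 := H2_H1 (hU1 i).1; have h2 := H2_H1 (hH i).1.
  rewrite (@ip_ae _ _ _ _ _ _ hOm _ (fun x => wD Om j (U1 i) x - wD Om j (H i) x)).
  - by rewrite (ipBl hOm (H1_sqi_wD j h1) (H1_sqi_wD j h2) (H1_sqi_wD j h1)).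
  - exact: sqi_meas (H1_sqi_wD j (H2_H1 (hW i))).
  - exact: sqi_meas (sqiB mD (H1_sqi_wD j h1) (H1_sqi_wD j h2)).
  - exact: sqi_meas (H1_sqi_wD j h1).
  - by rewrite WE; exact: (wDB_ae hOm d0 j h1 h2).
have h i : tau^-1 * (ip Om (U1 i) (U1 i) - ip Om (H i) (U1 i)) +
    nu * (\sum_j ip Om (wD Om j (U1 i)) (wD Om j (U1 i)) - \sum_j ip Om (wD Om j (H i)) (wD Om j (U1 i))) =
    g * ip Om (wD Om i (p n)) (U1 i) - ip Om (wD Om i (p n.+1)) (U1 i).
  have sl := sqi_lap hOm (hW i); have sw0 := H1_sqi_wD i hp0; have sw1 := H1_sqi_wD i hp1.
  have s1 := sqiZ mD tau^-1 (sW i); have s2 := sqiZ mD (- nu) sl; have s := sU1 i.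
  have := ip_ae hOm (sqi_meas (sqiD mD (sqiD mD s1 s2) sw1)) (sqi_meas (sqiZ mD g sw0)) (sqi_meas s) (e i).
  rewrite (ipDl hOm (sqiD mD s1 s2) sw1 s) (ipDl hOm s1 s2 s) (ipZl hOm _ (sW i) s) (ipZl hOm _ sl s).
  rewrite (ipZl hOm _ sw0 s) (_ : ip Om (W i) (U1 i) = ip Om (U1 i) (U1 i) - ip Om (H i) (U1 i)); last first.
    by rewrite WE (ipBl hOm s (sH i) s).
  rewrite (green_dirichlet hOm d0 (hW i) (hU1 i).2).
  have alg (t v a b b' k e1 e2 : R) : t * a + - v * - b + e1 = k * e2 -> b = b' ->
      t * a + v * b' = k * e2 - e1 by move=> <- <-; ring.
  by move=> h; exact: (alg _ _ _ _ _ _ _ _ h (hs i)).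
have alg (k : R) (a b c e' z z' : 'I_d -> R) :
    (forall i, tau^-1 * (a i - b i) + nu * (c i - e' i) = k * z i - z' i) ->
    \sum_i z i = 0 -> \sum_i z' i = 0 ->
    (\sum_i a i - \sum_i b i) + tau * nu * (\sum_i c i - \sum_i e' i) = 0.
  move=> e1 e2 e3; rewrite -!sumrB mulr_sumr -big_split /=.
  rewrite (eq_bigr (fun i => tau * (k * z i - z' i))).
    by rewrite -mulr_sumr sumrB -mulr_sumr e2 e3 mulr0 subr0 mulr0.
  by move=> i _; rewrite -e1; field; rewrite gt_eqF.
exact: (alg _ _ _ _ _ _ _ h z0 z1).
Qed.

(** The prefactor contains the inverse of the root of [E1 + delta0]; together with [r n.+1] it forms
    [xi]. Positivity of [E1 + delta0] makes the root nonzero. *)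
Lemma auxiliary_step : step2 Om lam eps beta theta delta0 tau phi muc p u uh r n ->
  2 * lam * (r n.+1 * (r n.+1 - r n)) =
  tau * ksi * (lam * ip Om F' delta + ip Om q Dv + mxip Om (uh n.+1) pgm
    + mxip Om adv (uh n.+1) + g * mxip Om (grad Om (p n)) (uh n.+1)).
Proof.
rewrite /step2 /xi; move: (_ + _ + _) => I e.
have s0 : 0 < Num.sqrt (E1 Om eps beta P + delta0) by rewrite sqrtr_gt0.
have -> : r n.+1 - r n = tau * ((2 * lam * Num.sqrt (E1 Om eps beta P + delta0))^-1 * I).
  by rewrite -e; field; rewrite gt_eqF.
by field; rewrite !gt_eqF.
Qed.

Let sq_gradE f : H1 Om f ->
  mxL2norm Om (grad Om f) ^+ 2 = \sum_i ip Om (wD Om i f) (wD Om i f).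
Proof.
move=> hf; rewrite mxL2norm_sq (mxip_vec hOm); first by apply: eq_bigr => i _; rewrite gradE.
move=> i; have sw := H1_sqi_wD i hf.
by have := sqi_mul mD sw sw; apply: eq_intg => // x _; rewrite mxE.
Qed.

Let energyE k : H1 Om (phi k) -> (forall i, sqi mu Om (vcomp (u k) i)) ->
  energy Om lam beta phi u r k = 2^-1 * \sum_i ip Om (vcomp (u k) i) (vcomp (u k) i)
    + lam / 2 * \sum_i ip Om (wD Om i (phi k)) (wD Om i (phi k))
    + lam * beta / 2 * ip Om (phi k) (phi k) + lam * r k ^+ 2.
Proof.
move=> hk sk; rewrite /energy (sq_gradE hk) mxL2norm_sq real_normK ?num_real//.
rewrite sqr_sqrtr ?sqi_int_ge0// (mxip_vec hOm)// => i.
exact: (sqi_mul mD (sk i) (sk i)).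
Qed.

Let vgradE (v : X -> X) : H2_H10 Om v ->
  mxL2norm Om (vgrad Om v) ^+ 2 =
  \sum_i \sum_j ip Om (wD Om j (vcomp v i)) (wD Om j (vcomp v i)).
Proof.
move=> hv; have e i j : (fun x => vgrad Om v x i j) = wD Om j (vcomp v i).
  by apply/funext => x; rewrite mxE.
rewrite mxL2norm_sq (mxip_sum hOm).
  by apply: eq_bigr => i _; apply: eq_bigr => j _; rewrite e.
move=> i j; have sw := H1_sqi_wD j (H2_H1 (hv i).1).
by have := sqi_mul mD sw sw; apply: eq_intg => // x _; rewrite mxE.
Qed.

Lemma energy_step : 0 < nu -> 0 < beta ->
  step2 Om lam eps beta theta delta0 tau phi muc p u uh r n ->
  step3 Om nu theta tau p u uh n ->
  energy Om lam beta phi u r n.+1 - energy Om lam beta phi u r n <=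
  - (M * tau * mxL2norm Om (grad Om q) ^+ 2)
  - nu * tau / 2 * (mxL2norm Om (vgrad Om (uh n.+1)) ^+ 2 + mxL2norm Om (vgrad Om (u n.+1)) ^+ 2).
Proof.
move=> nu0 beta0 st2 st3.
have sum_le (I : finType) (a b c : I -> R) : (forall k, a k <= 2^-1 * (b k + c k)) ->
    \sum_k a k <= 2^-1 * (\sum_k b k + \sum_k c k).
  by move=> h; rewrite -big_split mulr_sumr; exact: ler_sum.
have cK : \sum_i ip Om (wD Om i P) (wD Om i P1) <=
    2^-1 * (\sum_i ip Om (wD Om i P) (wD Om i P) + \sum_i ip Om (wD Om i P1) (wD Om i P1)).
  by apply: sum_le => i; apply: (ip_le hOm); apply: H1_sqi_wD; exact: H2_H1.
have cL := ip_le hOm sP sP1.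
have cB : \sum_i ip Om (U i) (H i) <= 2^-1 * (\sum_i ip Om (U i) (U i) + \sum_i ip Om (H i) (H i)).
  by apply: sum_le => i; exact: (ip_le hOm).
have cC : \sum_i ip Om (H i) (U1 i) <= 2^-1 * (\sum_i ip Om (H i) (H i) + \sum_i ip Om (U1 i) (U1 i)).
  by apply: sum_le => i; exact: (ip_le hOm).
have cG : \sum_i \sum_j ip Om (wD Om j (H i)) (wD Om j (U1 i)) <=
    2^-1 * (\sum_i \sum_j ip Om (wD Om j (H i)) (wD Om j (H i)) +
            \sum_i \sum_j ip Om (wD Om j (U1 i)) (wD Om j (U1 i))).
  apply: (sum_le) => i; apply: (sum_le) => j; apply: (ip_le hOm); apply: H1_sqi_wD.
    exact: H2_H1 (hH i).1.
  exact: H2_H1 (hU1 i).1.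
(* Pure algebra from here on: each integral becomes a real variable, constrained by the five tested
   equations and five Young inequalities. *)
have alg (K0 KX K1 L0 LX L1 A0 B AH C A1 GH GX G1 N X1 k I1 I2 I3 I4 I5 g' r0 r1 : R)
    (en0 en1 N' GH' G1' : R) :
    en1 = 2^-1 * A1 + lam / 2 * K1 + lam * beta / 2 * L1 + lam * r1 ^+ 2 ->
    en0 = 2^-1 * A0 + lam / 2 * K0 + lam * beta / 2 * L0 + lam * r0 ^+ 2 ->
    N' = N -> GH' = GH -> G1' = G1 ->
    X1 + k * I2 = - (M * N) ->
    tau * X1 = lam * (K1 - KX) + lam * beta * (L1 - LX) + tau * (lam * k * I1) ->
    tau * (k * (I3 + I4)) = - (AH - B) - tau * nu * GH - tau * (k * g' * I5) ->
    (A1 - C) + tau * nu * (G1 - GX) = 0 ->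
    2 * lam * (r1 * (r1 - r0)) = tau * k * (lam * I1 + I2 + I3 + I4 + g' * I5) ->
    KX <= 2^-1 * (K0 + K1) -> LX <= 2^-1 * (L0 + L1) -> B <= 2^-1 * (A0 + AH) ->
    C <= 2^-1 * (AH + A1) -> GX <= 2^-1 * (GH + G1) ->
    en1 - en0 <= - (M * tau * N') - nu * tau / 2 * (GH' + G1').
  move=> -> -> -> -> -> e1 e2 e3 e4 e5 i1 i2 i3 i4 i5.
  have f1 : M * N = - (X1 + k * I2) by rewrite e1 opprK.
  have f2 : lam * (K1 - KX) + lam * beta * (L1 - LX) = tau * X1 - tau * (lam * k * I1).
    by rewrite e2 addrK.
  have f3 : AH - B = - (tau * nu * GH) - tau * (k * g' * I5) - tau * (k * (I3 + I4)).
    by rewrite e3; ring.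
  (* Sum of the tested equations except that of Step 3: the terms [I1] to [I5], all carrying [xi],
     cancel against the equation of [R]. *)
  have f : (lam * (K1 - KX) + lam * beta * (L1 - LX)) + (AH - B) +
      2 * lam * (r1 * (r1 - r0)) + tau * (M * N) + tau * nu * GH = 0.
    by rewrite f1 f2 f3 e5; ring.
  (* The slack consists of the Young defects and [lam (r1 - r0)^2], minus two expressions that
     vanish. The factor 1/2 of the viscous dissipation arises here: prediction yields [GH],
     projection yields [G1 - GX], and [GX <= (GH + G1) / 2] leaves half of [GH + G1]. *)
  rewrite -subr_ge0 [X in 0 <= X](_ : _ = lam * (2^-1 * (K0 + K1) - KX) + lam * beta * (2^-1 * (L0 + L1) - LX)
    + (2^-1 * (A0 + AH) - B) + (2^-1 * (AH + A1) - C) + tau * nu * (2^-1 * (GH + G1) - GX)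
    + lam * (r1 - r0) ^+ 2
    - ((lam * (K1 - KX) + lam * beta * (L1 - LX)) + (AH - B) +
       2 * lam * (r1 * (r1 - r0)) + tau * (M * N) + tau * nu * GH)
    - ((A1 - C) + tau * nu * (G1 - GX))); last by field.
  have [[lam0' beta0'] [nu0' tau0']] := ((ltW lam0, ltW beta0), (ltW nu0, ltW tau0)).
  rewrite f e4 !subr0; by do ?[by rewrite subr_ge0|exact: sqr_ge0|apply: addr_ge0|apply: mulr_ge0].
exact: (alg _ _ _ _ _ _ _ _ _ _ _ _ _ _ _ _ _ _ _ _ _ _ _ _ _ _ _ _ _ _
  (energyE (H2_H1 hP1) sU1) (energyE (H2_H1 hP) sU) (sq_gradE (H2_H1 hq)) (vgradE hH) (vgradE hU1)
  potential_step chemical_step momentum_step (projection_step st3) (auxiliary_step st2) cK cL cB cC cG).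
Qed.

End one_step.

Theorem theorem2 (R : realType) (d : nat) (hd : d = 2%N \/ d = 3%N)
  (Om : set 'rV[R]_d) (m : nat) (nrm : 'I_m -> 'rV[R]_d) (off : 'I_m -> R)
  (hOm : convex_polytope Om nrm off)
  (M lam nu eps beta theta delta0 T : R)
  (hM : 0 < M) (hlam : 0 < lam) (hnu : 0 < nu) (heps : 0 < eps)
  (hbeta : 0 < beta) (htheta : 0 < theta) (hdelta0 : 0 < delta0)
  (hE1 : forall f, H2 Om f -> 0 < E1 Om eps beta f + delta0)
  (hT : 0 < T) (Nt : nat) (hNt : (0 < Nt)%N)
  (phi muc p : nat -> 'rV[R]_d -> R) (u uh : nat -> 'rV[R]_d -> 'rV[R]_d)
  (r : nat -> R)
  (hsol : ivs_solution Om nrm off M lam nu eps beta theta delta0 (T / Nt%:R)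
            phi muc p u uh r Nt) :
  (forall n, (n < Nt)%N -> ip Om (phi n.+1) (cst 1) = ip Om (phi n) (cst 1)) /\
  (forall n, (n < Nt)%N ->
    energy Om lam beta phi u r n.+1 - energy Om lam beta phi u r n <=
    - (M * (T / Nt%:R) * mxL2norm Om (grad Om (muc n.+1)) ^+ 2)
    - nu * (T / Nt%:R) / 2 *
        (mxL2norm Om (vgrad Om (uh n.+1)) ^+ 2
         + mxL2norm Om (vgrad Om (u n.+1)) ^+ 2)).
Proof.
case: hsol => adm steps; have tau0 : 0 < T / Nt%:R by rewrite divr_gt0 ?ltr0n.
have E n : (n < Nt)%N -> 0 < E1 Om eps beta (phi n) + delta0.
  by move=> hn; have [[h _] _ _ _ _] := adm n (ltnW hn); exact: hE1.
split=> n hn; have [hH st1 st2 st3] := steps n hn.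
  exact: (mass_step hOm hd tau0 (adm n (ltnW hn)) (adm n.+1 hn) st1).
exact: (energy_step hOm hd hlam heps tau0 (adm n (ltnW hn)) (adm n.+1 hn) hH st1 (E n hn)
  hnu hbeta st2 st3).
Qed.
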